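(* Let $v_j=v_j(s)$, $j=1,\dots,n-1$, be distributions in the variable $s$ in a neighborhood of $0\in\mathbb{R}^{n-1}$. If the equations $$\partial_{\overline z}f=0,\qquad (\partial_{t^j}-z\,\partial_{s^j})f=v_j(s)\quad (j=1,\dots,n-1)$$ have a distribution solution $f$ near $(z,s,t)=(0,0,0)$ in $\mathbb{C}\times\mathbb{R}^{n-1}\times\mathbb{R}^{n-1}$, then the $v_j(s)$ are real analytic near $s=0$.
   Context: Coordinates are $(z,s,t)\in\mathbb{C}\times\mathbb{R}^{n-1}\times\mathbb{R}^{n-1}$ with $s=(s^1,\dots,s^{n-1})$, $t=(t^1,\dots,t^{n-1})$, and $\partial_{\overline z}=\tfrac12(\partial_x+i\partial_y)$ for $z=x+iy$. Distributions are complex-valued. On the right-hand side of the second equation, $v_j(s)$ is regarded as a distribution in $(z,s,t)$ depending only on $s$ (its pullback under the projection $(z,s,t)\mapsto s$). *)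

(* Defs.v *)
From HB Require Import structures.
From mathcomp Require Import all_boot all_order all_algebra.
From mathcomp Require Import all_classical all_reals all_analysis.
From mathcomp.real_closed Require Import complex.

Set Implicit Arguments.
Unset Strict Implicit.
Unset Printing Implicit Defensive.

Import Order.TTheory GRing.Theory Num.Theory.
Import numFieldNormedType.Exports.

Local Open Scope classical_set_scope.
Local Open Scope ring_scope.
Local Open Scope complex_scope.

Section Distributions.
Context {R : realType} {V : normedModType R}.
Implicit Types (phi psi : V -> R[i]) (u w : (V -> R[i]) -> R[i]).

Definition Cderive (v : V) phi : V -> R[i] :=
  fun x => 'D_v (fun y => complex.Re (phi y)) x +i* 'D_v (fun y => complex.Im (phi y)) x.

Definition Cderives (vs : seq V) phi : V -> R[i] := foldr Cderive phi vs.

(* On a finite-dimensional V (the only case used) this is C^oo: differentiability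
   of all the iterated derivatives implies their continuity. *)
Definition smooth phi : Prop :=
  forall (vs : seq V) (x : V),
    differentiable (fun y => complex.Re (Cderives vs phi y)) x /\
    differentiable (fun y => complex.Im (Cderives vs phi y)) x.

Definition test_fun_in (K : set V) phi : Prop :=
  smooth phi /\ forall x, ~ K x -> phi x = 0.

Definition test_fun (Omega : set V) phi : Prop :=
  exists K : set V, [/\ compact K, K `<=` Omega & test_fun_in K phi].

(* B is an upper bound of the C^N norm of phi; derivatives along all vectors of
   norm at most 1 are equivalent, up to a constant depending on N and dim V, to
   the partial derivatives in a basis. *)
Definition CN_norm_le (N : nat) phi (B : R) : Prop :=
  forall vs : seq V, (size vs <= N)%N -> (forall v, v \in vs -> `|v| <= 1) ->
    forall x, Normc.normc (Cderives vs phi x) <= B.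

(* A distribution on Omega is represented by a functional on all functions
   V -> R[i]; only its values on test functions supported in Omega matter. *)
Definition is_distribution (Omega : set V) u : Prop :=
  (forall (a : R[i]) phi psi, test_fun Omega phi -> test_fun Omega psi ->
     u (fun x => a * phi x + psi x) = a * u phi + u psi) /\
  (forall K : set V, compact K -> K `<=` Omega ->
     exists (C : R) (N : nat), forall phi (B : R),
       test_fun_in K phi -> CN_norm_le N phi B ->
       Normc.normc (u phi) <= C * B).

Definition dist_eq (Omega : set V) u w : Prop :=
  forall phi, test_fun Omega phi -> u phi = w phi.

Definition dist_zero : (V -> R[i]) -> R[i] := fun=> 0.

Definition dist_add u w : (V -> R[i]) -> R[i] := fun phi => u phi + w phi.

Definition dist_sub u w : (V -> R[i]) -> R[i] := fun phi => u phi - w phi.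

Definition dist_mul (a : V -> R[i]) u : (V -> R[i]) -> R[i] :=
  fun phi => u (fun x => a x * phi x).

Definition dist_derive (v : V) u : (V -> R[i]) -> R[i] :=
  fun phi => - u (Cderive v phi).

End Distributions.

Section Integration.
Context {R : realType}.

Definition Cintegral (F : R -> R[i]) : R[i] :=
  (\int[lebesgue_measure]_x complex.Re (F x)) +i* (\int[lebesgue_measure]_x complex.Im (F x)).

(* Integral over R^m as an iterated one-variable Lebesgue integral; by Fubini it
   is the integral for Lebesgue measure on continuous compactly supported
   functions, the only ones it is applied to. *)
Fixpoint Cintegral_rV (m : nat) : ('rV[R]_m -> R[i]) -> R[i] :=
  match m with
  | 0 => fun F => F 0
  | k.+1 => fun F =>
      Cintegral (fun x => Cintegral_rV (fun y : 'rV[R]_k =>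
        F (row_mx (x%:M : 'rV[R]_1) y : 'rV[R]_(1 + k))))
  end.

Definition dist_of_fun (m : nat) (g : 'rV[R]_m -> R[i]) :
    ('rV[R]_m -> R[i]) -> R[i] :=
  fun phi => Cintegral_rV (fun s => g s * phi s).

End Integration.

Section RealAnalytic.
Context {R : realType} {m : nat}.

Definition monomial (y : 'rV[R]_m) (alpha : 'I_m -> nat) : R[i] :=
  (\prod_(i < m) y 0 i ^+ alpha i)%:C.

(* The power series \sum_alpha c_alpha y^alpha converges absolutely, with sum l;
   given absolute convergence, the partial sums over the boxes
   {alpha | alpha_i < N for all i} converge to the sum of the series. *)
Definition pseries_abs_sum (c : ('I_m -> nat) -> R[i]) (y : 'rV[R]_m)
    (l : R[i]) : Prop :=
  (exists M : R, forall N : nat,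
     \sum_(alpha : {ffun 'I_m -> 'I_N})
       Normc.normc (c (fun i => alpha i) * monomial y (fun i => alpha i)) <= M)
  /\
  ((fun N : nat => \sum_(alpha : {ffun 'I_m -> 'I_N})
     c (fun i => alpha i) * monomial y (fun i => alpha i)) : nat -> R[i]^o)
    @ \oo --> (l : R[i]^o).

Definition real_analytic (W : set 'rV[R]_m) (g : 'rV[R]_m -> R[i]) : Prop :=
  forall a, W a -> exists (c : ('I_m -> nat) -> R[i]) (r : R), 0 < r /\
    forall s, `|s - a| < r -> pseries_abs_sum c (s - a) (g s).

Definition dist_real_analytic_near (U : set 'rV[R]_m)
    (u : ('rV[R]_m -> R[i]) -> R[i]) (a : 'rV[R]_m) : Prop :=
  exists (W : set 'rV[R]_m) (g : 'rV[R]_m -> R[i]),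
    [/\ open W, W a, W `<=` U, real_analytic W g & dist_eq W u (dist_of_fun g)].

End RealAnalytic.

(* The point (z, s, t) with z = x + iy is represented by ((x, y), s, t). *)
Definition zst_space (R : realType) (m : nat) : normedModType R :=
  ((R * R) * 'rV[R]_m * 'rV[R]_m)%type.

Section Coordinates.
Context {R : realType} {m : nat}.
Local Notation E := (zst_space R m).
Implicit Types (f : (E -> R[i]) -> R[i]).

Definition zst (x y : R) (s t : 'rV[R]_m) : E := ((x, y), s, t).

Definition z_coord (p : E) : R[i] := p.1.1.1 +i* p.1.1.2.

Definition s_proj (p : E) : 'rV[R]_m := p.1.2.

Definition dist_dx f := dist_derive (zst 1 0 0 0) f.

Definition dist_dy f := dist_derive (zst 0 1 0 0) f.

Definition dist_ds (j : 'I_m) f := dist_derive (zst 0 0 (delta_mx 0 j) 0) f.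

Definition dist_dt (j : 'I_m) f := dist_derive (zst 0 0 0 (delta_mx 0 j)) f.

Definition dist_dzbar f : (E -> R[i]) -> R[i] :=
  dist_mul (fun=> 2^-1) (dist_add (dist_dx f) (dist_mul (fun=> 0 +i* 1) (dist_dy f))).

(* Pullback under s_proj: integrate the test function over the fibers. *)
Definition dist_pullback_s (u : ('rV[R]_m -> R[i]) -> R[i]) :
    (E -> R[i]) -> R[i] :=
  fun phi => u (fun s => Cintegral (fun x => Cintegral (fun y =>
    Cintegral_rV (fun t => phi (zst x y s t))))).

End Coordinates.

(* Main.v *)
(* For a fixed j put G_k(psi, X) = f(omega_k(z) psi(s) (d_j X)(t)), where
   omega_k = kappa(z) / z^k and kappa >= 0 is a bump supported in an annulus, such
   that z kappa(z) is a multiple of the d-bar derivative of a compactly supported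
   function. The equations for f give
     G_{k+1}(psi, d_i X) = G_k(d_i psi, X)  and  G_0(psi, X) = - c (int X) v_j(psi)
   with c = int kappa > 0. Replacing X by a k-fold finite difference, with step
   h ~ 1/k, of a fixed bump and iterating turns this into
     h^k c (int X) |v_j(d^beta psi)| <= C A^k |psi|_{C^N},   k = |beta|,
   that is |v_j(d^beta psi)| <= C A^k k! |psi|_{C^N}.

   A functional u with such bounds is an analytic function. Let
   chi_{a,sigma}(s) = e^{m sigma} chi(e^sigma (s - a)); the sigma-derivative of
   chi_{a,sigma} is e^{-sigma} times a divergence, so u(d^beta chi_{a,sigma}),
   a priori of growth e^{p sigma}, is by integration in sigma of growth
   e^{(p-1) sigma}, and in finitely many steps it is bounded and converges at rate
   e^{-sigma} to (int chi) g_beta(a), with |g_beta| <= C A^k k!. Hence g = g_0 has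
   convergent Taylor series, and decomposing a test function phi with a partition
   of unity at scale e^{-sigma} shows u(phi) = int g phi. *)
Require Import Defs.
From HB Require Import structures.
From mathcomp Require Import all_boot all_order all_algebra.
From mathcomp Require Import all_classical all_reals all_analysis.
From mathcomp.real_closed Require Import complex.
From mathcomp Require Import ring lra zify.

Import Order.TTheory GRing.Theory Num.Theory.
Import numFieldNormedType.Exports.

Set Implicit Arguments.
Unset Strict Implicit.
Unset Printing Implicit Defensive.

Local Open Scope classical_set_scope.
Local Open Scope ring_scope.

(** * Iterated directional derivatives *)

Section Calculus.
Context {R : realType} {V W : normedModType R}.
Implicit Types (f g : V -> R) (x v u : V).

(** The factor d_j X, rather than X, removes the right-hand sides: the equation of index i
    contributes v_i(psi) times the integral of d_j X, which is 0, so the relation between G_{k+1}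
    and G_k is homogeneous for every i. Only G_0 uses the equation of index j with X itself; there
    the term f(z omega_0 (d_j psi) X) vanishes because z kappa is a d-bar derivative, and v_j
    appears. Taking X = d^beta chi with a fixed bump chi would estimate v_j(d^beta psi) by
    derivatives of chi, and those cannot all be bounded by A^k k!, since chi would then be analytic
    with compact support. A k-fold difference of a bump has C^N norm at most 2^k times that of the
    bump, and h^-k with h ~ 1/k costs only A^k k!. Replacing derivatives by differences loses
    nothing: v_j does not depend on t, so G_0 sees X only through its integral and is unchanged when
    X is translated. The annulus keeps 1/z^k smooth on the support of kappa; with N fixed, the C^N
    norm of omega_k grows geometrically in k. *)

Lemma derive_comp (f : W -> R) (F : V -> W) x v :
  differentiable F x -> differentiable f (F x) ->
  'D_v (fun y => f (F y)) x = 'D_('D_v F x) f (F x).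
Proof.
move=> dF df; rewrite (deriveE _ dF) (deriveE _ df).
have -> : (fun y => f (F y)) = f \o F by [].
by rewrite (deriveE _ (differentiable_comp dF df)) (diff_comp dF df).
Qed.

Lemma is_derive_comp_curve (f : W -> R) (c : R -> W) (t : R) (c' : W) :
  is_derive t (1 : R) c c' -> differentiable f (c t) ->
  is_derive t (1 : R) (fun s => f (c s)) ('D_c' f (c t)).
Proof.
move=> dc df.
have dct : differentiable c t by apply/derivable1_diffP.
have ec' : 'd c t 1 = c' by rewrite -deriveE // derive_val.
apply: DeriveDef.
  by apply/derivable1_diffP; exact: (differentiable_comp dct df).
have -> : (fun s => f (c s)) = f \o c by [].
rewrite (deriveE _ df) (deriveE _ (differentiable_comp dct df)) (diff_comp dct df).
by rewrite -[in RHS]ec'.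
Qed.

Lemma derivative_scale f x (a : R) v : differentiable f x ->
  'D_(a *: v) f x = a * 'D_v f x.
Proof. by move=> df; rewrite !deriveE // linearZ. Qed.

Lemma derivative_sum (I : Type) (r : seq I) (F : I -> V) f x :
  differentiable f x ->
  'D_(\sum_(i <- r) F i) f x = \sum_(i <- r) 'D_(F i) f x.
Proof.
by move=> df; rewrite deriveE // linear_sum; apply: eq_bigr => i _; rewrite deriveE.
Qed.

Lemma is_derive_line f x v (t : R) : differentiable f (x + t *: v) ->
  is_derive t (1 : R) (fun s => f (x + s *: v)) ('D_v f (x + t *: v)).
Proof.
move=> df.
have E : (fun h : R => h^-1 *: (f (x + (h *: (1 : R) + t) *: v) - f (x + t *: v))) =
         (fun h : R => h^-1 *: (f (h *: v + (x + t *: v)) - f (x + t *: v))).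
  by apply/funext => h /=; rewrite scalerDl [h%:A]mulr1 addrCA.
have d : derivable f (x + t *: v) v by exact: diff_derivable.
split; first by move: d; rewrite /derivable -E.
by rewrite /derive -E.
Qed.

End Calculus.

(** * Mean value estimates on the line *)

Section MeanValue.
Context {R : realType}.
Implicit Types (f df : R -> R) (a b : R).

Lemma mean_value f df a b : a <= b ->
  (forall x, a <= x <= b -> is_derive x 1 f (df x)) ->
  exists2 c, a <= c <= b & f b - f a = df c * (b - a).
Proof.
move=> ab dfP; have [||c] := @MVT_segment R f df a b ab.
- by move=> x; rewrite in_itv /= => /andP[/ltW ax /ltW xb]; apply: dfP; rewrite ax.
- by apply: derivable_within_continuous => x; rewrite in_itv /= => /dfP [].
- by rewrite in_itv /=; exists c.
Qed.

(** For each sign [s] the function [g - s * f] has nonnegative derivative. This replaces the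
    integration of a bound on [df]: growth estimates in the scale parameter are read off an explicit
    majorant [g]. *)
Lemma le_of_derivative_le f df g dg a b : a <= b ->
  (forall x, a <= x <= b -> is_derive x 1 f (df x)) ->
  (forall x, a <= x <= b -> is_derive x 1 g (dg x)) ->
  (forall x, a <= x <= b -> `|df x| <= dg x) ->
  `|f b - f a| <= g b - g a.
Proof.
move=> ab dfP dgP le.
have H (s : R) : `|s| = 1 -> s * (f b - f a) <= g b - g a.
  move=> s1.
  have [|c cab E] := @mean_value (fun x => g x - s * f x) (fun x => dg x - s * df x) a b ab.
    move=> x xab; have ? := dfP x xab; have ? := dgP x xab.
    have -> : (fun y => g y - s * f y) = (g - (s *: f)) by [].
    by apply: is_deriveB.
  suff : 0 <= (g b - s * f b) - (g a - s * f a) by rewrite subr_ge0; lra.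
  rewrite E mulr_ge0 ?subr_ge0 //; apply: le_trans (le c cab).
  by rewrite (le_trans (ler_norm _)) // normrM s1 mul1r.
rewrite ler_norml -[f b - f a]mul1r H ?normr1 // andbT.
by have := H (- 1); rewrite normrN1 => /(_ erefl); lra.
Qed.

Lemma dist_le_of_derivative_bound f df a b (M : R) :
  (forall x, Num.min a b <= x <= Num.max a b -> is_derive x 1 f (df x)) ->
  (forall x, Num.min a b <= x <= Num.max a b -> `|df x| <= M) ->
  `|f b - f a| <= M * `|b - a|.
Proof.
wlog ab : a b / a <= b => [W|].
  have [ab|] := boolP (a <= b); first exact: W.
  rewrite -ltNge => /ltW ba dP le.
  rewrite distrC [`|b - a|]distrC; apply: W => // x.
    by rewrite minC maxC; exact: dP.
  by rewrite minC maxC; exact: le.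
rewrite (min_idPl ab) (max_idPr ab) => dP le.
rewrite [`|b - a|]ger0_norm ?subr_ge0 //.
have := @le_of_derivative_le f df (fun x => M * x) (fun=> M) a b ab dP _ le.
rewrite mulrBr; apply => x _.
have -> : (fun y => M * y) = M *: (@id R) by [].
by apply: is_derive_eq; rewrite scaler1.
Qed.

End MeanValue.

Section IteratedDerivatives.
Context {R : realType} {V : normedModType R}.
Implicit Types (phi psi : V -> R) (v u x : V) (vs : seq V).

Definition rderives vs phi : V -> R := foldr (fun v f x => 'D_v f x) phi vs.

Definition rsmooth phi := forall vs x, differentiable (rderives vs phi) x.

Lemma rderives_cat vs1 vs2 phi :
  rderives (vs1 ++ vs2) phi = rderives vs1 (rderives vs2 phi).
Proof. exact: foldr_cat. Qed.

Lemma rderives_rcons vs v phi :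
  rderives (rcons vs v) phi = rderives vs (fun x => 'D_v phi x).
Proof. exact: foldr_rcons. Qed.

Lemma rsmooth_differentiable phi x : rsmooth phi -> differentiable phi x.
Proof. by move=> /(_ [::] x). Qed.

Lemma rsmooth_derive v phi : rsmooth phi -> rsmooth (fun x => 'D_v phi x).
Proof. by move=> sp vs x; rewrite -rderives_rcons. Qed.

Lemma rsmooth_derives vs phi : rsmooth phi -> rsmooth (rderives vs phi).
Proof. by move=> sp us x; rewrite -rderives_cat. Qed.

Lemma rsmooth_continuous phi : rsmooth phi -> continuous phi.
Proof. by move=> sp x; apply: differentiable_continuous; apply: rsmooth_differentiable. Qed.

(** A coinduction principle: every iterated derivative of a member of [P] stays in [P], hence is
    differentiable. *)
Lemma rsmooth_class (P : (V -> R) -> Prop) :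
  (forall phi, P phi -> forall x, differentiable phi x) ->
  (forall phi, P phi -> forall v, P (fun x => 'D_v phi x)) ->
  forall phi, P phi -> rsmooth phi.
Proof.
move=> Pd PD phi Pphi vs.
by apply: Pd; elim: vs => //= v vs IH; exact: PD.
Qed.

Lemma second_difference phi x u v (h : R) : 0 <= h -> rsmooth phi ->
  exists s t, [/\ 0 <= s <= h, 0 <= t <= h &
    phi (x + h *: u + h *: v) - phi (x + h *: u) - (phi (x + h *: v) - phi x) =
    h * h * 'D_v (fun y => 'D_u phi y) (x + s *: u + t *: v)].
Proof.
move=> h0 sp.
have := @mean_value R (fun s => phi (x + h *: v + s *: u) - phi (x + s *: u))
  (fun s => 'D_u phi (x + h *: v + s *: u) - 'D_u phi (x + s *: u)) 0 h h0.
case=> [s _|s sh].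
  by apply: is_deriveB; apply: is_derive_line; exact: rsmooth_differentiable.
rewrite !scale0r !addr0 subr0 => E1.
have := @mean_value R (fun t => 'D_u phi (x + s *: u + t *: v))
  (fun t => 'D_v (fun y => 'D_u phi y) (x + s *: u + t *: v)) 0 h h0.
case=> [t _|t th].
  by apply: is_derive_line; apply: rsmooth_differentiable; apply: rsmooth_derive.
rewrite !scale0r !addr0 subr0 => E2.
exists s, t; split => //.
rewrite -mulrA [h * 'D_v _ _]mulrC -E2 mulrC.
rewrite [x + s *: u + h *: v]addrAC -E1 [x + h *: u + h *: v]addrAC.
by ring.
Qed.

(** Schwarz's theorem. The same second difference over the parallelogram with sides [h *: u] and
    [h *: v] equals [h * h] times either mixed derivative at some nearby point, and both mixed
    derivatives are continuous. *)
Lemma derive_comm phi u v : rsmooth phi ->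
  (fun x => 'D_u (fun y => 'D_v phi y) x) = (fun x => 'D_v (fun y => 'D_u phi y) x).
Proof.
move=> sp; apply/funext => x.
have ct (w z : V) : {for x, continuous (fun y => 'D_w (fun y => 'D_z phi y) y)}.
  by apply: rsmooth_continuous; do 2 apply: rsmooth_derive.
apply/eqP; rewrite -subr_eq0 -normr_le0; apply/ler_addgt0Pr => e e0; rewrite add0r.
have e2 : 0 < e / 2 by rewrite divr_gt0.
have /cvgrPdist_le/(_ _ e2)/nbhs_ballP[d1 /= d10 B1] := ct u v.
have /cvgrPdist_le/(_ _ e2)/nbhs_ballP[d2 /= d20 B2] := ct v u.
set d := Num.min d1 d2; have d0 : 0 < d by rewrite lt_min d10 d20.
have le1 : d <= d1 by rewrite ge_min lexx.
have le2 : d <= d2 by rewrite ge_min lexx orbT.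
(* Keeps the whole parallelogram within distance [d] of [x]; the summand 1 makes the divisor
   positive even if [u] and [v] vanish. *)
set h := d / 2 / (1 + `|u| + `|v|).
have h0 : 0 < h by rewrite !divr_gt0.
have near s t w z : (w = u /\ z = v) \/ (w = v /\ z = u) -> 0 <= s <= h -> 0 <= t <= h ->
    `|x - (x + s *: w + t *: z)| < d.
  move=> wz /andP[s0 sh] /andP[t0 th].
  rewrite -addrA opprD addNKr normrN.
  have H : h * (1 + `|u| + `|v|) < d.
    by rewrite /h divfK ?gt_eqF // ltr_pdivrMr // ltr_pMr // ltr1n.
  apply: le_lt_trans H; apply: le_trans (ler_normD _ _) _.
  rewrite !normrZ !ger0_norm //.
  have nu := normr_ge0 u; have nv := normr_ge0 v.
  by case: wz => -[-> ->]; nra.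
have [s [t [sh th E1]]] := @second_difference phi x u v h (ltW h0) sp.
have [s' [t' [sh' th' E2]]] := @second_difference phi x v u h (ltW h0) sp.
have E : 'D_v (fun y => 'D_u phi y) (x + s *: u + t *: v) =
         'D_u (fun y => 'D_v phi y) (x + s' *: v + t' *: u).
  apply: (@mulfI _ (h * h)); first by rewrite mulf_neq0 // gt_eqF.
  apply: (eq_trans (esym E1)); apply: (eq_trans _ E2).
  by rewrite [x + h *: u + h *: v]addrAC; ring.
have := B2 (x + s *: u + t *: v); have := B1 (x + s' *: v + t' *: u).
rewrite -!ball_normE /= E => H1 H2.
have {}H1 := H1 (lt_le_trans (near _ _ _ _ (or_intror (conj erefl erefl)) sh' th') le1).
have {}H2 := H2 (lt_le_trans (near _ _ _ _ (or_introl (conj erefl erefl)) sh th) le2).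
move: H1 H2; set A := 'D_u _ x; set B := 'D_v _ x; set C := 'D_u _ _.
move: A B C => A B C H1 H2.
rewrite (_ : A - B = (A - C) - (B - C)); last by ring.
by apply: (le_trans (ler_normB _ _)); rewrite [leRHS]splitr; apply: lerD.
Qed.

Lemma derive_rderives phi v vs : rsmooth phi ->
  (fun x => 'D_v (rderives vs phi) x) = rderives vs (fun x => 'D_v phi x).
Proof.
move=> sp; elim: vs => //= u vs <-.
by apply: derive_comm; exact: rsmooth_derives.
Qed.

End IteratedDerivatives.

(** * Affine changes of variable *)

Section AffineMaps.
Context {R : realType} {V W : normedModType R}.
Implicit Types (L A : V -> W) (c : R).

(** [A] is the linear part of [L]: it transports directions of differentiation. The bound [c] gives
    continuity of [A], and is the factor by which composition with [L] multiplies weights. *)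
Definition affine_map L A c := (forall (h : R) x v, L (h *: v + x) = h *: A v + L x) /\
  (forall v, `|A v| <= c * `|v|).

Lemma affine_map_derive L A c x v : affine_map L A c -> 'D_v L x = A v.
Proof.
move=> [LA _]; rewrite /derive; apply: lim_near_cst => //.
near=> h; rewrite /= LA addrK scalerA mulVf ?scale1r //.
by near: h; exact: nbhs_dnbhs_neq.
Unshelve. all: by end_near. Qed.

Lemma affine_map_differentiable L A c x : affine_map L A c -> differentiable L x.
Proof.
move=> [LA bA].
have AE v : A v = L v - L 0 by have := LA 1 0 v; rewrite !scale1r addr0 => ->; rewrite addrK.
have linA : linear A.
  by move=> h u v; rewrite [in LHS]AE LA [A v]AE addrA.
pose scallM := GRing.isLinear.Build _ _ _ _ _ linA.
pose F : {linear V -> W} := HB.pack A scallM.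
have -> : L = (F : V -> W) + cst (L 0).
  by apply/funext => v; rewrite /= -[LHS](subrK (L 0)) -AE.
apply: differentiableD => //; apply: linear_differentiable.
apply: bounded_linear_continuous; apply/linear_boundedP.
apply: filterS (nbhs_pinfty_ge (num_real c)) => r cr v.
by apply: (le_trans (bA v)); rewrite ler_wpM2r.
Qed.

Lemma rderives_comp_affine L A c (phi : W -> R) vs : affine_map L A c -> rsmooth phi ->
  rderives vs (fun x => phi (L x)) = (fun x => rderives (map A vs) phi (L x)).
Proof.
move=> hL sp; elim: vs => //= v vs ->; apply/funext => x.
have dL := affine_map_differentiable x hL.
have dp : differentiable (rderives (map A vs) phi) (L x).
  by apply: rsmooth_differentiable; exact: rsmooth_derives.
by rewrite (derive_comp _ dL dp) (affine_map_derive _ _ hL).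
Qed.

Lemma rsmooth_comp_affine L A c (phi : W -> R) : affine_map L A c -> rsmooth phi ->
  rsmooth (fun x => phi (L x)).
Proof.
move=> hL sp vs x; rewrite (rderives_comp_affine _ hL) //.
apply: (@differentiable_comp _ _ _ _ L); first exact: (affine_map_differentiable x hL).
by apply: rsmooth_differentiable; exact: rsmooth_derives.
Qed.

End AffineMaps.

(** * Closure properties of smooth functions *)

Section SmoothClosure.
Context {R : realType} {V : normedModType R}.
Implicit Types (phi psi : V -> R) (v u x : V) (vs : seq V).

(** The sum, product, chain and quotient rules express a derivative of a generated function by the
    same operations, so the class is stable under differentiation and [rsmooth_class] applies to it.
    A direct induction on the number of derivatives for products or inverses is thereby avoided. *)
Inductive smooth_closure : (V -> R) -> Prop :=
| closure_base phi : rsmooth phi -> smooth_closure phi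
| closure_add phi psi : smooth_closure phi -> smooth_closure psi ->
    smooth_closure (fun x => phi x + psi x)
| closure_mul phi psi : smooth_closure phi -> smooth_closure psi ->
    smooth_closure (fun x => phi x * psi x)
| closure_comp (g : R -> R) phi : rsmooth g -> smooth_closure phi ->
    smooth_closure (fun x => g (phi x))
| closure_inv phi : (forall x, phi x != 0) -> smooth_closure phi ->
    smooth_closure (fun x => (phi x)^-1).

Lemma rsmooth_cst (a : R) : rsmooth (fun _ : V => a).
Proof.
have H : exists b : R, (fun _ : V => a) = cst b by exists a.
apply: (rsmooth_class (P := fun phi => exists b : R, phi = cst b)) H.
  by move=> phi [b ->] x; exact: differentiable_cst.
move=> phi [b ->] v; exists 0; apply/funext => x.
by rewrite derive_cst.
Qed.

Lemma smooth_closure_differentiable phi x : smooth_closure phi -> differentiable phi x.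
Proof.
move=> cp; elim: cp x => {phi} [phi sp|phi psi _ H1 _ H2|phi psi _ H1 _ H2|g phi sg _ H|phi n0 _ H] x.
- exact: rsmooth_differentiable.
- exact: differentiableD.
- exact: differentiableM.
- by apply: (differentiable_comp (H x)); exact: rsmooth_differentiable.
- exact: differentiableV.
Qed.

Lemma derive_comp1 (g : R -> R) phi x v : rsmooth g -> differentiable phi x ->
  'D_v (fun y => g (phi y)) x = 'D_v phi x * 'D_1 g (phi x).
Proof.
move=> sg dp; rewrite derive_comp //; last exact: rsmooth_differentiable.
by rewrite -derivative_scale ?scaler1 ?[_ *: _]mulr1 //; exact: rsmooth_differentiable.
Qed.

Lemma smooth_closure_derive phi v : smooth_closure phi ->
  smooth_closure (fun x => 'D_v phi x).
Proof.
move=> cp; elim: cp => {phi} [phi sp|phi psi c1 H1 c2 H2|phi psi c1 H1 c2 H2|g phi sg c H|phi n0 c H].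
- by apply: closure_base; exact: rsmooth_derive.
- have -> : (fun x => 'D_v (fun x => phi x + psi x) x) = (fun x => 'D_v phi x + 'D_v psi x).
    apply/funext => x; rewrite -deriveD //;
    by apply: diff_derivable; exact: smooth_closure_differentiable.
  exact: closure_add.
- have -> : (fun x => 'D_v (fun x => phi x * psi x) x) =
     (fun x => phi x * 'D_v psi x + psi x * 'D_v phi x).
    apply/funext => x; rewrite (@deriveM _ _ phi psi) //;
    by apply: diff_derivable; exact: smooth_closure_differentiable.
  by apply: closure_add; exact: closure_mul.
- have -> : (fun x => 'D_v (fun x => g (phi x)) x) = (fun x => 'D_v phi x * 'D_1 g (phi x)).
    by apply/funext => x; apply: derive_comp1 => //; exact: smooth_closure_differentiable.
  apply: closure_mul => //; apply: (@closure_comp (fun y => 'D_1 g y)) => //.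
  exact: rsmooth_derive.
- have -> : (fun x => 'D_v (fun x => (phi x)^-1) x) =
     (fun x => (-1) * (((phi x)^-1 * (phi x)^-1) * 'D_v phi x)).
    apply/funext => x; rewrite deriveV //; last first.
      by apply: diff_derivable; exact: smooth_closure_differentiable.
    by rewrite -exprVn expr2 mulN1r scaleNr.
  apply: closure_mul; first by apply: closure_base; exact: rsmooth_cst.
  by apply: closure_mul => //; apply: closure_mul; exact: closure_inv.
Qed.

Lemma rsmooth_closure phi : smooth_closure phi -> rsmooth phi.
Proof.
apply: rsmooth_class => {}phi cp; first by move=> x; exact: smooth_closure_differentiable.
by move=> v; exact: smooth_closure_derive.
Qed.

Lemma rsmooth_add phi psi : rsmooth phi -> rsmooth psi -> rsmooth (fun x => phi x + psi x).
Proof. by move=> s1 s2; apply: rsmooth_closure; apply: closure_add; exact: closure_base. Qed.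

Lemma rsmooth_mul phi psi : rsmooth phi -> rsmooth psi -> rsmooth (fun x => phi x * psi x).
Proof. by move=> s1 s2; apply: rsmooth_closure; apply: closure_mul; exact: closure_base. Qed.

Lemma rsmooth_comp (g : R -> R) phi : rsmooth g -> rsmooth phi -> rsmooth (fun x => g (phi x)).
Proof. by move=> s1 s2; apply: rsmooth_closure; apply: closure_comp => //; exact: closure_base. Qed.

Lemma rsmooth_inv phi : (forall x, phi x != 0) -> rsmooth phi -> rsmooth (fun x => (phi x)^-1).
Proof. by move=> s1 s2; apply: rsmooth_closure; apply: closure_inv => //; exact: closure_base. Qed.

Lemma rsmooth_scale a phi : rsmooth phi -> rsmooth (fun x => a * phi x).
Proof. by apply: rsmooth_mul; exact: rsmooth_cst. Qed.

Lemma rsmooth_opp phi : rsmooth phi -> rsmooth (fun x => - phi x).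
Proof.
move=> sp; have -> : (fun x => - phi x) = (fun x => (-1) * phi x).
  by apply/funext => x; rewrite mulN1r.
exact: rsmooth_scale.
Qed.

Lemma rsmooth_sub phi psi : rsmooth phi -> rsmooth psi -> rsmooth (fun x => phi x - psi x).
Proof. by move=> s1 s2; apply: rsmooth_add => //; exact: rsmooth_opp. Qed.

Lemma rsmooth_sum (I : Type) (r : seq I) (F : I -> V -> R) :
  (forall i, rsmooth (F i)) -> rsmooth (fun x => \sum_(i <- r) F i x).
Proof.
move=> sF; elim: r => [|i r IH].
  have -> : (fun x => \sum_(i <- [::]) F i x) = (fun=> 0).
    by apply/funext => x; rewrite big_nil.
  exact: rsmooth_cst.
have -> : (fun x => \sum_(i <- i :: r) F i x) = (fun x => F i x + \sum_(i <- r) F i x).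
  by apply/funext => x; rewrite big_cons.
exact: rsmooth_add.
Qed.

Lemma rsmooth_prod (I : Type) (r : seq I) (F : I -> V -> R) :
  (forall i, rsmooth (F i)) -> rsmooth (fun x => \prod_(i <- r) F i x).
Proof.
move=> sF; elim: r => [|i r IH].
  have -> : (fun x => \prod_(i <- [::]) F i x) = (fun=> 1).
    by apply/funext => x; rewrite big_nil.
  exact: rsmooth_cst.
have -> : (fun x => \prod_(i <- i :: r) F i x) = (fun x => F i x * \prod_(i <- r) F i x).
  by apply/funext => x; rewrite big_cons.
exact: rsmooth_mul.
Qed.

Lemma rderives_lin a phi psi vs : rsmooth phi -> rsmooth psi ->
  rderives vs (fun x => a * phi x + psi x) = (fun x => a * rderives vs phi x + rderives vs psi x).
Proof.
move=> s1 s2; elim: vs => //= v vs ->; apply/funext => x.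
have d1 : derivable (rderives vs phi) x v by apply: diff_derivable; exact: s1.
have d2 : derivable (rderives vs psi) x v by apply: diff_derivable; exact: s2.
rewrite -[fun y => _]/((a *: rderives vs phi) + rderives vs psi).
have dZ : derivable (a *: rderives vs phi) x v by exact: derivableZ.
by rewrite (@deriveD _ _ _ _ _ _ _ dZ d2) (@deriveZ _ _ _ _ _ _ _ d1).
Qed.

Lemma rderives_cst0 vs : rderives vs (fun _ : V => 0) = (fun=> 0).
Proof.
elim: vs => //= v vs ->; apply/funext => x.
by rewrite -[fun _ => 0]/(cst 0) derive_cst.
Qed.

Lemma rderives_add phi psi vs : rsmooth phi -> rsmooth psi ->
  rderives vs (fun x => phi x + psi x) = (fun x => rderives vs phi x + rderives vs psi x).
Proof.
move=> s1 s2; have := rderives_lin 1 vs s1 s2.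
by under eq_fun do rewrite mul1r; move=> ->; under eq_fun do rewrite mul1r.
Qed.

Lemma rderives_scale a phi vs : rsmooth phi ->
  rderives vs (fun x => a * phi x) = (fun x => a * rderives vs phi x).
Proof.
move=> s1; have := rderives_lin a vs s1 (rsmooth_cst 0).
under eq_fun do rewrite addr0.
by move=> ->; rewrite rderives_cst0; under eq_fun do rewrite addr0.
Qed.

Lemma rderives_sub phi psi vs : rsmooth phi -> rsmooth psi ->
  rderives vs (fun x => phi x - psi x) = (fun x => rderives vs phi x - rderives vs psi x).
Proof.
move=> s1 s2; have := rderives_lin (-1) vs s2 s1.
by under eq_fun do rewrite mulN1r addrC; move=> ->; under eq_fun do rewrite mulN1r addrC.
Qed.

Lemma rderives_sum (I : Type) (r : seq I) (F : I -> V -> R) vs :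
  (forall i, rsmooth (F i)) ->
  rderives vs (fun x => \sum_(i <- r) F i x) = (fun x => \sum_(i <- r) rderives vs (F i) x).
Proof.
move=> sF; elim: r => [|i r IH].
  under eq_fun do rewrite big_nil.
  by rewrite rderives_cst0; apply/funext => x; rewrite big_nil.
under eq_fun do rewrite big_cons.
rewrite rderives_add ?IH //; last exact: rsmooth_sum.
by apply/funext => x; rewrite big_cons.
Qed.

Lemma derive_mul phi psi v : rsmooth phi -> rsmooth psi ->
  (fun x => 'D_v (fun y => phi y * psi y) x) =
  (fun x => 'D_v phi x * psi x + phi x * 'D_v psi x).
Proof.
move=> s1 s2; apply/funext => x; rewrite (@deriveM _ _ phi psi).
- by rewrite addrC; congr (_ + _); exact: mulrC.
- by apply: diff_derivable; exact: rsmooth_differentiable.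
- by apply: diff_derivable; exact: rsmooth_differentiable.
Qed.

Lemma rderives_local phi psi (O : set V) vs : open O -> (forall x, O x -> phi x = psi x) ->
  forall x, O x -> rderives vs phi x = rderives vs psi x.
Proof.
move=> oO e; elim: vs => //= v vs IH x Ox.
by apply: near_eq_derive; apply: filterS (open_nbhs_nbhs (conj oO Ox)).
Qed.

Lemma rderives_vanish phi (K : set V) vs : closed K -> (forall x, ~ K x -> phi x = 0) ->
  forall x, ~ K x -> rderives vs phi x = 0.
Proof.
move=> cK e x Kx.
have oK : open (~` K) by exact: closed_openC.
by rewrite (@rderives_local phi (fun=> 0) _ vs oK) // rderives_cst0.
Qed.

End SmoothClosure.

(** * Weighted derivative bounds *)

Section Weights.
Context {R : realType} {V : normedModType R}.
Implicit Types (phi psi : V -> R) (v u x : V) (vs : seq V) (s B : R) (N : nat).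

(** A derivative of order k may cost [s ^+ k]. Weights add under products and are multiplied by [c]
    under affine maps, so constants are tracked exactly and [N] is paid for once, at the end, by
    [wbound_weight1]. The bound is pointwise so that estimates valid only on a support can be
    used. *)
Definition wbound N s B phi x := forall vs, (size vs <= N)%N ->
  (forall v, v \in vs -> `|v| <= 1) -> `|rderives vs phi x| <= B * s ^+ size vs.

Definition bound_CN N phi B := forall x, wbound N 1 B phi x.

Lemma wbound_value N s B phi x : wbound N s B phi x -> `|phi x| <= B.
Proof. by move=> /(_ [::] isT); rewrite expr0 mulr1 /=; apply. Qed.

Lemma wbound_ge0 N s B phi x : wbound N s B phi x -> 0 <= B.
Proof. by move=> /wbound_value; apply: le_trans. Qed.

Lemma wbound_leN N N' s B phi x : (N' <= N)%N -> wbound N s B phi x -> wbound N' s B phi x.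
Proof. by move=> le H vs sz; apply: H; exact: leq_trans le. Qed.

Lemma wbound_le N s s' B B' phi x : 0 <= s -> s <= s' -> B <= B' ->
  wbound N s B phi x -> wbound N s' B' phi x.
Proof.
move=> s0 ss BB H vs sz v1; apply: le_trans (H vs sz v1) _.
have B0 := wbound_ge0 H.
by apply: ler_pM => //; rewrite ?exprn_ge0 // lerXn2r // nnegrE (le_trans s0).
Qed.

Lemma wbound_derive N s B phi x v : `|v| <= 1 -> wbound N.+1 s B phi x ->
  wbound N s (B * s) (fun y => 'D_v phi y) x.
Proof.
move=> v1 H vs sz vs1; rewrite -rderives_rcons.
have := H (rcons vs v); rewrite size_rcons exprS mulrA; apply => // w.
by rewrite mem_rcons inE => /orP[/eqP ->|/vs1].
Qed.

Lemma wbound_add N s B1 B2 phi psi x : rsmooth phi -> rsmooth psi ->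
  wbound N s B1 phi x -> wbound N s B2 psi x ->
  wbound N s (B1 + B2) (fun y => phi y + psi y) x.
Proof.
move=> s1 s2 H1 H2 vs sz v1; rewrite rderives_add // mulrDl.
by apply: le_trans (ler_normD _ _) _; apply: lerD; [exact: H1|exact: H2].
Qed.

Lemma wbound_scale N s B a phi x : rsmooth phi ->
  wbound N s B phi x -> wbound N s (`|a| * B) (fun y => a * phi y) x.
Proof.
move=> s1 H1 vs sz v1; rewrite rderives_scale // normrM -mulrA.
by rewrite ler_wpM2l //; exact: H1.
Qed.

Lemma wbound_opp N s B phi x : rsmooth phi ->
  wbound N s B phi x -> wbound N s B (fun y => - phi y) x.
Proof.
move=> s1 H1; have := @wbound_scale N s B (-1) phi x s1 H1; rewrite normrN1 mul1r.
by under eq_fun do rewrite mulN1r.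
Qed.

Lemma wbound_sub N s B1 B2 phi psi x : rsmooth phi -> rsmooth psi ->
  wbound N s B1 phi x -> wbound N s B2 psi x ->
  wbound N s (B1 + B2) (fun y => phi y - psi y) x.
Proof.
move=> s1 s2 H1 H2; apply: wbound_add => //; first exact: rsmooth_opp.
exact: wbound_opp.
Qed.

(* Weights are what makes Leibniz' rule lossless: (s1 + s2)^n is the sum over
   all ways to distribute n derivatives over two factors. *)
Lemma wbound_mul N s1 s2 B1 B2 phi psi x : 0 <= s1 -> 0 <= s2 -> rsmooth phi -> rsmooth psi ->
  wbound N s1 B1 phi x -> wbound N s2 B2 psi x ->
  wbound N (s1 + s2) (B1 * B2) (fun y => phi y * psi y) x.
Proof.
move=> s10 s20; elim: N phi psi B1 B2 => [|N IH] phi psi B1 B2 sp1 sp2 H1 H2 vs.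
  rewrite leqn0 => /nilP -> _; rewrite expr0 mulr1 /= normrM.
  by apply: ler_pM => //; [exact: wbound_value H1|exact: wbound_value H2].
case/lastP: vs => [_ _|vs v].
  by rewrite expr0 mulr1 /= normrM; apply: ler_pM => //; [exact: wbound_value H1|exact: wbound_value H2].
rewrite size_rcons ltnS => sz v1.
have v1' : `|v| <= 1 by apply: v1; rewrite mem_rcons mem_head.
have vs1 w : w \in vs -> `|w| <= 1 by move=> wv; apply: v1; rewrite mem_rcons inE wv orbT.
rewrite rderives_rcons derive_mul //.
have d1 := rsmooth_derive v sp1; have d2 := rsmooth_derive v sp2.
rewrite rderives_add; try by apply: rsmooth_mul.
apply: le_trans (ler_normD _ _) _.
have W1 := IH _ _ _ _ d1 sp2 (wbound_derive v1' H1) (wbound_leN (leqnSn N) H2) vs sz vs1.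
have W2 := IH _ _ _ _ sp1 d2 (wbound_leN (leqnSn N) H1) (wbound_derive v1' H2) vs sz vs1.
apply: le_trans (lerD W1 W2) _; rewrite exprS le_eqVlt; apply/orP; left; apply/eqP.
by ring.
Qed.

Lemma wbound_cst N s (a : R) x : 0 <= s -> wbound N s `|a| (fun _ : V => a) x.
Proof.
move=> s0 vs _ _; have := rderives_scale a vs (@rsmooth_cst R V 1).
under eq_fun do rewrite mulr1; move=> ->.
case: vs => [|v vs]; first by rewrite /= mulr1 expr0 mulr1.
rewrite (_ : rderives (v :: vs) (fun=> 1) x = 0); last first.
  elim: vs v => [|w vs IH] v /=; first by rewrite -[fun=> 1]/(cst 1) derive_cst.
  rewrite -[fun x => _]/(rderives (w :: vs) (fun=> 1)).
  have -> : rderives (w :: vs) (fun _ : V => 1 : R) = (fun=> 0).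
    apply/funext => y /=; elim: vs w {IH} y => [|z vs IH] w y /=.
      by rewrite -[fun=> 1]/(cst 1) derive_cst.
    under [X in 'D_w X y]eq_fun do rewrite IH.
    by rewrite -[fun=> 0]/(cst 0) derive_cst.
  by rewrite -[fun=> 0]/(cst 0) derive_cst.
by rewrite mulr0 normr0 mulr_ge0 // exprn_ge0.
Qed.

Lemma wbound_weight1 N s B phi x : 1 <= s -> wbound N s B phi x -> wbound N 1 (B * s ^+ N) phi x.
Proof.
move=> s1 H vs sz v1; apply: le_trans (H vs sz v1) _; rewrite expr1n mulr1.
by rewrite ler_wpM2l ?(wbound_ge0 H) // ler_weXn2l.
Qed.

Lemma bound_CN_ge0 N phi B : bound_CN N phi B -> 0 <= B.
Proof. by move=> /(_ 0) /wbound_ge0. Qed.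

End Weights.

(** Differentiating along [v] becomes differentiating along [A v], of norm at most [c]; normalizing
    each such direction by [c^-1] extracts one factor [c] per derivative. *)
Lemma wbound_comp_affine {R : realType} {V W : normedModType R} (L A : V -> W) c N s B (phi : W -> R) x :
  0 < c -> affine_map L A c -> rsmooth phi ->
  wbound N s B phi (L x) -> wbound N (c * s) B (fun y => phi (L y)) x.
Proof.
move=> c0 hL sp H vs sz v1; rewrite (rderives_comp_affine _ hL) //.
have -> : map A vs = map (fun v => c *: (c^-1 *: A v)) vs.
  by apply: eq_map => v; rewrite scalerA divff ?scale1r // gt_eqF.
have -> : rderives [seq c *: (c^-1 *: A v) | v <- vs] phi (L x) =
    c ^+ size vs * rderives [seq c^-1 *: A v | v <- vs] phi (L x).
  elim: vs {sz v1} (L x) => [|v vs IH] y /=; first by rewrite mul1r.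
  have -> : rderives [seq c *: (c^-1 *: A v) | v <- vs] phi =
     (fun y => c ^+ size vs * rderives [seq c^-1 *: A v | v <- vs] phi y).
    by apply/funext => z; rewrite IH.
  rewrite derivative_scale; last first.
    by apply: rsmooth_differentiable; apply: rsmooth_scale; exact: rsmooth_derives.
  rewrite -[fun y => _]/(c ^+ size vs *: rderives [seq c^-1 *: A v | v <- vs] phi).
  rewrite deriveZ; last exact: diff_derivable.
  by rewrite exprS mulrA.
rewrite normrM ger0_norm ?exprn_ge0 ?(ltW c0) // exprMn [B * _]mulrCA ler_wpM2l ?exprn_ge0 ?(ltW c0) //.
have := H [seq c^-1 *: A v | v <- vs]; rewrite size_map; apply => //.
move=> w /mapP[v vvs ->]; rewrite normrZ normfV gtr0_norm // mulrC ler_pdivrMr // mul1r.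
apply: le_trans (hL.2 v) _; rewrite ger_pMr //; exact: v1.
Qed.

Section Coordinates.
Context {R : realType} {m : nat}.
Implicit Types (x v : 'rV[R]_m) (i : 'I_m).

Lemma coord_le_norm x i : `|x 0 i| <= `|x|.
Proof. by rewrite [leRHS]mx_normrE; apply: (@le_bigmax_cond _ _ _ 0 (0, i) xpredT (fun ij => `|x ij.1 ij.2|)). Qed.

Lemma rV_norm_le x (r : R) : 0 <= r -> (forall i, `|x 0 i| <= r) -> `|x| <= r.
Proof.
move=> r0 H; rewrite [leLHS]mx_normrE; apply: bigmax_le => // -[i j] _ /=.
by rewrite ord1.
Qed.

Lemma affine_map_coord i : affine_map (fun x : 'rV[R]_m => x 0 i) (fun x => x 0 i) 1.
Proof. by split=> [h x v|v]; rewrite ?mxE // mul1r coord_le_norm. Qed.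

Lemma rsmooth_coord i : rsmooth (fun x : 'rV[R]_m => x 0 i).
Proof.
pose P (f : 'rV[R]_m -> R) := f = (fun x => x 0 i) \/ exists a : R, f = cst a.
apply: (@rsmooth_class _ _ P); [| |by left].
  move=> f [->|[a ->]] x; last exact: differentiable_cst.
  exact: affine_map_differentiable (affine_map_coord i).
move=> f [->|[a ->]] v; right.
  by exists (v 0 i); apply/funext => x; exact: affine_map_derive (affine_map_coord i).
by exists 0; apply/funext => x; rewrite derive_cst.
Qed.

Lemma derive_coord i x v : 'D_v (fun x : 'rV[R]_m => x 0 i) x = v 0 i.
Proof. exact: affine_map_derive (affine_map_coord i). Qed.

Lemma delta_mx_norm i : `|delta_mx 0 i : 'rV[R]_m| <= 1.
Proof.
by apply: rV_norm_le => // j; rewrite mxE /=; case: eqP => _; rewrite ?normr1 ?normr0.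
Qed.

Lemma rV_sum_delta v : v = \sum_i v 0 i *: delta_mx 0 i.
Proof. exact: row_sum_delta. Qed.

End Coordinates.

Lemma affine_map_scale_shift {R : realType} {V : normedModType R} (a : R) (b : V) :
  affine_map (fun x => a *: x + b) ( *:%R a) `|a|.
Proof.
split=> [h x v|v]; last by rewrite normrZ.
by rewrite scalerDr !scalerA addrA [a * h]mulrC.
Qed.

Lemma affine_map_shift {R : realType} {V : normedModType R} (b : V) :
  affine_map (fun x => x + b) id 1.
Proof. by split=> [h x v|v]; rewrite ?mul1r // addrA. Qed.

Lemma affine_map_fst {R : realType} {V W : normedModType R} :
  affine_map (fun p : V * W => p.1) (fun p => p.1) 1.
Proof. by split=> // v; rewrite mul1r [leRHS]prod_normE /= le_max lexx. Qed.

Lemma affine_map_snd {R : realType} {V W : normedModType R} :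
  affine_map (fun p : V * W => p.2) (fun p => p.2) 1.
Proof. by split=> // v; rewrite mul1r [leRHS]prod_normE /= le_max lexx orbT. Qed.

Lemma affine_map_comp {R : realType} {U V W : normedModType R} (L1 A1 : U -> V) (L2 A2 : V -> W) c1 c2 :
  0 <= c2 -> affine_map L1 A1 c1 -> affine_map L2 A2 c2 ->
  affine_map (fun x => L2 (L1 x)) (fun x => A2 (A1 x)) (c2 * c1).
Proof.
move=> c20 [e1 b1] [e2 b2]; split=> [h x v|v]; first by rewrite e1 e2.
by apply: le_trans (b2 _) _; rewrite -mulrA ler_wpM2l.
Qed.

Lemma rsmooth_id {R : realType} : rsmooth (@id R).
Proof.
pose P (f : R -> R) := f = id \/ exists a : R, f = cst a.
apply: (@rsmooth_class _ _ P); [| |by left].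
  by move=> f [->|[a ->]] x.
move=> f [->|[a ->]] v; right.
  by exists v; apply/funext => x; rewrite derive_id.
by exists 0; apply/funext => x; rewrite derive_cst.
Qed.

(** * Bump functions *)

Section CompactSupport.
Context {R : realType} {V : normedModType R}.
Implicit Types (phi : V -> R) (K : set V).

Lemma closed_norm_le (r : R) : closed [set x : V | `|x| <= r].
Proof.
have -> : [set x : V | `|x| <= r] = (fun x : V => `|x|) @^-1` [set y | y <= r] by [].
apply: preimage_closed; last exact: closed_le.
by move=> x _; exact: norm_continuous.
Qed.

Lemma continuous_compact_bounded phi K : compact K -> continuous phi ->
  exists2 M : R, 0 <= M & forall x, K x -> `|phi x| <= M.
Proof.
move=> cK cphi.
have : compact (phi @` K) by apply: continuous_compact => //; exact: continuous_subspaceT.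
move=> /compact_bounded[M [_ HM]].
exists (`|M| + 1) => // x Kx.
by apply: (HM (`|M| + 1)); [rewrite ltr_pwDr // ler_norm|exists x].
Qed.

(** Finite dimension in the form needed for norms: derivatives along arbitrary vectors of norm at
    most 1 are controlled by the derivatives along the [e i]. *)
Definition finite_coords := exists (d : nat) (e : 'I_d -> V) (l : 'I_d -> V -> R),
  (forall v, v = \sum_i l i v *: e i) /\ forall i v, `|l i v| <= `|v|.

Lemma compact_support_bound_CN K phi N : finite_coords -> compact K -> closed K ->
  rsmooth phi -> (forall x, ~ K x -> phi x = 0) -> exists B, bound_CN N phi B.
Proof.
move=> [d [e [l [El bl]]]] cK clK; elim: N phi => [|N IH] phi sp z.
  have [M M0 HM] := continuous_compact_bounded cK (rsmooth_continuous sp).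
  exists M => x vs; rewrite leqn0 => /nilP -> _; rewrite /= expr0 mulr1.
  have [Kx|nKx] := pselect (K x); first exact: HM.
  by rewrite z // normr0.
have zD v x : ~ K x -> 'D_v phi x = 0 by exact: (@rderives_vanish _ _ phi K [:: v]).
have [B HB] : exists B : 'I_d -> R, forall i, bound_CN N (fun x => 'D_(e i) phi x) (B i).
  have := choice (fun i => IH _ (rsmooth_derive (e i) sp) (zD (e i))).
  by case=> B HB; exists B.
have [M M0 HM] := continuous_compact_bounded cK (rsmooth_continuous sp).
have B0 i : 0 <= B i by exact: bound_CN_ge0 (HB i).
(* [M] serves the empty list of directions. Otherwise the innermost direction is expanded along the
   [e i] with coefficients of modulus at most 1, which costs the sum of the [B i]. *)
exists (M + \sum_i B i) => x vs; case/lastP: vs => [|vs v] sz v1.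
  rewrite /= expr0 mulr1; have [Kx|nKx] := pselect (K x).
    by apply: le_trans (HM x Kx) _; rewrite lerDl sumr_ge0.
  by rewrite z // normr0 addr_ge0 // sumr_ge0.
rewrite expr1n mulr1 rderives_rcons.
have -> : (fun y => 'D_v phi y) = (fun y => \sum_i l i v * 'D_(e i) phi y).
  apply/funext => y; rewrite {1}(El v) derivative_sum; last exact: rsmooth_differentiable.
  by apply: eq_bigr => i _; apply: derivative_scale; exact: rsmooth_differentiable.
rewrite rderives_sum; last by move=> i; apply: rsmooth_scale; exact: rsmooth_derive.
apply: (@le_trans _ _ (\sum_i B i)); last by rewrite lerDr.
apply: le_trans (ler_norm_sum _ _ _) _; apply: ler_sum => i _.
rewrite rderives_scale; last exact: rsmooth_derive.
rewrite normrM -[B i]mul1r ler_pM //.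
  by apply: le_trans (bl i v) (v1 _ _); rewrite mem_rcons mem_head.
have := HB i x vs; rewrite expr1n mulr1; apply.
  by move: sz; rewrite size_rcons.
by move=> w wvs; apply: v1; rewrite mem_rcons inE wvs orbT.
Qed.

(** The support lies in one closed ball fixed in advance, on which a distribution has a single order
    and a single constant. *)
Definition rtest (r : R) phi := rsmooth phi /\ forall x, r < `|x| -> phi x = 0.

Lemma rtest_leW r r' phi : r <= r' -> rtest r phi -> rtest r' phi.
Proof. by move=> rr [sp z]; split=> // x xr; apply: z; exact: le_lt_trans xr. Qed.

Lemma rtest_derives r phi vs : rtest r phi -> rtest r (rderives vs phi).
Proof.
move=> [sp z]; split; first exact: rsmooth_derives.
move=> x xr; apply: (@rderives_vanish _ _ phi [set x : V | `|x| <= r]).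
- exact: closed_norm_le.
- by move=> y /= /negP; rewrite -ltNge; exact: z.
- by move=> /= ; rewrite leNgt xr.
Qed.

Lemma rtest_derive r phi v : rtest r phi -> rtest r (fun x => 'D_v phi x).
Proof. exact: (@rtest_derives r phi [:: v]). Qed.

Lemma rtest0 r : rtest r (fun=> 0). Proof. by split=> //; exact: rsmooth_cst. Qed.

Lemma rtest_lin r (a : R) phi psi : rtest r phi -> rtest r psi ->
  rtest r (fun x => a * phi x + psi x).
Proof.
move=> [s1 z1] [s2 z2]; split; first by apply: rsmooth_add => //; exact: rsmooth_scale.
by move=> x xr; rewrite z1 // z2 // mulr0 addr0.
Qed.

Lemma rtest_mull r f phi : rsmooth f -> rtest r phi -> rtest r (fun x => f x * phi x).
Proof.
by move=> sf [s1 z1]; split=> [|x xr]; [exact: rsmooth_mul|rewrite z1 // mulr0].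
Qed.

Lemma rtest_wbound_outside r phi N s x : 0 <= s -> rtest r phi -> r < `|x| -> wbound N s 0 phi x.
Proof.
move=> s0 tp xr vs _ _; have [_ z] := rtest_derives vs tp.
by rewrite z // normr0 mul0r.
Qed.

End CompactSupport.

Lemma finite_coords_rV {R : realType} {m : nat} : @finite_coords R 'rV[R]_m.
Proof.
exists m, (delta_mx 0), (fun i (v : 'rV[R]_m) => v 0 i); split; first exact: rV_sum_delta.
by move=> i v; exact: coord_le_norm.
Qed.

Lemma finite_coords_plane {R : realType} : @finite_coords R (R * R)%type.
Proof.
exists 2, (fun i => if i == 0 then (1, 0) else (0, 1)), (fun i v => if i == 0 then v.1 else v.2).
split=> [[a b]|i [a b]].
  rewrite big_ord_recl big_ord1 /=; congr (_, _) => /=.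
    by rewrite [_ *: _]mulr1 [_ *: _]mulr0 addr0.
  by rewrite [_ *: _]mulr0 [_ *: _]mulr1 add0r.
by rewrite [leRHS]prod_normE /=; case: (i == 0); rewrite le_max lexx ?orbT.
Qed.

Lemma compact_norm_le_rV {R : realType} {m : nat} (r : R) :
  compact [set x : 'rV[R]_m | `|x| <= r].
Proof.
apply: bounded_closed_compact; last exact: closed_norm_le.
exists r; split; first exact: num_real.
by move=> M /ltW rM x /= /le_trans; apply.
Qed.

Lemma compact_norm_le_plane {R : realType} (r : R) : compact [set x : R * R | `|x| <= r].
Proof.
have -> : [set x : R * R | `|x| <= r] = `[- r, r]%classic `*` `[- r, r]%classic.
  apply/seteqP; split=> -[x y] /=; rewrite prod_normE /= ge_max !in_itv /= !ler_norml.
    by move=> /andP[].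
  by move=> [-> ->].
by apply: compact_setX; exact: segment_compact.
Qed.

Lemma rtest_bound_rV {R : realType} {m : nat} N r (phi : 'rV[R]_m -> R) : rtest r phi ->
  exists B, bound_CN N phi B.
Proof.
move=> [sp z]; apply: (@compact_support_bound_CN R 'rV[R]_m [set x : 'rV[R]_m | `|x| <= r] phi N finite_coords_rV (@compact_norm_le_rV R m r)) => //.
  exact: closed_norm_le.
by move=> x /= /negP; rewrite -ltNge; exact: z.
Qed.

Lemma rtest_bound_plane {R : realType} N r (phi : R * R -> R) : rtest r phi ->
  exists B, bound_CN N phi B.
Proof.
move=> [sp z]; apply: (@compact_support_bound_CN R (R * R)%type [set x : R * R | `|x| <= r] phi N finite_coords_plane (@compact_norm_le_plane R r)) => //.
  exact: closed_norm_le.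
by move=> x /= /negP; rewrite -ltNge; exact: z.
Qed.

(** * Smooth steps and splines on the line *)

Section SmoothStep.
Context {R : realType}.
Implicit Types (x y : R) (k : nat).

(** The powers of [x^-1] are carried along because the derivative of [flat k] is a combination of
    [flat k.+1] and [flat k.+2]; the span of the family is stable under differentiation. *)
Definition flat k x : R := if 0 < x then x^-1 ^+ k * expR (- x^-1) else 0.

(** The term of order k + 2 of the exponential series bounds [expR x^-1] from below. Quadratic decay
    makes the difference quotient at 0, the only delicate point, tend to 0. *)
Lemma flat_quadratic k : exists2 C : R, 0 <= C & forall x, `|flat k x| <= C * x ^+ 2.
Proof.
exists ((k.+2)`!%:R) => // x; rewrite /flat; case: ltP => x0; last first.
  by rewrite normr0 mulr_ge0 // sqr_ge0.
have y0 : 0 < x^-1 by rewrite invr_gt0.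
rewrite ger0_norm; last by rewrite mulr_ge0 ?expR_ge0 // exprn_ge0 // ltW.
have := expR_ge1Dxn k.+1 (ltW y0).
set E := expR _; have E0 : 0 < E by exact: expR_gt0.
move=> H; rewrite expRN -/E ler_pdivrMr //.
have {}H : x^-1 ^+ k.+2 <= k.+2`!%:R * E.
  rewrite mulrC -ler_pdivrMr ?ltr0n ?fact_gt0 //; apply: le_trans H.
  by rewrite lerDr.
have -> : x^-1 ^+ k = x ^+ 2 * x^-1 ^+ k.+2.
  by rewrite -[k.+2]addn2 exprD mulrCA -exprMn divff ?gt_eqF // expr1n mulr1.
by rewrite [leRHS]mulrAC [leRHS]mulrC ler_wpM2l // sqr_ge0.
Qed.

Lemma is_derive_flat_pos k x : 0 < x ->
  is_derive x (1 : R) (fun y => y^-1 ^+ k * expR (- y^-1))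
    (- k%:R * (x^-1 ^+ k.+1 * expR (- x^-1)) + x^-1 ^+ k.+2 * expR (- x^-1)).
Proof.
move=> x0; have xn : x != 0 by rewrite gt_eqF.
have d1 : is_derive x (1 : R) (fun y => y^-1) (- x ^- 2 *: (1 : R)).
  exact: (is_deriveV (f := id)).
have d2 : is_derive x (1 : R) (fun y => - y^-1) (x ^- 2).
  by apply: is_derive_eq; rewrite scaleNr opprK [_ *: _]mulr1.
have d3 : is_derive x (1 : R) (fun y => expR (- y^-1)) (expR (- x^-1) * x ^- 2).
  exact: (@is_derive1_comp _ expR (fun y => - y^-1)).
have d4 := @is_deriveX _ _ (fun y : R => y^-1) k x 1 _ d1.
have d5 := is_deriveM d4 d3.
have e : (fun y => y^-1) ^+ k * (fun y => expR (- y^-1)) = (fun y => y^-1 ^+ k * expR (- y^-1)).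
  by apply/funext => y; rewrite exprfctE.
rewrite e in d5; apply: is_derive_eq d5 _.
rewrite exprfctE -exprVn /GRing.scale /=.
case: k {d4 e} => [|k] /=.
  by ring.
by rewrite !exprS; ring.
Qed.

Lemma is_derive_flat k x :
  is_derive x (1 : R) (flat k) (- k%:R * flat k.+1 x + flat k.+2 x).
Proof.
have [x0|x0|<-] := ltgtP 0 x.
- rewrite /flat x0; apply: near_eq_is_derive (is_derive_flat_pos k x0).
  near=> y; rewrite /flat ifT //; near: y.
  by exact: lt_nbhsr.
- rewrite /flat ltNge ltW //= mulr0 addr0.
  apply: (@near_eq_is_derive _ _ _ (cst 0)).
  near=> y; rewrite /flat ifF //; apply/negbTE; rewrite -leNgt ltW //; near: y.
  by exact: lt_nbhsl.
- have f0 j : flat j 0 = 0 by rewrite /flat ltxx.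
  rewrite !f0 mulr0 addr0.
  have [C C0 HC] := flat_quadratic k.
  have L : (fun h : R => h^-1 *: (flat k (h *: (1 : R) + 0) - flat k 0)) @ 0^' --> (0 : R).
    apply/cvgrPdist_le => e e0; near=> h.
    rewrite f0 subr0 addr0 [h%:A]mulr1 sub0r normrN normrM normfV.
    have h0 : 0 < `|h| by rewrite normr_gt0; near: h; exact: nbhs_dnbhs_neq.
    rewrite mulrC ler_pdivrMr //; apply: le_trans (HC h) _.
    rewrite -(real_normK (num_real h)) expr2 mulrA ler_wpM2r //.
    have : `|h| <= e / (C + 1).
      near: h; apply: (@dnbhs0_le _ R); rewrite divr_gt0 // ltr_wpDl //.
    rewrite ler_pdivlMr ?ltr_wpDl // => le; nra.
  by split; [apply/cvg_ex; exists 0|exact: cvg_lim L].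
Unshelve. all: by end_near. Qed.

Inductive flat_span : (R -> R) -> Prop :=
| span_flat k : flat_span (flat k)
| span_lin (a b : R) f g : flat_span f -> flat_span g -> flat_span (fun x => a * f x + b * g x).

Lemma flat_span_derive f : flat_span f ->
  (forall x, differentiable f x) /\ forall v, flat_span (fun x => 'D_v f x).
Proof.
elim=> {f} [k|a b f g _ [df Hf] _ [dg Hg]].
  have d x : differentiable (flat k) x.
    by apply/derivable1_diffP; case: (is_derive_flat k x).
  split=> // v.
  have -> : (fun x => 'D_v (flat k) x) = (fun x => (v * - k%:R) * flat k.+1 x + v * flat k.+2 x).
    apply/funext => x; rewrite -[v in LHS]mulr1 -[v * 1]/(v *: (1 : R)) derivative_scale //.
    by have [_ ->] := is_derive_flat k x; rewrite mulrDr mulrA.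
  by apply: span_lin; exact: span_flat.
split=> [x|v].
  by apply: (@differentiableD _ _ _ (a *: f) (b *: g)); exact: differentiableZ.
have -> : (fun x => 'D_v (fun x => a * f x + b * g x) x) = (fun x => a * 'D_v f x + b * 'D_v g x).
  apply/funext => x.
  have d1 : derivable f x v by exact: diff_derivable.
  have d2 : derivable g x v by exact: diff_derivable.
  have d1' : derivable (a *: f) x v by exact: derivableZ.
  have d2' : derivable (b *: g) x v by exact: derivableZ.
  have := @deriveD _ _ _ _ _ _ _ d1' d2'.
  by rewrite (@deriveZ _ _ _ _ _ _ _ d1) (@deriveZ _ _ _ _ _ _ _ d2).
exact: span_lin.
Qed.

Lemma rsmooth_flat : rsmooth (flat 0).
Proof.
apply: (rsmooth_class (P := flat_span)); last exact: span_flat.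
  by move=> f /flat_span_derive[].
by move=> f /flat_span_derive[].
Qed.

Lemma flat_ge0 x : 0 <= flat 0 x.
Proof. by rewrite /flat; case: ifP => // _; rewrite mul1r expR_ge0. Qed.

Lemma flat_gt0 x : 0 < x -> 0 < flat 0 x.
Proof. by move=> x0; rewrite /flat x0 mul1r expR_gt0. Qed.

Lemma flat_le0 x : x <= 0 -> flat 0 x = 0.
Proof. by rewrite /flat leNgt => /negbTE ->. Qed.

Lemma flat_nondecreasing x y : x <= y -> flat 0 x <= flat 0 y.
Proof.
move=> xy; have [x0|x0] := leP x 0; first by rewrite (flat_le0 x0) flat_ge0.
have y0 := lt_le_trans x0 xy.
by rewrite /flat x0 y0 !mul1r ler_expR lerN2 lef_pV2.
Qed.

(** The two summands of the denominator never vanish together, since [x] and [1 - x] are not both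
    nonpositive. *)
Definition step x := flat 0 x / (flat 0 x + flat 0 (1 - x)).

Lemma step_denom x : 0 < flat 0 x + flat 0 (1 - x).
Proof.
have [x0|x0] := leP x 0.
  by rewrite ltr_wpDl ?flat_ge0 // flat_gt0 // subr_gt0 (le_lt_trans x0).
by rewrite ltr_pwDl ?flat_ge0 // flat_gt0.
Qed.

Lemma rsmooth_step : rsmooth step.
Proof.
have s1 : rsmooth (fun x : R => flat 0 (1 - x)).
  apply: rsmooth_comp; first exact: rsmooth_flat.
  by apply: rsmooth_sub; [exact: rsmooth_cst|exact: rsmooth_id].
apply: rsmooth_mul; first exact: rsmooth_flat.
apply: rsmooth_inv; first by move=> x; rewrite gt_eqF // step_denom.
by apply: rsmooth_add => //; exact: rsmooth_flat.
Qed.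

Lemma step_le0 x : x <= 0 -> step x = 0.
Proof. by move=> x0; rewrite /step flat_le0 // mul0r. Qed.

Lemma step_ge1 x : 1 <= x -> step x = 1.
Proof.
move=> x1; rewrite /step [flat 0 (1 - x)]flat_le0 ?subr_le0 // addr0 divff //.
by rewrite gt_eqF // flat_gt0 // (lt_le_trans _ x1).
Qed.

Lemma step_nondecreasing x y : x <= y -> step x <= step y.
Proof.
move=> xy; rewrite /step ler_pdivrMr ?step_denom // mulrAC ler_pdivlMr ?step_denom //.
have H1 := flat_nondecreasing xy.
have H2 : flat 0 (1 - y) <= flat 0 (1 - x) by apply: flat_nondecreasing; rewrite lerD2l lerN2.
rewrite !mulrDr [flat 0 y * flat 0 x]mulrC lerD2l.
by apply: ler_pM; rewrite ?flat_ge0.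
Qed.

(* Integer translates of [spline] form a partition of unity. *)
Definition spline x := step (x + 1) - step x.

Lemma rsmooth_spline : rsmooth spline.
Proof.
apply: rsmooth_sub; last exact: rsmooth_step.
exact: (@rsmooth_comp_affine R R R _ _ _ _ (@affine_map_shift R R 1) rsmooth_step).
Qed.

Lemma spline_ge0 x : 0 <= spline x.
Proof. by rewrite subr_ge0 step_nondecreasing // lerDl. Qed.

Lemma spline0 : spline 0 = 1.
Proof. by rewrite /spline add0r step_ge1 // step_le0 // subr0. Qed.

Lemma spline_support x : 1 < `|x| -> spline x = 0.
Proof.
rewrite /spline ltr_normr => /orP[] x1.
  by rewrite !step_ge1 ?subrr //; lra.
by rewrite !step_le0 ?subrr //; lra.
Qed.

End SmoothStep.

(** * Integration of compactly supported Lipschitz functions *)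

Section CompactlySupported.
Context {R : realType}.
Implicit Types (f g F G : R -> R) (L : R).

Definition supported {V : normedModType R} L (f : V -> R) := forall x, L < `|x| -> f x = 0.

Definition rint f : R := \int[lebesgue_measure]_x f x.

Lemma supported_restrict f L (D : set R) : (forall x, `|x| <= L -> D x) ->
  supported L f -> f \_ D = f.
Proof.
move=> LD sf; apply/funext => x; rewrite patchE; case: ifPn => // /negP xD.
rewrite sf // ltNge; apply/negP => /LD Dx; apply: xD.
by rewrite inE.
Qed.

Lemma compact_support_integrable f L : continuous f -> supported L f ->
  (@lebesgue_measure R).-integrable setT (EFin \o f).
Proof.
move=> cf sf.
have i : (@lebesgue_measure R).-integrable `[- L, L]%classic (EFin \o f).
  apply: continuous_compact_integrable; first exact: segment_compact.
  exact: continuous_subspaceT.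
have := @integrable_mkcond _ _ R lebesgue_measure _ (EFin \o f) (measurable_itv `[- L, L]).
move=> /propext e; move: i; rewrite e; congr (_.-integrable _ _).
apply/funext => x; rewrite patchE /=; case: ifPn => // /negP xD.
rewrite sf // ltNge; apply/negP => xL; apply: xD.
by rewrite inE /= in_itv /= -ler_norml.
Qed.

(** The only contact with measure theory needed for the analytic properties of [rint]: linearity,
    bounds and changes of variable all follow from uniqueness of a primitive that vanishes on the
    far left and equals the integral on the far right. *)
Lemma antiderivative f L : continuous f -> supported L f -> exists F,
  [/\ forall x, is_derive x (1 : R) F (f x), forall x, x < - L -> F x = 0
    & forall x, L <= x -> F x = rint f].
Proof.
move=> cf sf.
have intf : (@lebesgue_measure R).-integrable setT (EFin \o f).
  exact: compact_support_integrable cf sf.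
exists (fun x => \int[lebesgue_measure]_(t in [set` Interval -oo%O (BRight x)]) f t); split.
- move=> x.
  have x1 : x < x + 1 by rewrite ltrDl.
  have [] := @continuous_FTC1 R f -oo%O x (x + 1) x1.
  + by apply: integrableS intf.
  + by rewrite /= ltNyr.
  + exact: cf.
  by rewrite derive1E => d e; split.
- move=> x xL.
  transitivity (\int[lebesgue_measure]_(t in [set` Interval -oo%O (BRight x)]) (cst (0 : R) t)).
    apply: eq_Rintegral => t; rewrite inE /= in_itv /= => tx.
    by apply: sf; rewrite ltr_normr orbC; apply/orP; left; lra.
  by rewrite Rintegral_cst // mul0r.
- move=> x xL; rewrite Rintegral_mkcond /rint.
  congr (Rintegral _ _ _); apply: (supported_restrict (L := L)) sf => t tL.
  by rewrite /= in_itv /=; move: tL; rewrite ler_norml => /andP[_ /le_trans]; apply.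
Qed.

Lemma rint_antiderivative f F L M : continuous f -> supported L f ->
  (forall x, is_derive x (1 : R) F (f x)) -> L < M -> 0 <= M -> rint f = F M - F (- M).
Proof.
move=> cf sf dF LM M0.
have [G [dG G0 G1]] := antiderivative cf sf.
have E : (F - G) M = (F - G) (- M).
  apply: is_derive_0_is_cst => x.
  by have := is_deriveB (dF x) (dG x); rewrite subrr.
have g0 : G (- M) = 0 by apply: G0; rewrite ltrN2.
have g1 : G M = rint f by apply: G1; exact: ltW.
have {}E : F M - G M = F (- M) - G (- M) by exact: E.
by move: E; rewrite g0 g1; lra.
Qed.

Lemma rint_lin f g L (a : R) : continuous f -> continuous g -> supported L f -> supported L g ->
  rint (fun x => a * f x + g x) = a * rint f + rint g.
Proof.
move=> cf cg sf sg.
have [F [dF F0 F1]] := antiderivative cf sf.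
have [G [dG G0 G1]] := antiderivative cg sg.
have s : supported L (fun x => a * f x + g x) by move=> x xL; rewrite sf // sg // mulr0 addr0.
have c : continuous (fun x => a * f x + g x).
  by move=> x; apply: (@continuousD _ _ _ (fun x => a * f x) g); [apply: (@continuousM _ _ (cst a) f); [exact: cst_continuous|exact: cf]|exact: cg].
have d x : is_derive x (1 : R) (fun x => a * F x + G x) (a * f x + g x).
  by have := is_deriveD (is_deriveZ a (dF x)) (dG x).
have L1 : L < `|L| + 1 by rewrite ltr_pwDr // ler_norm.
rewrite (rint_antiderivative c s d L1) ?addr_ge0 //.
have LM : - (`|L| + 1) < - L by rewrite ltrN2.
by rewrite (F0 _ LM) (G0 _ LM) (F1 _ (ltW L1)) (G1 _ (ltW L1)) mulr0 addr0 subr0.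
Qed.

Lemma rint_bound f L (M : R) : 0 <= L -> continuous f -> supported L f ->
  (forall x, `|f x| <= M) -> `|rint f| <= 2 * L * M.
Proof.
move=> L0 cf sf fM; have M0 : 0 <= M by apply: le_trans (fM 0).
have [F [dF F0 F1]] := antiderivative cf sf.
apply/ler_addgt0Pr => e e0.
(* The primitive is known to vanish only strictly to the left of [- L]; starting at [- L - d] costs
   [M * d], less than [e]. *)
pose d := e / (M + 1); have d0 : 0 < d by rewrite divr_gt0 // ltr_wpDl.
have := @dist_le_of_derivative_bound R F f (- L - d) L M (fun x _ => dF x) (fun x _ => fM x).
rewrite F1 // F0 ?subr0; last by lra.
move=> /le_trans; apply; rewrite ger0_norm; last by lra.
have -> : M * (L - (- L - d)) = 2 * L * M + M * d by ring.
rewrite lerD2l /d mulrA ler_pdivrMr ?ltr_wpDl // mulrDr mulr1 mulrC lerDl ltW //.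
Qed.

Lemma rint_affine f L (l a : R) : 0 < l -> continuous f -> supported L f ->
  rint (fun x => f (l * (x - a))) = l^-1 * rint f.
Proof.
move=> l0 cf sf; have ln : l != 0 by rewrite gt_eqF.
have [F [dF F0 F1]] := antiderivative cf sf.
have da x : is_derive x (1 : R) (fun x => l * (x - a)) l.
  have -> : (fun x => l * (x - a)) = l *: ((@id R) - cst a) by [].
  by apply: is_derive_eq; rewrite subr0 scaler1.
have d x : is_derive x (1 : R) (fun x => l^-1 * F (l * (x - a))) (f (l * (x - a))).
  have H := @is_derive1_comp R F (fun x => l * (x - a)) x _ _ (dF _) (da x).
  apply: (is_derive_eq (is_deriveZ l^-1 H)).
  by rewrite /GRing.scale /=; field.
have c : continuous (fun x => f (l * (x - a))).
  move=> x; apply: (@continuous_comp _ _ _ (fun x => l * (x - a)) f); last exact: cf.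
  by apply: differentiable_continuous; apply/derivable1_diffP; case: (da x).
set M := `|L| / l + `|a|.
have s : supported M (fun x => f (l * (x - a))).
  move=> x xM; apply: sf; apply: le_lt_trans (ler_norm L) _.
  rewrite normrM (gtr0_norm l0) mulrC -ltr_pdivrMr //.
  by have := lerB_dist x a; move: xM; rewrite /M; lra.
have M0 : 0 <= M by rewrite addr_ge0 // divr_ge0 // ltW.
have M1 : M < M + 1 by rewrite ltrDl.
have H1 : `|L| / l < M + 1 - a by rewrite /M; have := ler_norm a; lra.
have H2 : `|L| / l < M + 1 + a by rewrite /M; have := ler_norm (- a); rewrite normrN; lra.
have M10 : 0 <= M + 1 by rewrite addr_ge0.
rewrite (rint_antiderivative c s d M1 M10).
rewrite ltr_pdivrMr // mulrC in H1; rewrite ltr_pdivrMr // mulrC in H2.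
rewrite F1; last by apply: le_trans (ler_norm L) _; exact: ltW.
rewrite F0 ?mulr0 ?subr0 //.
by have := ler_norm L; move: H2; rewrite -opprD mulrN; lra.
Qed.

Lemma rint_ge0 f : (forall x, 0 <= f x) -> 0 <= rint f.
Proof. by move=> f0; apply: Rintegral_ge0. Qed.

(** If the integral were 0, the nondecreasing primitive would be squeezed between 0 and 0, so its
    derivative [f] would vanish everywhere. *)
Lemma rint_gt0 f L x0 : continuous f -> supported L f -> (forall x, 0 <= f x) ->
  0 < f x0 -> 0 < rint f.
Proof.
move=> cf sf f0 fx0; rewrite lt_neqAle rint_ge0 // andbT; apply/eqP => E.
have [F [dF F0 F1]] := antiderivative cf sf.
have mono x y : x <= y -> F x <= F y.
  move=> xy; have [c _] := mean_value xy (fun x _ => dF x).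
  by rewrite -subr_ge0 => ->; rewrite mulr_ge0 // subr_ge0.
have FE x : F x = 0.
  apply: le_anti; apply/andP; split.
    apply: le_trans (mono x (Num.max x L) _) _; first by rewrite le_max lexx.
    by rewrite F1 -?E // le_max lexx orbT.
  apply: le_trans (mono (Num.min x (- L - 1)) x _); last by rewrite ge_min lexx.
  by rewrite F0 // gt_min; apply/orP; right; lra.
have [_ D] := dF x0.
have /eqP : f x0 = 0.
  by rewrite -D (_ : F = cst 0) ?derive_cst //; apply/funext.
by rewrite gt_eqF.
Qed.

End CompactlySupported.

(** * Iterated integrals of Lipschitz functions *)

Section IteratedIntegral.
Context {R : realType}.

Fixpoint rint_rV (m : nat) : ('rV[R]_m -> R) -> R :=
  match m with
  | 0 => fun F => F 0
  | k.+1 => fun F => rint (fun x => rint_rV (fun y : 'rV[R]_k =>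
        F (row_mx (x%:M : 'rV[R]_1) y : 'rV[R]_(1 + k))))
  end.

Definition lipschitz_fun {V : normedModType R} (f : V -> R) :=
  exists2 k : R, 0 <= k & forall x y, `|f x - f y| <= k * `|x - y|.

(** Lipschitz rather than continuous: integrating over a slice preserves this class with explicit
    constants, which keeps the induction on the dimension inside it. *)
Definition lip_supp {V : normedModType R} (L : R) (f : V -> R) :=
  lipschitz_fun f /\ supported L f.

Lemma lipschitz_continuous {V : normedModType R} (f : V -> R) : lipschitz_fun f -> continuous f.
Proof.
move=> [k k0 fk] x; apply/cvgrPdist_le => e e0.
have d0 : 0 < e / (k + 1) by rewrite divr_gt0 // ltr_wpDl.
apply/nbhs_ballP; exists (e / (k + 1)) => //= y; rewrite -ball_normE /= => xy.
apply: le_trans (fk _ _) _.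
rewrite ltr_pdivlMr ?ltr_wpDl // in xy.
by have := normr_ge0 (x - y); nra.
Qed.

Lemma lip_supp_le {V : normedModType R} L L' (f : V -> R) : L <= L' -> lip_supp L f -> lip_supp L' f.
Proof. by move=> LL [lf sf]; split=> // x xL; apply: sf; exact: le_lt_trans xL. Qed.

Lemma lip_supp_lin {V : normedModType R} L (a : R) (f g : V -> R) :
  lip_supp L f -> lip_supp L g -> lip_supp L (fun x => a * f x + g x).
Proof.
move=> [[k k0 fk] sf] [[k' k'0 gk] sg]; split; last first.
  by move=> x xL; rewrite sf // sg // mulr0 addr0.
exists (`|a| * k + k') => [|x y]; first by rewrite addr_ge0 // mulr_ge0.
have -> : a * f x + g x - (a * f y + g y) = a * (f x - f y) + (g x - g y) by ring.
apply: le_trans (ler_normD _ _) _; rewrite mulrDl -mulrA normrM.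
by apply: lerD => //; apply: ler_wpM2l.
Qed.

Lemma lip_supp0 {V : normedModType R} L : lip_supp L (fun _ : V => 0).
Proof. by split=> //; exists 0 => // x y; rewrite subrr normr0 mul0r. Qed.

Lemma lip_supp_affine {V : normedModType R} L (l : R) (a : V) (f : V -> R) : 0 < l ->
  lip_supp L f -> lip_supp (`|L| / l + `|a|) (fun x => f (l *: (x - a))).
Proof.
move=> l0 [[k k0 fk] sf]; split.
  exists (k * l) => [|x y]; first by rewrite mulr_ge0 // ltW.
  apply: le_trans (fk _ _) _; rewrite -scalerBr normrZ (gtr0_norm l0) mulrA.
  by rewrite opprB addrA subrK.
move=> x xM; apply: sf; apply: le_lt_trans (ler_norm L) _.
rewrite normrZ (gtr0_norm l0) mulrC -ltr_pdivrMr //.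
by have := lerB_dist x a; move: xM; lra.
Qed.

Lemma row_mx_sub k (x x' : R) (y y' : 'rV[R]_k) :
  (row_mx (x%:M : 'rV[R]_1) y - row_mx (x'%:M : 'rV[R]_1) y' : 'rV[R]_(1 + k)) =
  row_mx ((x - x')%:M : 'rV[R]_1) (y - y').
Proof. by rewrite opp_row_mx add_row_mx raddfB. Qed.

Lemma norm_row_mx k (x : R) (y : 'rV[R]_k) :
  `|row_mx (x%:M : 'rV[R]_1) y : 'rV[R]_(1 + k)| = Num.max `|x| `|y|.
Proof.
apply: le_anti; apply/andP; split.
  apply: rV_norm_le; first by rewrite le_max normr_ge0.
  move=> i; rewrite mxE; case: splitP => j _.
    by rewrite ord1 mxE eqxx mulr1n le_max lexx.
  by rewrite le_max coord_le_norm orbT.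
rewrite ge_max; apply/andP; split.
  have := coord_le_norm (row_mx (x%:M : 'rV[R]_1) y : 'rV[R]_(1 + k)) (lshift k 0).
  by rewrite row_mxEl mxE eqxx mulr1n.
apply: rV_norm_le => // i.
have := coord_le_norm (row_mx (x%:M : 'rV[R]_1) y : 'rV[R]_(1 + k)) (rshift 1 i).
by rewrite row_mxEr.
Qed.

Lemma scale_row_mx_sub k (l x x' : R) (y y' : 'rV[R]_k) :
  (l *: (row_mx (x%:M : 'rV[R]_1) y - row_mx (x'%:M : 'rV[R]_1) y') : 'rV[R]_(1 + k)) =
  row_mx ((l * (x - x'))%:M : 'rV[R]_1) (l *: (y - y')).
Proof. by rewrite row_mx_sub scale_row_mx scale_scalar_mx. Qed.

Lemma row_mx_surj k (a : 'rV[R]_(1 + k)) :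
  exists (x : R) (y : 'rV[R]_k), a = row_mx (x%:M : 'rV[R]_1) y.
Proof.
exists (lsubmx a 0 0), (rsubmx a); rewrite -[LHS](@hsubmxK _ 1 1 k); congr row_mx.
by apply/rowP => j; rewrite ord1 [RHS]mxE eqxx mulr1n.
Qed.

Lemma lip_supp_slice k L (f : 'rV[R]_(1 + k) -> R) (x : R) : lip_supp L f ->
  lip_supp L (fun y : 'rV[R]_k => f (row_mx (x%:M : 'rV[R]_1) y)).
Proof.
move=> [[c c0 fc] sf]; split; last first.
  by move=> y yL; apply: sf; rewrite norm_row_mx lt_max yL orbT.
exists c => // y y'; apply: le_trans (fc _ _) _.
by rewrite row_mx_sub norm_row_mx subrr normr0 max_r.
Qed.

(** Linearity and the bound are proved together: in dimension k both are needed to see that the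
    slice integral is a Lipschitz function of the remaining variable, as the bound is applied to a
    difference of two slices. *)
Lemma rint_rV_basic (L : R) : 0 <= L -> forall m,
  (forall (a : R) (f g : 'rV[R]_m -> R), lip_supp L f -> lip_supp L g ->
    rint_rV (fun x => a * f x + g x) = a * rint_rV f + rint_rV g) /\
  (forall (f : 'rV[R]_m -> R) (M : R), lip_supp L f -> (forall x, `|f x| <= M) ->
    `|rint_rV f| <= (2 * L) ^+ m * M).
Proof.
move=> L0; elim=> [|k [IHl IHb]].
  by split=> // f M _ fM; rewrite expr0 mul1r; exact: fM.
have inner (f : 'rV[R]_(1 + k) -> R) : lip_supp L f ->
    lip_supp L (fun x : R => rint_rV (fun y : 'rV[R]_k => f (row_mx (x%:M : 'rV[R]_1) y))).
  move=> hf; have [[c c0 fc] sf] := hf; split; last first.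
    move=> x xL; rewrite (_ : (fun y => _) = (fun=> 0)); last first.
      by apply/funext => y; apply: sf; rewrite norm_row_mx lt_max xL.
    apply/eqP; rewrite -normr_le0 -[leRHS](mulr0 ((2 * L) ^+ k)); apply: IHb.
      exact: lip_supp0.
    by move=> y; rewrite normr0.
  exists ((2 * L) ^+ k * c) => [|x x'].
    by rewrite mulr_ge0 // exprn_ge0 // mulr_ge0.
  have -> : rint_rV (fun y : 'rV[R]_k => f (row_mx (x%:M : 'rV[R]_1) y)) -
     rint_rV (fun y : 'rV[R]_k => f (row_mx (x'%:M : 'rV[R]_1) y)) =
     rint_rV (fun y : 'rV[R]_k => -1 * f (row_mx (x'%:M : 'rV[R]_1) y) +
                     f (row_mx (x%:M : 'rV[R]_1) y)).
    by rewrite IHl ?mulN1r 1?addrC //; exact: lip_supp_slice.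
  rewrite -mulrA; apply: IHb.
    by apply: lip_supp_lin; exact: lip_supp_slice.
  move=> y; rewrite mulN1r addrC; apply: le_trans (fc _ _) _.
  by rewrite row_mx_sub norm_row_mx subrr normr0 max_l.
split=> [a f g hf hg|f M hf fM] /=.
  have [lf sf] := inner _ hf; have [lg sg] := inner _ hg.
  rewrite -(rint_lin a (lipschitz_continuous lf) (lipschitz_continuous lg) sf sg).
  congr rint; apply/funext => x; apply: IHl; exact: lip_supp_slice.
have [lf sf] := inner _ hf.
rewrite exprS -mulrA; apply: rint_bound => //; first exact: lipschitz_continuous.
by move=> x; apply: IHb => //; exact: lip_supp_slice.
Qed.

Section Fixed.
Context {m : nat}.
Implicit Types (f g : 'rV[R]_m -> R) (L : R).

Lemma rint_rV_lin L (a : R) f g : 0 <= L -> lip_supp L f -> lip_supp L g ->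
  rint_rV (fun x => a * f x + g x) = a * rint_rV f + rint_rV g.
Proof. by move=> /rint_rV_basic /(_ m)[H _]; exact: H. Qed.

Lemma rint_rV_bound L f M : 0 <= L -> lip_supp L f -> (forall x, `|f x| <= M) ->
  `|rint_rV f| <= (2 * L) ^+ m * M.
Proof. by move=> /rint_rV_basic /(_ m)[_ H]; exact: H. Qed.

Lemma rint_rV0 : rint_rV (fun _ : 'rV[R]_m => 0) = 0.
Proof.
apply/eqP; rewrite -normr_le0 -[leRHS](mulr0 ((2 * (0 : R)) ^+ m)); apply: rint_rV_bound => //.
  exact: lip_supp0.
by move=> y; rewrite normr0.
Qed.

Lemma rint_rV_scale L (a : R) f : 0 <= L -> lip_supp L f ->
  rint_rV (fun x => a * f x) = a * rint_rV f.
Proof.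
move=> L0 hf; have := rint_rV_lin a L0 hf (lip_supp0 L).
by under eq_fun do rewrite addr0; rewrite rint_rV0 addr0.
Qed.

Lemma rint_rV_add L f g : 0 <= L -> lip_supp L f -> lip_supp L g ->
  rint_rV (fun x => f x + g x) = rint_rV f + rint_rV g.
Proof.
move=> L0 hf hg; have := rint_rV_lin 1 L0 hf hg.
by under eq_fun do rewrite mul1r; rewrite mul1r.
Qed.

Lemma lip_supp_sum L (I : Type) (r : seq I) (F : I -> 'rV[R]_m -> R) :
  (forall i, lip_supp L (F i)) -> lip_supp L (fun x => \sum_(i <- r) F i x).
Proof.
move=> hF; elim: r => [|i r IH].
  by under eq_fun do rewrite big_nil; exact: lip_supp0.
have := lip_supp_lin 1 (hF i) IH.
by under eq_fun do rewrite mul1r -(big_cons _ _ i r xpredT (fun i => F i _)).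
Qed.

Lemma rint_rV_sum L (I : Type) (r : seq I) (F : I -> 'rV[R]_m -> R) : 0 <= L ->
  (forall i, lip_supp L (F i)) ->
  rint_rV (fun x => \sum_(i <- r) F i x) = \sum_(i <- r) rint_rV (F i).
Proof.
move=> L0 hF; elim: r => [|i r IH].
  by under eq_fun do rewrite big_nil; rewrite rint_rV0 big_nil.
under eq_fun do rewrite big_cons.
by rewrite (rint_rV_add L0 (hF i) (lip_supp_sum r hF)) IH big_cons.
Qed.

End Fixed.

Lemma lip_supp_inner k L (f : 'rV[R]_(1 + k) -> R) : 0 <= L -> lip_supp L f ->
    lip_supp L (fun x : R => rint_rV (fun y : 'rV[R]_k => f (row_mx (x%:M : 'rV[R]_1) y))).
Proof.
move=> L0 hf; have [[c c0 fc] sf] := hf; split; last first.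
  move=> x xL; rewrite -[RHS](@rint_rV0 k); congr rint_rV.
  by apply/funext => y; apply: sf; rewrite norm_row_mx lt_max xL.
exists ((2 * L) ^+ k * c) => [|x x']; first by rewrite mulr_ge0 // exprn_ge0 // mulr_ge0.
rewrite addrC -mulN1r -(rint_rV_lin (-1) L0 (lip_supp_slice x' hf) (lip_supp_slice x hf)).
rewrite -mulrA; apply: rint_rV_bound => //.
  by apply: lip_supp_lin; exact: lip_supp_slice.
move=> y; rewrite mulN1r addrC; apply: le_trans (fc _ _) _.
by rewrite row_mx_sub norm_row_mx subrr normr0 max_l.
Qed.

Lemma rint_rV_affine m (f : 'rV[R]_m -> R) L (l : R) (a : 'rV[R]_m) : 0 < l -> 0 <= L ->
  lip_supp L f -> rint_rV (fun x => f (l *: (x - a))) = l^-1 ^+ m * rint_rV f.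
Proof.
move=> l0 L0; elim: m f a => [|k IH] f a hf /=.
  by rewrite expr0 mul1r; congr f; apply/rowP => -[].
have [a0 [a1 ->]] := row_mx_surj (a : 'rV[R]_(1 + k)).
have E x : rint_rV (fun y : 'rV[R]_k => f (l *: (row_mx (x%:M : 'rV[R]_1) y - row_mx (a0%:M : 'rV[R]_1) a1))) =
   l^-1 ^+ k * rint_rV (fun y : 'rV[R]_k => f (row_mx ((l * (x - a0))%:M : 'rV[R]_1) y)).
  rewrite -(IH _ a1 (lip_supp_slice _ hf)); congr rint_rV; apply/funext => y.
  by apply: (congr1 f); exact: scale_row_mx_sub.
under eq_fun do rewrite E.
have [lf sf] := lip_supp_inner L0 hf.
have h := lip_supp_affine a0 l0 (conj lf sf).
have [lf' sf'] := h.
have e0 : supported (`|L| / l + `|a0|) (fun _ : R => 0 : R) by [].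
have c0 : continuous (fun _ : R => 0 : R) by move=> x; exact: cst_continuous.
have := rint_lin (l^-1 ^+ k) (lipschitz_continuous lf') c0 sf' e0.
under eq_fun do rewrite addr0.
move=> ->; rewrite (rint_affine a0 l0 (lipschitz_continuous lf) sf).
by rewrite /rint Rintegral_cst // mul0r addr0 exprS mulrA [l^-1 * _]mulrC.
Qed.

Lemma rint_rV_ge0 m (f : 'rV[R]_m -> R) : (forall x, 0 <= f x) -> 0 <= rint_rV f.
Proof.
elim: m f => [|k IH] f f0 /=; first exact: f0.
by apply: rint_ge0 => x; apply: IH.
Qed.

Lemma rint_rV_gt0 m (f : 'rV[R]_m -> R) L x0 : 0 <= L -> lip_supp L f ->
  (forall x, 0 <= f x) -> 0 < f x0 -> 0 < rint_rV f.
Proof.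
move=> L0; elim: m f x0 => [|k IH] f x0 hf f0 fx0 /=.
  by rewrite (_ : 0 = x0) //; apply/rowP => -[].
have [lf sf] := lip_supp_inner L0 hf.
have [a0 [a1 aE]] := row_mx_surj (x0 : 'rV[R]_(1 + k)).
apply: (@rint_gt0 _ _ L a0 (lipschitz_continuous lf) sf).
  by move=> x; apply: rint_rV_ge0.
by apply: (IH _ a1 (lip_supp_slice _ hf)) => //; rewrite -aE.
Qed.

Lemma rint_rV_abs_le m L (b f : 'rV[R]_m -> R) e : 0 <= L -> lip_supp L b -> lip_supp L f ->
  (forall x, `|f x| <= e * b x) -> `|rint_rV f| <= e * rint_rV b.
Proof.
move=> L0 hb hf H.
have hf' : lip_supp L (fun x => -1 * f x).
  by have := lip_supp_lin (-1) hf (lip_supp0 L); under eq_fun do rewrite addr0.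
have P1 : 0 <= rint_rV (fun x => e * b x + f x).
  by apply: rint_rV_ge0 => x; have := H x; rewrite ler_norml => /andP[]; lra.
have P2 : 0 <= rint_rV (fun x => e * b x + -1 * f x).
  by apply: rint_rV_ge0 => x; have := H x; rewrite ler_norml => /andP[]; lra.
rewrite (rint_rV_lin e L0 hb hf) in P1.
rewrite (rint_rV_lin e L0 hb hf') (rint_rV_scale _ L0 hf) in P2.
by rewrite ler_norml; apply/andP; split; lra.
Qed.

Lemma bound_CN_lipschitz {V : normedModType R} (f : V -> R) B : rsmooth f -> bound_CN 1 f B ->
  forall x y, `|f x - f y| <= B * `|x - y|.
Proof.
move=> sf Bf x y; have B0 := bound_CN_ge0 Bf.
have D z : `|'D_(x - y) f z| <= B * `|x - y|.
  have [->|w0] := eqVneq (x - y) 0.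
    by rewrite derive0 normr0 mulr_ge0.
  have n0 : 0 < `|x - y| by rewrite normr_gt0.
  set w := x - y in w0 n0 *; set u := `|w|^-1 *: w.
  have u1 : `|u| <= 1 by rewrite normrZ normfV normr_id mulVf // gt_eqF.
  have -> : 'D_w f z = `|w| * 'D_u f z.
    rewrite -derivative_scale; last exact: rsmooth_differentiable.
    by congr ('D__ _ _); rewrite scalerA divff ?scale1r // gt_eqF.
  rewrite normrM normr_id mulrC ler_wpM2r //.
  have := Bf z [:: u] isT; rewrite expr1n mulr1; apply.
  by move=> v; rewrite inE => /eqP ->.
have := @dist_le_of_derivative_bound R (fun t => f (y + t *: (x - y)))
  (fun t => 'D_(x - y) f (y + t *: (x - y))) 0 1 (B * `|x - y|).
rewrite scale1r scale0r addr0 subr0 normr1 mulr1 [y + _]addrC subrK; apply => // t _.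
by apply: is_derive_line; exact: rsmooth_differentiable.
Qed.

Lemma rtest_lip_supp m (f : 'rV[R]_m -> R) r : rtest r f -> lip_supp r f.
Proof.
move=> tf; have [sf z] := tf; have [B HB] := rtest_bound_rV 1 tf.
by split=> //; exists B; [exact: bound_CN_ge0 HB|exact: bound_CN_lipschitz].
Qed.

(** By translation invariance every difference quotient of [f] has integral 0, and it differs from
    the derivative by at most a constant times [h]. No exchange of the order of integration is
    involved. *)
Lemma rint_rV_derive m (f : 'rV[R]_m -> R) r (i : 'I_m) : 0 <= r -> rtest r f ->
  rint_rV (fun x => 'D_(delta_mx 0 i) f x) = 0.
Proof.
move=> r0 tf; set v : 'rV[R]_m := delta_mx 0 i.
have v1 : `|v| <= 1 by exact: delta_mx_norm.
have [sf _] := tf; have tDf := rtest_derive v tf; have [sDf _] := tDf.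
have [B HB] := rtest_bound_rV 1 tDf; have B0 := bound_CN_ge0 HB.
have hf := rtest_lip_supp tf; have hDf := rtest_lip_supp tDf.
have r1 : 0 <= r + 1 by rewrite addr_ge0.
set C := (2 * (r + 1)) ^+ m * B.
have C0 : 0 <= C by rewrite mulr_ge0 // exprn_ge0 // mulr_ge0.
suff H h : 0 < h <= 1 -> `|rint_rV (fun x => 'D_v f x)| <= C * h.
  apply/eqP; rewrite -normr_le0; apply/ler_addgt0Pr => e e0; rewrite add0r.
  pose h := Num.min 1 (e / (C + 1)).
  have d0 : 0 < e / (C + 1) by rewrite divr_gt0 // ltr_wpDl.
  apply: le_trans (H h _) _; first by rewrite lt_min ltr01 d0 ge_min lexx.
  have : h <= e / (C + 1) by rewrite ge_min lexx orbT.
  have : 0 < h by rewrite lt_min ltr01 d0.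
  by rewrite ler_pdivlMr ?ltr_wpDl //; nra.
move=> /andP[h0 h1].
have ht : lip_supp (r + 1) (fun x => f (1 *: (x - (- h *: v)))).
  apply: lip_supp_le (lip_supp_affine (- h *: v) ltr01 hf).
  rewrite divr1 ger0_norm // lerD2l normrZ normrN (gtr0_norm h0).
  by have := normr_ge0 v; nra.
have hf1 : lip_supp (r + 1) f by apply: lip_supp_le hf; rewrite lerDl.
have hDf1 : lip_supp (r + 1) (fun x => 'D_v f x) by apply: lip_supp_le hDf; rewrite lerDl.
pose g x := h^-1 * f x + 'D_v f x.
have hg : lip_supp (r + 1) g by exact: lip_supp_lin.
have E : rint_rV (fun x => - h^-1 * f (1 *: (x - (- h *: v))) + g x) = rint_rV (fun x => 'D_v f x).
  rewrite (rint_rV_lin _ r1 ht hg) (rint_rV_lin _ r1 hf1 hDf1).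
  by rewrite (rint_rV_affine _ ltr01 r0 hf) invr1 expr1n mul1r mulNr addKr.
rewrite -E -mulrA; apply: rint_rV_bound => //; first exact: lip_supp_lin.
move=> x; rewrite /g scale1r scaleNr opprK.
have [|c /andP[c0 ch]] := @mean_value R (fun t => f (x + t *: v)) (fun t => 'D_v f (x + t *: v)) 0 h (ltW h0).
  by move=> t _; apply: is_derive_line; exact: rsmooth_differentiable.
rewrite scale0r addr0 subr0 => E2.
have -> : - h^-1 * f (x + h *: v) + (h^-1 * f x + 'D_v f x) = 'D_v f x - 'D_v f (x + c *: v).
  have -> : 'D_v f (x + c *: v) = h^-1 * (f (x + h *: v) - f x).
    by rewrite E2 mulrC mulfK // gt_eqF.
  by ring.
apply: le_trans (bound_CN_lipschitz sDf HB _ _) _.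
rewrite opprD addNKr normrN normrZ (ger0_norm c0) ler_wpM2l //.
by have := normr_ge0 v; nra.
Qed.

End IteratedIntegral.

(** * Functionals with factorial derivative bounds *)

Section Functionals.
Context {R : realType} {V : normedModType R}.
Implicit Types (u : (V -> R) -> R) (phi psi : V -> R) (r : R).

Definition linear_on r u := forall (a : R) phi psi, rtest r phi -> rtest r psi ->
  u (fun x => a * phi x + psi x) = a * u phi + u psi.

Definition bounded_on r (N : nat) (C : R) u := forall phi B, rtest r phi ->
  bound_CN N phi B -> `|u phi| <= C * B.

Lemma linear_on0 r u : linear_on r u -> u (fun=> 0) = 0.
Proof.
move=> lu; have := lu 1 _ _ (@rtest0 _ _ r) (@rtest0 _ _ r).
under eq_fun do rewrite mulr0 addr0.
by rewrite mul1r => /eqP; rewrite -subr_eq0 opprD addNKr oppr_eq0 => /eqP.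
Qed.

Lemma linear_on_scale r u a phi : linear_on r u -> rtest r phi ->
  u (fun x => a * phi x) = a * u phi.
Proof.
move=> lu tp; have := lu a _ _ tp (@rtest0 _ _ r).
by under eq_fun do rewrite addr0; rewrite (linear_on0 lu) addr0.
Qed.

Lemma linear_on_add r u phi psi : linear_on r u -> rtest r phi -> rtest r psi ->
  u (fun x => phi x + psi x) = u phi + u psi.
Proof.
move=> lu tp tq; have := lu 1 _ _ tp tq.
by under eq_fun do rewrite mul1r; rewrite mul1r.
Qed.

Lemma rtest_sum r (I : Type) (s : seq I) (F : I -> V -> R) : (forall i, rtest r (F i)) ->
  rtest r (fun x => \sum_(i <- s) F i x).
Proof.
move=> tF; elim: s => [|i s IH].
  by under eq_fun do rewrite big_nil; exact: rtest0.
have := rtest_lin 1 (tF i) IH.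
by under eq_fun do rewrite mul1r -(big_cons _ _ i s xpredT (fun i => F i _)).
Qed.

Lemma linear_on_sum r u (I : Type) (s : seq I) (F : I -> V -> R) : linear_on r u ->
  (forall i, rtest r (F i)) ->
  u (fun x => \sum_(i <- s) F i x) = \sum_(i <- s) u (F i).
Proof.
move=> lu tF; elim: s => [|i s IH].
  by under eq_fun do rewrite big_nil; rewrite big_nil (linear_on0 lu).
under eq_fun do rewrite big_cons.
by rewrite (linear_on_add lu (tF i) (rtest_sum s tF)) IH big_cons.
Qed.

Lemma taylor_order1 (g g1 g2 : R -> R) (t0 h B : R) :
  (forall t, `|t - t0| <= `|h| -> is_derive t (1 : R) g (g1 t)) ->
  (forall t, `|t - t0| <= `|h| -> is_derive t (1 : R) g1 (g2 t)) ->
  (forall t, `|t - t0| <= `|h| -> `|g2 t| <= B) ->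
  `|g (t0 + h) - g t0 - h * g1 t0| <= B * h ^+ 2.
Proof.
move=> dg dg1 b2.
have seg (s t : R) : `|s - t0| <= `|h| -> Num.min t0 s <= t <= Num.max t0 s -> `|t - t0| <= `|h|.
  move=> sh /andP[]; rewrite ge_min le_max => H1 H2; apply: le_trans sh.
  case/orP: H1 => H1; case/orP: H2 => H2.
  - have -> : t = t0 by apply: le_anti; rewrite H1 H2.
    by rewrite subrr normr0.
  - by rewrite !ger0_norm ?subr_ge0 ?lerD2r // (le_trans H1).
  - by rewrite !ler0_norm ?subr_le0 ?(le_trans H1) // lerN2 lerD2r.
  - by have -> : t = s by apply: le_anti; rewrite H1 H2.
have b1 t : `|t - t0| <= `|h| -> `|g1 t - g1 t0| <= B * `|h|.
  move=> th; have B0 : 0 <= B by apply: le_trans (b2 t th).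
  apply: le_trans (ler_wpM2l B0 th).
  apply: (dist_le_of_derivative_bound (df := g2)) => s /(seg _ _ th) sh; [exact: dg1|exact: b2].
have hh : `|t0 + h - t0| <= `|h| by rewrite addrAC subrr add0r.
have := @dist_le_of_derivative_bound R (fun t => g t - t * g1 t0) (fun t => g1 t - g1 t0)
  t0 (t0 + h) (B * `|h|).
have -> : g (t0 + h) - (t0 + h) * g1 t0 - (g t0 - t0 * g1 t0) =
  g (t0 + h) - g t0 - h * g1 t0 by ring.
have -> : B * `|h| * `|t0 + h - t0| = B * h ^+ 2.
  by rewrite addrAC subrr add0r -mulrA -expr2 real_normK // num_real.
apply => [t /(seg _ _ hh) th|t /(seg _ _ hh) th]; last exact: b1.
apply: is_deriveB; first exact: dg.
have -> : (fun t => t * g1 t0) = g1 t0 *: (@id R) by apply/funext => s; rewrite /= mulrC.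
by apply: is_derive_eq; rewrite scaler1.
Qed.

(** Differentiation under a functional: [F1] and [F2] are the first two derivatives of the family in
    the parameter. A C^N bound on [F2] makes the first-order Taylor remainder of the family O(h^2)
    in the C^N norm, hence also after applying [u]. *)
Lemma is_derive_functional r N C u (F F1 F2 : R -> V -> R) (t0 d B : R) :
  linear_on r u -> bounded_on r N C u -> 0 < d -> 0 <= C ->
  (forall t, `|t - t0| <= d -> rtest r (F t)) ->
  (forall t, `|t - t0| <= d -> rtest r (F1 t)) ->
  (forall vs x t, `|t - t0| <= d ->
     is_derive t (1 : R) (fun s => rderives vs (F s) x) (rderives vs (F1 t) x)) ->
  (forall vs x t, `|t - t0| <= d ->
     is_derive t (1 : R) (fun s => rderives vs (F1 s) x) (rderives vs (F2 t) x)) ->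
  (forall t, `|t - t0| <= d -> bound_CN N (F2 t) B) ->
  is_derive t0 (1 : R) (fun t => u (F t)) (u (F1 t0)).
Proof.
move=> lu bu d0 C0 tF tF1 dF dF1 bF2.
have t00 : `|t0 - t0| <= d by rewrite subrr normr0 ltW.
have B0 : 0 <= B by apply: (bound_CN_ge0 (bF2 t0 t00)).
have K h : `|h| <= d -> `|u (F (t0 + h)) - u (F t0) - h * u (F1 t0)| <= C * B * h ^+ 2.
  move=> hd; have th : `|t0 + h - t0| <= d by rewrite addrAC subrr add0r.
  have T1 := rtest_lin (- h) (tF1 _ t00) (tF _ th).
  have -> : u (F (t0 + h)) - u (F t0) - h * u (F1 t0) =
      u (fun x => -1 * F t0 x + (- h * F1 t0 x + F (t0 + h) x)).
    by rewrite lu // ?lu //; [ring|exact: tF1|exact: tF|exact: tF].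
  rewrite -mulrA; apply: bu; first exact: rtest_lin (tF _ t00) T1.
  move=> x vs sz v1; rewrite expr1n mulr1.
  have [s1 _] := tF _ t00; have [s2 _] := tF1 _ t00; have [s3 _] := tF _ th.
  rewrite rderives_lin //; last by case: T1.
  rewrite rderives_lin //.
  have -> : -1 * rderives vs (F t0) x +
    (- h * rderives vs (F1 t0) x + rderives vs (F (t0 + h)) x) =
    rderives vs (F (t0 + h)) x - rderives vs (F t0) x - h * rderives vs (F1 t0) x by ring.
  apply: (@taylor_order1 (fun t => rderives vs (F t) x) (fun t => rderives vs (F1 t) x)
    (fun t => rderives vs (F2 t) x)) => t /le_trans/(_ hd) td; [exact: dF|exact: dF1|].
  by have := bF2 t td x vs sz v1; rewrite expr1n mulr1.
have L : (fun h : R => h^-1 *: (u (F (h *: (1 : R) + t0)) - u (F t0))) @ 0^' --> u (F1 t0).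
  apply/cvgrPdist_le => e e0; near=> h.
  have h0 : h != 0 by near: h; exact: nbhs_dnbhs_neq.
  have hn : 0 < `|h| by rewrite normr_gt0.
  rewrite [h%:A]mulr1 addrC [_ + t0]addrC.
  have -> : - (h^-1 *: (u (F (t0 + h)) - u (F t0))) + u (F1 t0) =
     - (h^-1 * (u (F (t0 + h)) - u (F t0) - h * u (F1 t0))).
    by rewrite /GRing.scale /=; field.
  rewrite normrN normrM normfV mulrC ler_pdivrMr //.
  apply: le_trans (K h _) _; first by near: h; apply: (@dnbhs0_le _ R).
  have : `|h| <= e / (C * B + 1).
    near: h; apply: (@dnbhs0_le _ R); rewrite divr_gt0 // ltr_wpDl // mulr_ge0 //.
  have CB : 0 <= C * B by exact: mulr_ge0.
  rewrite ler_pdivlMr ?ltr_wpDl // -(real_normK (num_real h)) expr2 mulrA => le.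
  by rewrite ler_wpM2r //; nra.
split; first by apply/cvg_ex; exists (u (F1 t0)).
by apply: cvg_lim L.
Unshelve. all: by end_near. Qed.

End Functionals.

(** * Translations and dilations of bumps *)

Section Regularization.
Context {R : realType} {m : nat}.
Local Notation V := 'rV[R]_m.
Implicit Types (u : (V -> R) -> R) (chi phi : V -> R) (a x v : V) (sg : R) (beta : seq 'I_m).

Definition dseq beta : (V -> R) -> V -> R := rderives [seq delta_mx 0 i | i <- beta].

Lemma dseq_cat beta1 beta2 phi : dseq (beta1 ++ beta2) phi = dseq beta1 (dseq beta2 phi).
Proof. by rewrite /dseq map_cat rderives_cat. Qed.

Lemma dseq_rcons beta i phi :
  dseq (rcons beta i) phi = dseq beta (fun x => 'D_(delta_mx 0 i) phi x).
Proof. by rewrite -cats1 dseq_cat. Qed.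

Lemma rtest_translate r (b : V) phi : rtest r phi -> rtest (r + `|b|) (fun x => phi (x - b)).
Proof.
move=> [sp z]; split; first exact: (rsmooth_comp_affine (@affine_map_shift R V (- b)) sp).
move=> x xr; apply: z; have := lerB_dist x b; lra.
Qed.

Lemma rderives_translate (b : V) vs phi : rsmooth phi ->
  rderives vs (fun x => phi (x - b)) = (fun x => rderives vs phi (x - b)).
Proof.
move=> sp; rewrite (rderives_comp_affine vs (@affine_map_shift R V (- b)) sp).
by rewrite map_id.
Qed.

Lemma bound_CN_translate N B (b : V) phi : rsmooth phi -> bound_CN N phi B ->
  bound_CN N (fun x => phi (x - b)) B.
Proof. by move=> sp H x vs sz v1; rewrite rderives_translate //; exact: H. Qed.

Lemma is_derive_translate r rho N C u eta (b e : V) (t0 : R) :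
  linear_on r u -> bounded_on r N C u -> 0 <= C -> rtest rho eta ->
  rho + `|b + t0 *: e| < r ->
  is_derive t0 (1 : R) (fun t => u (fun x => eta (x - (b + t *: e))))
     (- u (fun x => 'D_e eta (x - (b + t0 *: e)))).
Proof.
move=> lu bu C0 te lt; have [se ze] := te.
have tD := rtest_derive e te; have [sD _] := tD.
have tDD := rtest_derive e tD; have [sDD _] := tDD.
have [B HB] := rtest_bound_rV N tDD.
(* How far the parameter can move while the translated support, a ball of radius [rho], stays in the
   ball of radius [r]. *)
set d := (r - (rho + `|b + t0 *: e|)) / (`|e| + 1).
have d0 : 0 < d by rewrite divr_gt0 // subr_gt0.
have tin f t : rtest rho f -> `|t - t0| <= d -> rtest r (fun x => f (x - (b + t *: e))).
  move=> tf td; apply: rtest_leW (rtest_translate _ tf).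
  have -> : b + t *: e = (b + t0 *: e) + (t - t0) *: e by rewrite scalerBl addrA addrAC addrK.
  apply: le_trans (lerD (lexx _) (ler_normD _ _)) _; rewrite normrZ.
  move: td; rewrite /d ler_pdivlMr // => td.
  by have := normr_ge0 (t - t0); have := normr_ge0 e; nra.
have cd f vs x t : rsmooth f ->
    is_derive t (1 : R) (fun s => rderives vs (fun x => f (x - (b + s *: e))) x)
      (rderives vs (fun x => - 'D_e f (x - (b + t *: e))) x).
  move=> sf.
  have -> : (fun s => rderives vs (fun x => f (x - (b + s *: e))) x) =
     (fun s => rderives vs f ((x - b) + s *: (- e))).
    by apply/funext => s; rewrite rderives_translate // opprD addrA scalerN.
  have -> : rderives vs (fun x => - 'D_e f (x - (b + t *: e))) x =
     'D_(- e) (rderives vs f) ((x - b) + t *: (- e)).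
    have sDf := rsmooth_derive e sf.
    have -> : (fun x => - 'D_e f (x - (b + t *: e))) = (fun x => -1 * 'D_e f (x - (b + t *: e))).
      by apply/funext => z; rewrite mulN1r.
    rewrite rderives_scale; last exact: (rsmooth_comp_affine (@affine_map_shift R V (- (b + t *: e))) sDf).
    rewrite (rderives_translate (b + t *: e) vs sDf) -derive_rderives //.
    have -> z : 'D_(- e) (rderives vs f) z = -1 * 'D_e (rderives vs f) z.
      by rewrite -derivative_scale ?scaleN1r; last exact: sf.
    by rewrite scalerN opprD addrA.
  by apply: is_derive_line; exact: sf.
have EN t : u (fun x => -1 * 'D_e eta (x - (b + t *: e))) =
    u (fun x => - 'D_e eta (x - (b + t *: e))).
  by congr u; apply/funext => z; rewrite mulN1r.
have -> : - u (fun x => 'D_e eta (x - (b + t0 *: e))) = u (fun x => - 'D_e eta (x - (b + t0 *: e))).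
  rewrite -EN (linear_on_scale _ lu) ?mulN1r //.
  by apply: (tin (fun x => 'D_e eta x)) => //; rewrite subrr normr0 ltW.
apply: (@is_derive_functional R V r N C u (fun t x => eta (x - (b + t *: e)))
  (fun t x => - 'D_e eta (x - (b + t *: e)))
  (fun t x => 'D_e (fun y => 'D_e eta y) (x - (b + t *: e))) t0 d B lu bu d0 C0).
- by move=> t td; apply: tin.
- move=> t td; have := rtest_lin (-1) (tin _ t tD td) (@rtest0 _ _ r).
  by under eq_fun do rewrite mulN1r addr0.
- by move=> vs x t _; apply: cd.
- move=> vs x t _.
  have -> : (fun s => rderives vs (fun x => - 'D_e eta (x - (b + s *: e))) x) =
     - (fun s => rderives vs (fun x => 'D_e eta (x - (b + s *: e))) x).
    apply/funext => s.
    have -> : (fun x => - 'D_e eta (x - (b + s *: e))) = (fun x => -1 * 'D_e eta (x - (b + s *: e))).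
      by apply/funext => z; rewrite mulN1r.
    rewrite rderives_scale ?mulN1r //.
    exact: (rsmooth_comp_affine (@affine_map_shift R V (- (b + s *: e))) sD).
  have H := is_deriveN (cd _ vs x t sD); apply: (is_derive_eq H).
  have -> : (fun x => - 'D_e (fun y => 'D_e eta y) (x - (b + t *: e))) =
     (fun x => -1 * 'D_e (fun y => 'D_e eta y) (x - (b + t *: e))).
    by apply/funext => z; rewrite mulN1r.
  rewrite rderives_scale; first by rewrite mulN1r opprK.
  exact: (rsmooth_comp_affine (@affine_map_shift R V (- (b + t *: e))) sDD).
- by move=> t td; exact: (@bound_CN_translate N B (b + t *: e) _ sDD HB).
Qed.

(** The functions chi_{a,sigma}; the prefactor keeps the integral independent of [sg]. *)
Definition rescale a sg chi x := expR (m%:R * sg) * chi (expR sg *: (x - a)).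

Lemma affine_map_rescale a sg :
  affine_map (fun x : V => expR sg *: (x - a)) ( *:%R (expR sg)) (expR sg).
Proof.
have := @affine_map_scale_shift R V (expR sg) (expR sg *: - a).
rewrite ger0_norm ?expR_ge0 //.
by under [X in affine_map X]eq_fun do rewrite -scalerDr.
Qed.

Lemma rsmooth_rescale a sg chi : rsmooth chi -> rsmooth (rescale a sg chi).
Proof.
by move=> sc; apply: rsmooth_scale; exact: (rsmooth_comp_affine (affine_map_rescale a sg) sc).
Qed.

Lemma rderives_scaled_directions (c : R) vs chi y : rsmooth chi ->
  rderives [seq c *: v | v <- vs] chi y = c ^+ size vs * rderives vs chi y.
Proof.
move=> sc; elim: vs y => [|v vs IH] y /=; first by rewrite mul1r.
have -> : rderives [seq c *: v | v <- vs] chi = (fun z => c ^+ size vs * rderives vs chi z).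
  by apply/funext => z; rewrite IH.
have sr := rsmooth_derives vs sc.
rewrite derivative_scale; last exact: rsmooth_differentiable (rsmooth_scale _ sr).
have d : derivable (rderives vs chi) y v by apply: diff_derivable; exact: sc.
by rewrite (@deriveZ _ _ _ _ _ _ _ d) exprS mulrA.
Qed.

Lemma rderives_rescale a sg chi vs : rsmooth chi -> rderives vs (rescale a sg chi) =
  (fun x => expR ((m + size vs)%:R * sg) * rderives vs chi (expR sg *: (x - a))).
Proof.
move=> sc; rewrite rderives_scale; last exact: (rsmooth_comp_affine (affine_map_rescale a sg) sc).
rewrite (rderives_comp_affine vs (affine_map_rescale a sg) sc).
apply/funext => x; rewrite rderives_scaled_directions // mulrA; congr (_ * _).
by rewrite -expRM_natl -expRD natrD mulrDl.
Qed.

Lemma rescale_derive a sg chi v : rsmooth chi ->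
  rescale a sg (fun y => 'D_v chi y) = (fun x => expR (- sg) * 'D_v (rescale a sg chi) x).
Proof.
move=> sc; apply/funext => x.
have := rderives_rescale a sg [:: v] sc => /(congr1 (fun f => f x)) /= ->.
rewrite mulrA -expRD; congr (expR _ * _).
by rewrite natrD mulrDl mul1r addrC addrK.
Qed.

Lemma rtest_rescale a sg chi r : rtest 1 chi -> `|a| <= r / 2 -> expR (- sg) <= r / 2 ->
  rtest r (rescale a sg chi).
Proof.
move=> [sc z] ar er; split; first exact: rsmooth_rescale.
move=> x xr; rewrite /rescale z ?mulr0 //.
rewrite normrZ ger0_norm ?expR_ge0 // -ltr_pdivrMl ?expR_gt0 // -expRN mulr1.
by have := lerB_dist x a; lra.
Qed.

Lemma bound_CN_rescale a sg chi N B : 0 <= sg -> rsmooth chi -> bound_CN N chi B ->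
  bound_CN N (rescale a sg chi) (expR ((m + N)%:R * sg) * B).
Proof.
move=> sg0 sc H x.
have s1 : 1 <= expR sg by rewrite -expR0 ler_expR.
have W := wbound_comp_affine (expR_gt0 sg) (affine_map_rescale a sg) sc (H (expR sg *: (x - a))).
rewrite mulr1 in W; have {}W := wbound_weight1 s1 W.
have sc' := rsmooth_comp_affine (affine_map_rescale a sg) sc.
have := wbound_scale (expR (m%:R * sg)) sc' W.
by rewrite ger0_norm ?expR_ge0 // -expRM_natl mulrCA -expRD natrD mulrDl mulrC.
Qed.

(** The generator of these dilations: the derivative of [rescale a sg chi] in [sg] is
    [rescale a sg (euler chi)]. It is the divergence of the vector field y chi(y), which is where
    the gain of a factor [expR (- sg)] comes from. *)
Definition euler chi : V -> R := fun y => m%:R * chi y + 'D_y chi y.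

Lemma derive_radial chi y : rsmooth chi ->
  'D_y chi y = \sum_(i < m) y 0 i * 'D_(delta_mx 0 i) chi y.
Proof.
move=> sc; rewrite {2}(rV_sum_delta y) derivative_sum; last exact: rsmooth_differentiable.
by apply: eq_bigr => i _; apply: derivative_scale; exact: rsmooth_differentiable.
Qed.

Lemma radialE chi : rsmooth chi ->
  (fun y : V => 'D_y chi y) = (fun y : V => \sum_(i < m) y 0 i * 'D_(delta_mx 0 i) chi y).
Proof. by move=> sc; apply/funext => y; exact: derive_radial. Qed.

Lemma rsmooth_radial chi : rsmooth chi -> rsmooth (fun y : V => 'D_y chi y).
Proof.
move=> sc; rewrite (radialE sc); apply: rsmooth_sum => i.
by apply: rsmooth_mul; [exact: rsmooth_coord|exact: rsmooth_derive].
Qed.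

Lemma rsmooth_euler chi : rsmooth chi -> rsmooth (euler chi).
Proof. by move=> sc; apply: rsmooth_add; [exact: rsmooth_scale|exact: rsmooth_radial]. Qed.

Lemma derive_coord_mul chi i v : rsmooth chi ->
  (fun y : V => 'D_v (fun y : V => y 0 i * chi y) y) =
  (fun y : V => v 0 i * chi y + y 0 i * 'D_v chi y).
Proof.
move=> sc; rewrite (derive_mul v (rsmooth_coord i) sc).
by apply/funext => y; rewrite derive_coord.
Qed.

Lemma euler_divergence chi : rsmooth chi ->
  euler chi = (fun y : V => \sum_(i < m) 'D_(delta_mx 0 i) (fun z : V => z 0 i * chi z) y).
Proof.
move=> sc; apply/funext => y; rewrite /euler derive_radial //.
have -> : m%:R * chi y = \sum_(i < m) chi y by rewrite sumr_const card_ord mulr_natl.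
rewrite -big_split /=; apply: eq_bigr => i _.
have := derive_coord_mul i (delta_mx 0 i) sc => /(congr1 (fun f => f y)) /= ->.
by rewrite mxE !eqxx mul1r.
Qed.

Lemma derive_radial_comm chi v : rsmooth chi ->
  (fun y : V => 'D_v (fun z : V => 'D_z chi z) y) =
  (fun y : V => 'D_v chi y + 'D_y (fun z => 'D_v chi z) y).
Proof.
move=> sc; have sDv := rsmooth_derive v sc.
rewrite (radialE sc).
have sF i : rsmooth (fun y : V => y 0 i * 'D_(delta_mx 0 i) chi y).
  by apply: rsmooth_mul; [exact: rsmooth_coord|exact: rsmooth_derive].
have := rderives_sum (index_enum 'I_m) [:: v] sF => /= ->.
apply/funext => y; rewrite (derive_radial y sDv) {2}(rV_sum_delta v).
rewrite derivative_sum; last exact: rsmooth_differentiable.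
rewrite -big_split /=; apply: eq_bigr => i _.
have := derive_coord_mul i v (rsmooth_derive (delta_mx 0 i) sc).
move=> /(congr1 (fun f => f y)) /= ->.
rewrite derivative_scale; last exact: rsmooth_differentiable.
by have := derive_comm v (delta_mx 0 i) sc => /(congr1 (fun f => f y)) /= ->.
Qed.

(** The commutator of ['D_v] with the radial derivative is ['D_v] itself, so each derivative raises
    the coefficient [m] by one; this matches the exponent in [rderives_rescale]. *)
Lemma rderives_euler chi vs : rsmooth chi -> rderives vs (euler chi) =
  (fun y : V => (m + size vs)%:R * rderives vs chi y + 'D_y (rderives vs chi) y).
Proof.
move=> sc; rewrite rderives_lin //; last exact: rsmooth_radial.
have -> : rderives vs (fun y : V => 'D_y chi y) =
   (fun y : V => (size vs)%:R * rderives vs chi y + 'D_y (rderives vs chi) y).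
  elim: vs => [|v vs IH] /=; first by apply/funext => y; rewrite mul0r add0r.
  rewrite IH; have sr := rsmooth_derives vs sc.
  have := rderives_lin (size vs)%:R [:: v] sr (rsmooth_radial sr) => /= ->.
  have := derive_radial_comm v sr => /= E; apply/funext => y.
  by rewrite (congr1 (fun f => f y) E) /= -[(size vs).+1]addn1 natrD mulrDl mul1r addrA.
by apply/funext => y; rewrite natrD mulrDl addrA.
Qed.

Lemma is_derive_rescale_point a chi vs x sg : rsmooth chi ->
  is_derive sg (1 : R) (fun s => rderives vs (rescale a s chi) x)
    (rderives vs (rescale a sg (euler chi)) x).
Proof.
move=> sc; rewrite (rderives_rescale a sg vs (rsmooth_euler sc)) (rderives_euler vs sc).
under [X in is_derive sg 1 X]eq_fun do rewrite (rderives_rescale _ _ _ sc).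
set c := (m + size vs)%:R; set eta := rderives vs chi.
have d1 : is_derive sg (1 : R) (fun s : R => expR (c * s)) (c * expR (c * sg)).
  have dl : is_derive sg (1 : R) (fun s : R => c * s) c.
    have -> : (fun s : R => c * s) = c *: (@id R) by [].
    by apply: is_derive_eq; rewrite scaler1.
  have := @is_derive1_comp R expR (fun s => c * s) sg _ _ (is_derive_expR _) dl.
  by rewrite mulrC.
have d2 : is_derive sg (1 : R) (fun s => eta (expR s *: (x - a))) ('D_(expR sg *: (x - a)) eta (expR sg *: (x - a))).
  apply: (@is_derive_comp_curve _ _ eta (fun s => expR s *: (x - a))); last exact: sc.
  have dd : differentiable (fun s : R => expR s *: (x - a)) sg.
    by apply: differentiableZl; apply/derivable1_diffP.
  split; first exact/derivable1_diffP.
  rewrite deriveE // diffZl; last by apply/derivable1_diffP.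
  by rewrite -deriveE ?derive_val //; apply/derivable1_diffP.
by apply: (is_derive_eq (is_deriveM d1 d2)); rewrite /GRing.scale /=; ring.
Qed.

Lemma rtest_euler chi : rtest 1 chi -> rtest 1 (euler chi).
Proof.
move=> tc; have [sc z] := tc; rewrite (euler_divergence sc).
apply: rtest_sum => i; apply: rtest_derive; apply: rtest_mull => //.
exact: rsmooth_coord.
Qed.

Lemma is_derive_rescale r N C u chi a sg : linear_on r u -> bounded_on r N C u -> 0 <= C ->
  rtest 1 chi -> `|a| <= r / 2 -> expR (- sg) < r / 2 -> 0 < sg ->
  is_derive sg (1 : R) (fun s => u (rescale a s chi)) (u (rescale a sg (euler chi))).
Proof.
move=> lu bu C0 tc ar er sg0.
have te := rtest_euler tc; have tee := rtest_euler te.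
have [sc _] := tc; have [se _] := te; have [see _] := tee.
have [B HB] := rtest_bound_rV N tee.
have r2 : 0 < r / 2 by apply: le_lt_trans er; exact: expR_ge0.
have er' : - ln (r / 2) < sg.
  by rewrite ltrNl -[X in X < _](@expRK R) ltr_ln // posrE ?expR_gt0.
(* On this neighbourhood of [sg] the scale stays nonnegative and the rescaled bump keeps a radius at
   most [r / 2]. *)
set d := Num.min sg (sg + ln (r / 2)).
have d0 : 0 < d by rewrite lt_min sg0 -ltrBlDr add0r.
have H t : `|t - sg| <= d -> 0 <= t /\ expR (- t) <= r / 2.
  rewrite le_min !ler_norml => /andP[/andP[H1 _] /andP[H2 _]]; split; first by lra.
  by rewrite -[leRHS](@lnK R) ?posrE // ler_expR; lra.
have B0 : 0 <= B by exact: bound_CN_ge0 HB.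
apply: (@is_derive_functional R V r N C u (fun s => rescale a s chi)
  (fun s => rescale a s (euler chi)) (fun s => rescale a s (euler (euler chi))) sg d
  (expR ((m + N)%:R * (2 * sg)) * B)) => //.
- by move=> t /H[_ et]; apply: rtest_rescale.
- by move=> t /H[_ et]; apply: rtest_rescale.
- by move=> vs x t _; apply: is_derive_rescale_point.
- by move=> vs x t _; apply: is_derive_rescale_point.
- move=> t td; have [t0 _] := H t td.
  move=> x; have := bound_CN_rescale a t0 see HB; move=> /(_ x).
  apply: wbound_le => //; rewrite ler_wpM2r // ler_expR ler_wpM2l //.
  by move: td; rewrite le_min ler_norml => /andP[/andP[_ +] _]; lra.
Qed.

(** On the unit ball a coordinate and its derivatives are at most 1, so the product has weight 1 +
    1, which costs [2 ^+ N]; outside that ball the product and its derivatives vanish. *)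
Lemma bound_CN_coord_mul N B chi i : rtest 1 chi -> bound_CN N chi B ->
  bound_CN N (fun y : V => y 0 i * chi y) (2 ^+ N * B).
Proof.
move=> tc H y; have [sc _] := tc; have B0 := bound_CN_ge0 H.
have [y1|y1] := leP `|y| 1; last first.
  have t' := rtest_mull (rsmooth_coord i) tc.
  have W0 := @rtest_wbound_outside R V 1 _ N 1 y ler01 t' y1.
  move=> vs sz v1; apply: le_trans (W0 vs sz v1) _.
  by rewrite mul0r expr1n mulr1 mulr_ge0 // exprn_ge0.
have W1 : wbound N 1 1 (fun y : V => y 0 i) y.
  move=> vs _ v1; rewrite expr1n mulr1.
  case/lastP: vs v1 => [_|vs v v1] /=; first exact: le_trans (coord_le_norm y i) y1.
  rewrite rderives_rcons.
  have -> : (fun z : V => 'D_v (fun w : V => w 0 i) z) = (fun=> v 0 i).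
    by apply/funext => z; rewrite derive_coord.
  have := @wbound_cst R V (size vs) 1 (v 0 i) y ler01 vs (leqnn _).
  rewrite expr1n mulr1 => /(_ _)/le_trans; apply.
    by move=> w wv; apply: v1; rewrite mem_rcons inE wv orbT.
  by apply: le_trans (coord_le_norm v i) (v1 _ _); rewrite mem_rcons mem_head.
have := wbound_mul ler01 ler01 (rsmooth_coord i) sc W1 (H y).
move=> /(wbound_weight1 _); rewrite mul1r mulrC -[1 + 1]/(2 : R); apply.
by rewrite ler1n.
Qed.

End Regularization.

(** The limit is the supremum of the lower bounds [q s - M * expR (- s)]; each
    [q t + M * expR (- t)] lies above all of them, which yields existence and rate at once. *)
Lemma exp_cauchy_limit {R : realType} (q : R -> R) (M s0 : R) : 0 <= M ->
  (forall s t, s0 <= s -> s <= t -> `|q t - q s| <= M * expR (- s)) ->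
  exists l, forall s, s0 <= s -> `|q s - l| <= M * expR (- s).
Proof.
move=> M0 H.
pose E := [set q s - M * expR (- s) | s in [set s | s0 <= s]].
have U s t : s0 <= s -> s0 <= t -> q t - M * expR (- t) <= q s + M * expR (- s).
  move=> ss st; have e1 := mulr_ge0 M0 (expR_ge0 (- s)); have e2 := mulr_ge0 M0 (expR_ge0 (- t)).
  have [st'|/ltW ts] := leP s t.
    by have := H _ _ ss st'; rewrite ler_norml => /andP[]; lra.
  by have := H _ _ st ts; rewrite ler_norml => /andP[]; lra.
have hE : has_sup E.
  split; first by exists (q s0 - M * expR (- s0)); exists s0 => //=.
  by exists (q s0 + M * expR (- s0)) => _ [t /= st <-]; apply: U.
exists (sup E) => s ss.
have L1 : q s - M * expR (- s) <= sup E by apply: sup_upper_bound => //; exists s.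
have L2 : sup E <= q s + M * expR (- s).
  by apply: ge_sup; [case: hE|move=> _ [t /= st <-]; apply: U].
by rewrite ler_norml; apply/andP; split; lra.
Qed.

(** The binomial coefficient is one term of (1 + 1)^(k + j). This trades a factorial of a sum for a
    product of factorials at the price of doubling the base of the geometric factor. *)
Lemma fact_double k j : ((k + j)`! <= 2 ^ (k + j) * (k`! * j`!))%N.
Proof.
have := bin_fact (leq_addl k j); rewrite addnK => <-.
rewrite [(j`! * _)%N]mulnC leq_mul2r; apply/orP; right.
by rewrite -[2%N]/(1 + 1)%N Pascal (bigD1 (inord j)) //= inordK ?ltnS ?leq_addl // !exp1n !muln1 leq_addr.
Qed.

Lemma fact_succ_le k : ((k.+1)`! <= 2 ^ k * k`!)%N.
Proof.
rewrite factS leq_mul2r; apply/orP; right.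
by elim: k => // k IH; rewrite expnS mul2n -addnn -addn1; apply: leq_add; rewrite // expn_gt0.
Qed.

(** * Lowering the growth exponent of rescaled bumps *)

Section Estimates.
Context {R : realType} {m : nat}.
Local Notation V := 'rV[R]_m.
Implicit Types (chi phi : V -> R) (a x v : V) (sg : R) (beta : seq 'I_m).

Definition derivative_bounds (r : R) (N : nat) (C A : R) (u : (V -> R) -> R) :=
  forall beta psi B, rtest r psi -> bound_CN N psi B ->
  `|u (dseq beta psi)| <= C * A ^+ size beta * (size beta)`!%:R * B.

Variables (r : R) (N : nat) (C A : R) (u : (V -> R) -> R).
Hypotheses (C0 : 0 <= C) (A0 : 0 <= A).
Hypotheses (lu : linear_on r u) (du : derivative_bounds r N C A u).

Let ub beta phi := u (dseq beta phi).

Lemma linear_on_dseq beta : linear_on r (ub beta).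
Proof.
move=> a phi psi tp tq; rewrite /ub /dseq.
have [sp _] := tp; have [sq _] := tq.
by rewrite rderives_lin // lu //; exact: rtest_derives.
Qed.

Lemma bounded_on_dseq beta : bounded_on r N (C * A ^+ size beta * (size beta)`!%:R) (ub beta).
Proof. by move=> phi B tp H; exact: du. Qed.

Lemma const_ge0 beta : 0 <= C * A ^+ size beta * (size beta)`!%:R.
Proof. by rewrite !mulr_ge0 // exprn_ge0. Qed.

Variable s0 : R.
Hypotheses (s00 : 0 < s0) (es0 : expR (- s0) < r / 2).

Lemma scale_small sg : s0 <= sg -> expR (- sg) < r / 2.
Proof. by move=> h; apply: le_lt_trans es0; rewrite ler_expR lerN2. Qed.

(** All [chi] and all [beta] at once: one step of the descent replaces [chi] by its products with
    coordinates and lengthens [beta] by one index. *)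
Definition rescaled_bound p C1 A1 := forall beta chi B a sg, rtest 1 chi -> bound_CN N chi B ->
  `|a| <= r / 2 -> s0 <= sg ->
  `|ub beta (rescale a sg chi)| <= C1 * A1 ^+ size beta * (size beta)`!%:R * expR (p * sg) * B.

Lemma rescaled_bound_start : rescaled_bound (m + N)%:R C A.
Proof.
move=> beta chi B a sg tc H ar ss.
have sg0 : 0 <= sg by apply: le_trans ss; exact: ltW.
have tr : rtest r (rescale a sg chi) by apply: rtest_rescale => //; exact/ltW/scale_small.
have [sc _] := tc.
have := du beta tr (bound_CN_rescale a sg0 sc H); rewrite mulrA; exact.
Qed.

Lemma rescale_euler_sum beta a sg chi : rtest 1 chi -> `|a| <= r / 2 -> s0 <= sg ->
  ub beta (rescale a sg (euler chi)) =
  expR (- sg) * \sum_(i < m) ub (rcons beta i) (rescale a sg (fun y : V => y 0 i * chi y)).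
Proof.
move=> tc ar ss; have [sc _] := tc.
have ti i : rtest 1 (fun y : V => y 0 i * chi y) by apply: rtest_mull => //; exact: rsmooth_coord.
have es : expR (- sg) <= r / 2 by exact/ltW/scale_small.
have tD i : rtest r (fun x => 'D_(delta_mx 0 i) (rescale a sg (fun y : V => y 0 i * chi y)) x).
  by apply: rtest_derive; exact: rtest_rescale.
have -> : rescale a sg (euler chi) = (fun x => \sum_(i < m) expR (- sg) *
    'D_(delta_mx 0 i) (rescale a sg (fun y : V => y 0 i * chi y)) x).
  apply/funext => x; rewrite (euler_divergence sc) /rescale mulr_sumr; apply: eq_bigr => i _.
  have [si _] := ti i.
  by have := rescale_derive a sg (delta_mx 0 i) si => /(congr1 (fun f => f x)).
rewrite (linear_on_sum _ (linear_on_dseq beta)); last first.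
  move=> i; have := rtest_lin (expR (- sg)) (tD i) (@rtest0 _ _ r).
  by under eq_fun do rewrite addr0.
rewrite mulr_sumr; apply: eq_bigr => i _.
by rewrite (linear_on_scale _ (linear_on_dseq beta) (tD i)) /ub dseq_rcons.
Qed.

(** The divergence form gains [expR (- sg)] at the cost of one more derivative on the functional;
    the extra factor k + 1 is at most 2^k and is absorbed by doubling [A1]. *)
Lemma rescale_derivative_bound p C1 A1 beta a sg chi B : 0 <= C1 -> 0 <= A1 ->
  rescaled_bound p C1 A1 -> rtest 1 chi -> bound_CN N chi B -> `|a| <= r / 2 -> s0 <= sg ->
  `|ub beta (rescale a sg (euler chi))| <=
   (m%:R * C1 * A1 * 2 ^+ N * (2 * A1) ^+ size beta * (size beta)`!%:R * B) * expR ((p - 1) * sg).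
Proof.
move=> C10 A10 E tc H ar ss; rewrite (rescale_euler_sum _ tc ar ss) normrM.
rewrite [`|expR _|]ger0_norm ?expR_ge0 //.
have B0 := bound_CN_ge0 H.
set k := size beta.
apply: (@le_trans _ _ (expR (- sg) * \sum_(i < m) (C1 * A1 ^+ k.+1 * (k.+1)`!%:R * expR (p * sg) * (2 ^+ N * B)))).
  rewrite ler_wpM2l ?expR_ge0 //; apply: le_trans (ler_norm_sum _ _ _) _.
  apply: ler_sum => i _.
  have ti : rtest 1 (fun y : V => y 0 i * chi y) by apply: rtest_mull => //; exact: rsmooth_coord.
  by have := E (rcons beta i) _ _ a sg ti (bound_CN_coord_mul i tc H) ar ss; rewrite size_rcons.
rewrite sumr_const card_ord -[X in expR _ * X <= _]mulr_natl mulrBl mul1r expRD.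
have F : (k.+1)`!%:R <= 2 ^+ k * k`!%:R :> R by rewrite -natrX -natrM ler_nat fact_succ_le.
have -> : expR (- sg) * (m%:R * (C1 * A1 ^+ k.+1 * (k.+1)`!%:R * expR (p * sg) * (2 ^+ N * B))) =
   (m%:R * C1 * A1 * 2 ^+ N * A1 ^+ k * B * (expR (p * sg) * expR (- sg))) * (k.+1)`!%:R.
  by rewrite exprS; ring.
have -> : m%:R * C1 * A1 * 2 ^+ N * (2 * A1) ^+ k * k`!%:R * B * (expR (p * sg) * expR (- sg)) =
   (m%:R * C1 * A1 * 2 ^+ N * A1 ^+ k * B * (expR (p * sg) * expR (- sg))) * (2 ^+ k * k`!%:R).
  by rewrite exprMn; ring.
by rewrite ler_wpM2l // !mulr_ge0 ?expR_ge0 ?exprn_ge0.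
Qed.

Lemma is_derive_ub beta a sg chi : rtest 1 chi -> `|a| <= r / 2 -> s0 <= sg ->
  is_derive sg (1 : R) (fun s => ub beta (rescale a s chi)) (ub beta (rescale a sg (euler chi))).
Proof.
move=> tc ar ss; apply: (is_derive_rescale (linear_on_dseq beta) (@bounded_on_dseq beta)) => //.
- exact: const_ge0.
- exact: scale_small.
- exact: lt_le_trans ss.
Qed.

Lemma is_derive_exp_scaled (c p t : R) :
  is_derive t (1 : R) (fun s : R => c * expR (p * s)) (c * (p * expR (p * t))).
Proof.
have dl : is_derive t (1 : R) (fun s : R => p * s) p.
  have -> : (fun s : R => p * s) = p *: (@id R) by [].
  by apply: is_derive_eq; rewrite scaler1.
have := is_deriveZ c (@is_derive1_comp R expR (fun s => p * s) t _ _ (is_derive_expR _) dl).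
by move=> H; apply: (is_derive_eq H); rewrite /GRing.scale /= [expR _ * p]mulrC.
Qed.

(** The derivative in the scale grows at most like [expR (p * sg)]. Its primitive is a multiple of
    the same exponential only for [p != 0]; for negative [p] it is bounded, hence the maximum with
    0. *)
Lemma rescaled_bound_step p C1 A1 : 0 <= C1 -> 0 <= A1 -> p != 0 -> -1 <= p ->
  rescaled_bound (p + 1) C1 A1 ->
  exists C2, 0 <= C2 /\ rescaled_bound (Num.max p 0) C2 (2 * A1).
Proof.
(* The constant below bounds the value at the initial scale [s0] by its first summand and the
   subsequent variation by its second. *)
move=> C10 A10 pn0 p1 E.
have K0 : 0 <= m%:R * C1 * A1 * 2 ^+ N by rewrite !mulr_ge0 // exprn_ge0.
exists (C1 * expR ((p + 1) * s0) + m%:R * C1 * A1 * 2 ^+ N / `|p|); split.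
  by rewrite addr_ge0 // ?mulr_ge0 ?expR_ge0 // ?divr_ge0 //; exact: ltW.
move=> beta chi B a sg tc H ar ss; have B0 := bound_CN_ge0 H.
set k := size beta; set w := expR (Num.max p 0 * sg).
have sg0 : 0 <= sg by apply: le_trans ss; exact: ltW.
have w1 : 1 <= w by rewrite -expR0 ler_expR mulr_ge0 // le_max lexx orbT.
set P := (2 * A1) ^+ k * k`!%:R * B.
have P0 : 0 <= P by rewrite !mulr_ge0 // exprn_ge0 // mulr_ge0.
pose M := m%:R * C1 * A1 * 2 ^+ N * P.
have M0 : 0 <= M by rewrite mulr_ge0.
have D t : s0 <= t <= sg -> `|ub beta (rescale a t (euler chi))| <= M / p * (p * expR (p * t)).
  move=> /andP[st _]; have := rescale_derivative_bound beta C10 A10 E tc H ar st.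
  rewrite addrK mulrA divfK // /M /P.
  by move=> /le_trans; apply; rewrite -/k le_eqVlt; apply/orP; left; apply/eqP; ring.
have := @le_of_derivative_le R (fun s => ub beta (rescale a s chi))
  (fun s => ub beta (rescale a s (euler chi))) (fun s => M / p * expR (p * s))
  (fun s => M / p * (p * expR (p * s))) s0 sg ss.
move=> /(_ (fun t tb => is_derive_ub beta tc ar (proj1 (andP tb)))).
move=> /(_ (fun t _ => is_derive_exp_scaled _ _ _) D) L.
have Q0 := E beta chi B a s0 tc H ar (lexx _).
have L2 : M / p * expR (p * sg) - M / p * expR (p * s0) <= M / `|p| * w.
  rewrite -mulrBr /w; have [p0|] := boolP (0 < p); last rewrite -leNgt => p0.
    rewrite gtr0_norm // max_l; last exact: ltW.
    by apply: ler_wpM2l; [apply: divr_ge0 => //; exact: ltW|rewrite gerBl expR_ge0].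
  have {}p0 : p < 0 by rewrite lt_neqAle pn0.
  rewrite ltr0_norm // max_r; last exact: ltW.
  rewrite mul0r expR0 mulr1.
  have -> : M / p * (expR (p * sg) - expR (p * s0)) = M / - p * (expR (p * s0) - expR (p * sg)).
    by rewrite invrN mulrN mulNr -mulrN opprB.
  apply: ler_piMr; first by apply: divr_ge0 => //; rewrite oppr_ge0 ltW.
  apply: (@le_trans _ _ (expR (p * s0))); first by rewrite gerBl expR_ge0.
  by rewrite -expR0 ler_expR nmulr_rle0 // ltW.
have Q1 : `|ub beta (rescale a s0 chi)| <= C1 * expR ((p + 1) * s0) * P.
  apply: le_trans Q0 _; rewrite -/k.
  have -> : C1 * A1 ^+ k * k`!%:R * expR ((p + 1) * s0) * B =
    C1 * expR ((p + 1) * s0) * (A1 ^+ k * k`!%:R * B) by ring.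
  rewrite ler_wpM2l ?mulr_ge0 ?expR_ge0 // /P ler_wpM2r // ler_wpM2r //.
  by rewrite exprMn ler_peMl ?exprn_ge0 // exprn_ege1 // ler1n.
have -> : (C1 * expR ((p + 1) * s0) + m%:R * C1 * A1 * 2 ^+ N / `|p|) * (2 * A1) ^+ k * k`!%:R * w * B
   = C1 * expR ((p + 1) * s0) * P * w + M / `|p| * w by rewrite /M /P; ring.
rewrite -[ub beta _](subrK (ub beta (rescale a s0 chi))).
apply: le_trans (ler_normD _ _) _; rewrite addrC; apply: lerD; last exact: le_trans L L2.
apply: le_trans Q1 _; apply: ler_peMr => //.
by apply: mulr_ge0 => //; apply: mulr_ge0 => //; exact: expR_ge0.
Qed.

(** Half-integral exponents never meet the excluded value 0: the descent goes from 1/2 to -1/2,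
    where the bound becomes uniform in the scale. *)
Lemma rescaled_bound_descent j C1 A1 : 0 <= C1 -> 0 <= A1 -> rescaled_bound (j%:R + 2^-1) C1 A1 ->
  exists C2 A2, [/\ 0 <= C2, 0 <= A2 & rescaled_bound 0 C2 A2].
Proof.
elim: j C1 A1 => [|j IH] C1 A1 C10 A10 E.
  have n0 : - 2^-1 != 0 :> R by rewrite oppr_eq0 gt_eqF.
  have [||C2 [C20 E2]] := rescaled_bound_step C10 A10 n0; first lra.
    by have -> : - 2^-1 + 1 = 0%:R + 2^-1 :> R by lra.
  exists C2, (2 * A1); split => //; first by rewrite mulr_ge0.
  by move: E2; rewrite max_r // oppr_le0 ltW.
have p0 : 0 < j%:R + 2^-1 :> R by rewrite ltr_wpDl.
have n0 : j%:R + 2^-1 != 0 :> R by rewrite gt_eqF.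
have [||C2 [C20 E2]] := rescaled_bound_step C10 A10 n0; first lra.
  by move: E; rewrite -addn1 natrD addrAC.
apply: (IH C2 (2 * A1)) => //; first by rewrite mulr_ge0.
by move: E2; rewrite max_l // ltW.
Qed.

(** The initial exponent m + N is weakened to m + N + 1/2 so that the descent through half-integers
    can start. *)
Lemma rescaled_bound_uniform : exists C2 A2, [/\ 0 <= C2, 0 <= A2 & rescaled_bound 0 C2 A2].
Proof.
apply: (@rescaled_bound_descent (m + N) C A) => // beta chi B a sg tc H ar ss.
apply: le_trans (rescaled_bound_start beta tc H ar ss) _.
rewrite ler_wpM2r ?(bound_CN_ge0 H) // ler_wpM2l ?const_ge0 // ler_expR ler_wpM2r ?lerDl //.
by apply: le_trans ss; exact: ltW.
Qed.

End Estimates.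

(** * Existence of point values *)

Section PointValues.
Context {R : realType} {m : nat}.
Local Notation V := 'rV[R]_m.

(* [g beta a] is the value at [a] of the derivative of order [beta] of [u], up to sign. *)
Lemma point_values (r : R) (N : nat) (C A : R) (u : (V -> R) -> R) (b : V -> R) :
  0 < r -> 0 <= C -> 0 <= A -> linear_on r u -> derivative_bounds r N C A u -> rtest 1 b ->
  exists (s0 C' A' : R) (g : seq 'I_m -> V -> R),
  [/\ [/\ 0 < s0, expR (- s0) < r / 2, 0 <= C' & 1 <= A'],
     forall beta a sg, `|a| <= r / 2 -> s0 <= sg ->
       `|u (dseq beta (rescale a sg b))| <= C' * A' ^+ size beta * (size beta)`!%:R,
     forall beta a sg, `|a| <= r / 2 -> s0 <= sg ->
       `|u (dseq beta (rescale a sg b)) - g beta a| <=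
         C' * A' ^+ size beta * (size beta)`!%:R * expR (- sg) &
     forall chi B a sg, rtest 1 chi -> bound_CN N chi B -> `|a| <= r / 2 -> s0 <= sg ->
       `|u (rescale a sg chi)| <= C' * B].
Proof.
move=> r0 C0 A0 lu du tb.
(* Ensures [expR (- s0) < r / 2]: bumps of scale at least [s0] centred in the ball of radius [r / 2]
   are supported in the ball of radius [r]. *)
pose s0 : R := Num.max 1 (1 - ln (r / 2)).
have s00 : 0 < s0 by rewrite lt_max ltr01.
have r2 : 0 < r / 2 by rewrite divr_gt0.
have es0 : expR (- s0) < r / 2.
  rewrite -[ltRHS](@lnK R) ?posrE // ltr_expR ltrNl lt_max; apply/orP; right.
  by lra.
have [C2 [A2 [C20 A20 E]]] := rescaled_bound_uniform C0 A0 lu du s00 es0.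
have [B HB] := rtest_bound_rV N tb; have B0 := bound_CN_ge0 HB.
pose K := m%:R * C2 * A2 * 2 ^+ N * B.
have K0 : 0 <= K by rewrite !mulr_ge0 // exprn_ge0.
pose M (beta : seq 'I_m) := K * (2 * A2) ^+ size beta * (size beta)`!%:R.
have M0 beta : 0 <= M beta by rewrite !mulr_ge0 // exprn_ge0 // mulr_ge0.
(* Once the exponent is 0, the derivative in the scale is O([expR (- t)]) and the family is Cauchy
   with that rate. *)
have D beta a s t : `|a| <= r / 2 -> s0 <= s -> s <= t ->
    `|u (dseq beta (rescale a t b)) - u (dseq beta (rescale a s b))| <= M beta * expR (- s).
  move=> ar ss st.
  have := @le_of_derivative_le R (fun s => u (dseq beta (rescale a s b)))
    (fun s => u (dseq beta (rescale a s (euler b)))) (fun s => - M beta * expR (-1 * s))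
    (fun s => - M beta * (-1 * expR (-1 * s))) s t st.
  move=> /(_ (fun t tb' => is_derive_ub C0 A0 lu du s00 es0 beta tb ar (le_trans ss (proj1 (andP tb'))))).
  move=> /(_ (fun t _ => is_derive_exp_scaled _ _ _)) L.
  apply: le_trans (L _) _.
    move=> z /andP[sz _].
    have := rescale_derivative_bound lu es0 beta C20 A20 E tb HB ar (le_trans ss sz).
    move=> /le_trans; apply.
    have -> : - M beta * (-1 * expR (-1 * z)) = M beta * expR ((0 - 1) * z) by rewrite sub0r; ring.
    by rewrite ler_wpM2r ?expR_ge0 // /M /K le_eqVlt; apply/orP; left; apply/eqP; ring.
  by rewrite !mulN1r; have := mulr_ge0 (M0 beta) (expR_ge0 (- t)); lra.
have ex (p : seq 'I_m * V) : exists l, `|p.2| <= r / 2 -> forall s, s0 <= s ->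
    `|u (dseq p.1 (rescale p.2 s b)) - l| <= M p.1 * expR (- s).
  (* Centres outside the ball receive the default value 0, since [choice] needs a total relation. *)
  case: (leP `|p.2| (r / 2)) => ar; last by exists 0.
  have [l Hl] := @exp_cauchy_limit R (fun s => u (dseq p.1 (rescale p.2 s b))) (M p.1) s0 (M0 _)
    (fun s t => D p.1 p.2 s t ar).
  by exists l.
have [g Hg] := choice ex.
pose C' := C2 * (B + 1) + K; pose A' := 2 * A2 + 1.
have C'0 : 0 <= C' by rewrite addr_ge0 // mulr_ge0 // addr_ge0.
exists s0, C', A', (fun beta a => g (beta, a)); split => //.
- by split=> //; rewrite /A'; lra.
- move=> beta a sg ar ss; apply: le_trans (E beta b B a sg tb HB ar ss) _.
  rewrite mul0r expR0 mulr1 mulrAC ler_wpM2r //.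
  rewrite mulrAC ler_pM ?mulr_ge0 ?exprn_ge0 //.
    by rewrite /C'; nra.
  by rewrite lerXn2r ?nnegrE // /A'; lra.
- move=> beta a sg ar ss; apply: le_trans (Hg (beta, a) ar sg ss) _.
  rewrite ler_wpM2r ?expR_ge0 // ler_wpM2r //= ler_pM ?exprn_ge0 ?mulr_ge0 //.
    by rewrite /C' lerDr mulr_ge0 // addr_ge0.
  by rewrite lerXn2r ?nnegrE /A' ?addr_ge0 ?mulr_ge0 // lerDl.
- move=> chi B' a sg tc H ar ss; apply: le_trans (E [::] chi B' a sg tc H ar ss) _.
  rewrite mul0r expR0 !mulr1 ler_wpM2r ?(bound_CN_ge0 H) //.
  by rewrite /C'; nra.
Qed.

End PointValues.

(** * Power series expansion of the point values *)

Section Taylor.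
Context {R : realType}.

Lemma is_derive_taylor_poly (c : nat -> R) K (t : R) :
  is_derive t (1 : R) (fun t => \sum_(j < K.+1) c j * t ^+ j / j`!%:R)
    (\sum_(j < K) c j.+1 * t ^+ j / j`!%:R).
Proof.
elim: K => [|K IH].
  have -> : (fun t => \sum_(j < 1) c j * t ^+ j / j`!%:R) = cst (c 0%N / 1).
    by apply/funext => s; rewrite big_ord1 expr0 mulr1.
  by rewrite big_ord0; exact: is_derive_cst.
have -> : (fun t => \sum_(j < K.+2) c j * t ^+ j / j`!%:R) =
  (fun t => \sum_(j < K.+1) c j * t ^+ j / j`!%:R) + ((c K.+1 / (K.+1)`!%:R) *: (@id R ^+ K.+1)).
  by apply/funext => s; rewrite big_ord_recr fctE /= exprfctE /GRing.scale /= mulrAC.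
rewrite big_ord_recr /=; apply: is_deriveD.
have H := is_deriveZ (c K.+1 / (K.+1)`!%:R) (@is_deriveX R R id K.+1 t 1 1 (is_derive_id _ _)).
apply: (is_derive_eq H); rewrite /GRing.scale /= mulr1 factS natrM.
have f0 : K`!%:R != 0 :> R by rewrite pnatr_eq0 -lt0n fact_gt0.
have k0 : K.+1%:R != 0 :> R by rewrite pnatr_eq0.
by field; rewrite f0 addrC -natr1 in k0 *; rewrite k0.
Qed.

(** Induction on the order: the derivative of a Taylor remainder is the remainder of [q 1] of one
    order less, so [le_of_derivative_le] integrates the bound. *)
Lemma taylor_bound_pos (q : nat -> R -> R) K (y M : R) : 0 <= y ->
  (forall j t, (j < K)%N -> 0 <= t <= y -> is_derive t (1 : R) (q j) (q j.+1 t)) ->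
  (forall t, 0 <= t <= y -> `|q K t| <= M) ->
  `|q 0%N y - \sum_(j < K) q j 0 * y ^+ j / j`!%:R| <= M * y ^+ K / K`!%:R.
Proof.
elim: K q y => [|K IH] q y y0 dq bq.
  by rewrite big_ord0 subr0 expr0 mulr1 divr1; apply: bq; rewrite y0 lexx.
pose r t := q 0%N t - \sum_(j < K.+1) q j 0 * t ^+ j / j`!%:R.
(* The majorant M t^(K+1) / (K+1)! is written as a Taylor polynomial with a single coefficient, so
   that [is_derive_taylor_poly] differentiates it too. *)
pose g t := \sum_(j < K.+2) (if j == K.+1 :> nat then M else 0) * t ^+ j / j`!%:R.
have gE t : g t = M * t ^+ K.+1 / (K.+1)`!%:R.
  rewrite /g big_ord_recr /= eqxx big1 ?add0r // => j _.
  by rewrite ltn_eqF // ?mul0r // ltn_ord.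
have := @le_of_derivative_le R r (fun t => q 1%N t - \sum_(j < K) q j.+1 0 * t ^+ j / j`!%:R)
  g (fun t => \sum_(j < K.+1) (if j.+1 == K.+1 :> nat then M else 0) * t ^+ j / j`!%:R) 0 y y0.
have -> : r 0 = 0.
  rewrite /r big_ord_recl /= expr0 mulr1 divr1 big1 ?addr0 ?subrr // => j _.
  by rewrite /= exprS mul0r mulr0 mul0r.
have -> : g 0 = 0 by rewrite gE exprS mul0r mulr0 mul0r.
rewrite !subr0 gE; apply => t /andP[t0 ty].
- apply: is_deriveB; first by apply: dq => //; rewrite t0.
  exact: (is_derive_taylor_poly (fun j => q j 0)).
- exact: (is_derive_taylor_poly (fun j => if j == K.+1 then M else 0)).
- rewrite big_ord_recr /= eqxx [X in _ <= X + _]big1 ?add0r; last first.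
    by move=> j _; rewrite ifF ?mul0r //; apply: ltn_eqF; exact: ltn_ord.
  apply: (IH (fun j => q j.+1)) => // [j s jK /andP[s0 st]|s /andP[s0 st]].
    by apply: dq => //; rewrite s0 (le_trans st).
  by apply: bq; rewrite s0 (le_trans st).
Qed.

Lemma taylor_bound (q : nat -> R -> R) K (y M : R) :
  (forall j t, (j < K)%N -> Num.min 0 y <= t <= Num.max 0 y ->
     is_derive t (1 : R) (q j) (q j.+1 t)) ->
  (forall t, Num.min 0 y <= t <= Num.max 0 y -> `|q K t| <= M) ->
  `|q 0%N y - \sum_(j < K) q j 0 * y ^+ j / j`!%:R| <= M * `|y| ^+ K / K`!%:R.
Proof.
have [y0|] := boolP (0 <= y).
  by rewrite (min_idPl y0) (max_idPr y0) (ger0_norm y0) => dq bq; exact: taylor_bound_pos.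
rewrite -ltNge => /ltW y0; rewrite (min_idPr y0) (max_idPl y0) => dq bq.
have ny : 0 <= - y by rewrite oppr_ge0.
have rg t : 0 <= t <= - y -> y <= - t <= 0 by move=> /andP[? ?]; apply/andP; split; lra.
rewrite (ler0_norm y0).
have := @taylor_bound_pos (fun j t => (-1) ^+ j * q j (- t)) K (- y) M ny.
rewrite expr0 mul1r opprK.
have -> : \sum_(j < K) (-1) ^+ j * q j (- 0) * (- y) ^+ j / j`!%:R =
   \sum_(j < K) q j 0 * y ^+ j / j`!%:R.
  apply: eq_bigr => j _; rewrite oppr0; congr (_ / _).
  by rewrite [(-1) ^+ j * _]mulrC -mulrA -exprMn mulN1r opprK.
apply => [j t jK /rg ty|t /rg ty]; last first.
  by rewrite normrM normrX normrN1 expr1n mul1r; exact: bq.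
have dN : is_derive t (1 : R) (fun t : R => - t) (-1).
  have -> : (fun t : R => - t) = - (@id R) by [].
  exact: is_deriveN.
have H := @is_derive1_comp R (q j) (fun t => - t) t _ _ (dq j _ jK ty) dN.
apply: (is_derive_eq (is_deriveZ ((-1) ^+ j) H)).
by rewrite /GRing.scale /= exprS; ring.
Qed.

Lemma le_of_exp_error (X Y D s0 : R) : 0 <= D ->
  (forall s, s0 <= s -> X <= Y + D * expR (- s)) -> X <= Y.
Proof.
move=> D0 H; apply/ler_addgt0Pr => e e0.
have d0 : 0 < e / (D + 1) by rewrite divr_gt0 // ltr_wpDl.
pose s := Num.max s0 (- ln (e / (D + 1))).
apply: le_trans (H s _) _; first by rewrite le_max lexx.
rewrite lerD2l.
have : expR (- s) <= e / (D + 1).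
  by rewrite -[leRHS](@lnK R) ?posrE // ler_expR lerNl le_max lexx orbT.
rewrite ler_pdivlMr ?ltr_wpDl // => le.
by have := expR_ge0 (- s); nra.
Qed.

Lemma geometric_le2 (x : R) N : 0 <= x -> x <= 2^-1 -> \sum_(j < N) x ^+ j <= 2.
Proof.
move=> x0 x2; have x1 : 0 < 1 - x by lra.
have := subrX1 x N => /(congr1 -%R); rewrite -mulNr !opprB => E.
have : (1 - x) * \sum_(j < N) x ^+ j <= 1 by rewrite -E gerBl exprn_ge0.
have : 0 <= \sum_(j < N) x ^+ j by apply: sumr_ge0 => j _; rewrite exprn_ge0.
by nra.
Qed.

End Taylor.

Section PowerSeries.
Context {R : realType} {m : nat}.
Local Notation V := 'rV[R]_m.
Implicit Types (a y p : V) (l : seq 'I_m) (beta : seq 'I_m).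

(* [G beta] plays the role of the derivative of [G [::]] in the directions [beta]. *)
Definition taylor_family (r1 C A : R) (G : seq 'I_m -> V -> R) :=
  forall N beta i p (t : R), `|p| <= r1 -> `|p + t *: delta_mx 0 i| <= r1 ->
  `|G beta (p + t *: delta_mx 0 i) -
     \sum_(j < N) G (beta ++ nseq j i) p * t ^+ j / j`!%:R| <=
  C * A ^+ size beta * (size beta)`!%:R * (A * `|t|) ^+ N.

(** Taylor expansion with [N] terms in each coordinate of [l], one coordinate after another. Nested
    one-variable expansions give exactly the partial sums over boxes of exponents. *)
Fixpoint box_expansion N (G : seq 'I_m -> V -> R) y l beta p : R :=
  match l with
  | [::] => G beta p
  | i :: l' => \sum_(j < N) y 0 i ^+ j / j`!%:R * box_expansion N G y l' (beta ++ nseq j i) p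
  end.

Definition restrict_coords l y : V := \row_j (if j \in l then y 0 j else 0).

Lemma restrict_coords_norm l y : `|restrict_coords l y| <= `|y|.
Proof.
apply: rV_norm_le => // j; rewrite mxE; case: ifP => _; first exact: coord_le_norm.
by rewrite normr0.
Qed.

Lemma restrict_coords_cons i l y : i \notin l ->
  restrict_coords (i :: l) y = restrict_coords l y + y 0 i *: delta_mx 0 i.
Proof.
move=> il; apply/rowP => j; rewrite !mxE inE eqxx /=; have [->|ji] := eqVneq j i.
  by rewrite (negbTE il) mulr1 add0r.
by rewrite mulr0 addr0.
Qed.

(** Adding a coordinate sums the previous errors against a geometric series of sum at most 2 and
    adds one new remainder, so 2^l - 1 becomes 2 (2^l - 1) + 1. It also doubles the base, through (k
    + j)! <= 2^(k + j) k! j!. *)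
Lemma box_expansion_error r1 C A G N a y l beta : 0 <= C -> 0 <= A ->
  taylor_family r1 C A G -> `|a| + `|y| <= r1 -> 2 ^+ m * A * `|y| <= 2^-1 * 2^-1 -> uniq l ->
  `|box_expansion N G y l beta a - G beta (a + restrict_coords l y)| <=
   (2 ^+ size l - 1) * C * (2 ^+ size l * A) ^+ size beta * (size beta)`!%:R * 2^-1 ^+ N.
Proof.
move=> C0 A0 TG ay yA ul.
have sl : (size l <= m)%N by rewrite -[X in (_ <= X)%N]card_ord -(card_uniqP ul) max_card.
elim: l beta ul sl => [|i l IH] beta /=.
  move=> _ _; rewrite expr0 subrr !mul0r.
  have -> : restrict_coords [::] y = 0 by apply/rowP => j; rewrite !mxE.
  by rewrite addr0 subrr normr0.
move=> /andP[il ul] sl; set k := size beta.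
set p := a + restrict_coords l y; set As := 2 ^+ size l * A.
have As0 : 0 <= As by rewrite mulr_ge0 // exprn_ge0.
have AsA : A <= As by rewrite ler_peMl // exprn_ege1 // ler1n.
have Asy : 2 * As * `|y| <= 2^-1.
  have : 2 ^+ size l * A * `|y| <= 2 ^+ m * A * `|y|.
    by rewrite ler_wpM2r // ler_wpM2r // ler_weXn2l ?ler1n // ltnW.
  by rewrite -/As; lra.
have pr : `|p| <= r1.
  by apply: le_trans (ler_normD _ _) _; apply: le_trans ay; rewrite lerD2l restrict_coords_norm.
have pyr : `|p + y 0 i *: delta_mx 0 i| <= r1.
  rewrite /p -addrA -restrict_coords_cons //; apply: le_trans (ler_normD _ _) _.
  by apply: le_trans ay; rewrite lerD2l restrict_coords_norm.
have -> : a + restrict_coords (i :: l) y = p + y 0 i *: delta_mx 0 i.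
  by rewrite restrict_coords_cons // addrA.
have T := TG N beta i p (y 0 i) pr pyr.
set D := 2^-1 ^+ N; have D0 : 0 <= D by rewrite exprn_ge0 // invr_ge0.
have cl0 : 0 <= 2 ^+ size l - 1 :> R by rewrite subr_ge0 exprn_ege1 // ler1n.
set S := \sum_(j < N) G (beta ++ nseq j i) p * y 0 i ^+ j / j`!%:R in T.
have e1 : `|\sum_(j < N) y 0 i ^+ j / j`!%:R * box_expansion N G y l (beta ++ nseq j i) a - S| <=
   2 * ((2 ^+ size l - 1) * C * (2 * As) ^+ k * k`!%:R * D).
  rewrite -sumrB; apply: le_trans (ler_norm_sum _ _ _) _.
  apply: (@le_trans _ _ (\sum_(j < N) ((2 ^+ size l - 1) * C * (2 * As) ^+ k * k`!%:R * D) * (2 * As * `|y|) ^+ j)).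
    apply: ler_sum => j _.
    have -> : y 0 i ^+ j / j`!%:R * box_expansion N G y l (beta ++ nseq j i) a -
       G (beta ++ nseq j i) p * y 0 i ^+ j / j`!%:R =
       y 0 i ^+ j / j`!%:R * (box_expansion N G y l (beta ++ nseq j i) a - G (beta ++ nseq j i) p).
      by ring.
    rewrite normrM normf_div normrX [`|j`!%:R|]gtr0_norm //.
    have := IH (beta ++ nseq j i) ul (ltnW sl); rewrite size_cat size_nseq -/k -/p => H.
    have yj : `|y 0 i| ^+ j <= `|y| ^+ j by rewrite lerXn2r ?nnegrE // coord_le_norm.
    have ij : 0 <= (j`!%:R : R)^-1 by rewrite invr_ge0 ltW.
    have w1 : 0 <= `|y 0 i| ^+ j / j`!%:R by rewrite mulr_ge0 // exprn_ge0.
    apply: le_trans (ler_pM w1 (normr_ge0 _) (ler_wpM2r ij yj) H) _.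
    have F : (k + j)`!%:R <= 2 ^+ (k + j) * (k`!%:R * j`!%:R) :> R.
      by rewrite -natrX -!natrM ler_nat fact_double.
    rewrite mulrAC ler_pdivrMr //.
    have -> : `|y| ^+ j * ((2 ^+ size l - 1) * C * As ^+ (k + j) * (k + j)`!%:R * D) =
      (`|y| ^+ j * ((2 ^+ size l - 1) * C * As ^+ (k + j) * D)) * (k + j)`!%:R by ring.
    apply: le_trans (ler_wpM2l _ F) _.
      by rewrite !mulr_ge0 ?exprn_ge0.
    by rewrite !exprMn !exprD le_eqVlt; apply/orP; left; apply/eqP; ring.
  rewrite -mulr_sumr mulrC ler_wpM2r //; last by apply: geometric_le2; rewrite ?mulr_ge0.
  by rewrite !mulr_ge0 ?exprn_ge0 ?mulr_ge0.
have e2 : C * A ^+ k * k`!%:R * (A * `|y 0 i|) ^+ N <= C * (2 * As) ^+ k * k`!%:R * D.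
  apply: ler_pM.
  - by rewrite !mulr_ge0 ?exprn_ge0.
  - by rewrite exprn_ge0 // mulr_ge0.
  - by rewrite ler_wpM2r // ler_wpM2l // lerXn2r ?nnegrE ?mulr_ge0 //; lra.
  rewrite lerXn2r ?nnegrE ?mulr_ge0 ?invr_ge0 //; have := coord_le_norm y i => yi.
  have : A * `|y 0 i| <= As * `|y| by apply: ler_pM.
  by have := mulr_ge0 As0 (normr_ge0 y); lra.
have -> : 2 ^+ (size l).+1 * A = 2 * As by rewrite exprS mulrA.
set Z := \sum_(j < N) _ in e1 *.
have -> : Z - G beta (p + y 0 i *: delta_mx 0 i) = (Z - S) - (G beta (p + y 0 i *: delta_mx 0 i) - S).
  by rewrite opprB addrA subrK.
apply: le_trans (ler_normB _ _) _; apply: le_trans (lerD e1 (le_trans T e2)) _.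
by rewrite exprS le_eqVlt; apply/orP; left; apply/eqP; ring.
Qed.

Definition multi_list (alpha : 'I_m -> nat) l : seq 'I_m := flatten [seq nseq (alpha i) i | i <- l].

Lemma eq_multi_list alpha alpha' l : {in l, alpha =1 alpha'} -> multi_list alpha l = multi_list alpha' l.
Proof. by move=> e; congr flatten; apply/eq_in_map => i il; rewrite e. Qed.

Definition update_index N (i : 'I_m) (j : 'I_N) (f : {ffun 'I_m -> 'I_N}) : {ffun 'I_m -> 'I_N} :=
  [ffun k => if k == i then j else f k].

(** The nested sums run over the exponents that are 0 outside [l]; the exponent 0 must belong to the
    box, whence [N.+1]. *)
Lemma box_expansion_sum N (G : seq 'I_m -> V -> R) y l beta p : uniq l ->
  box_expansion N.+1 G y l beta p =
  \sum_(f : {ffun 'I_m -> 'I_N.+1} | [forall i, (i \in l) || (f i == ord0)])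
    (\prod_(i <- l) (y 0 i ^+ f i / (f i)`!%:R)) * G (beta ++ multi_list (fun i => f i) l) p.
Proof.
elim: l beta => [|i l IH] beta /=.
  move=> _; rewrite (big_pred1 [ffun=> ord0]) ?big_nil ?mul1r ?cats0 // => f.
  apply/forallP/eqP => [H|-> i]; last by rewrite ffunE.
  by apply/ffunP => i; rewrite ffunE; exact/eqP/H.
move=> /andP[il ul].
rewrite (partition_big (fun f : {ffun 'I_m -> 'I_N.+1} => f i) xpredT) //=.
apply: eq_bigr => j _; rewrite (IH _ ul) mulr_sumr.
(* Exponents equal to [j] at [i] correspond to exponents equal to 0 at [i]; as [i] is not in [l],
   the latter are those of the induction hypothesis. *)
rewrite [RHS](reindex_onto (update_index i j) (update_index i ord0)) /=; last first.
  move=> f /andP[_ /eqP fj]; apply/ffunP => k; rewrite !ffunE.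
  by case: eqVneq => // ->.
apply: eq_big => [f|f Hf].
  apply/idP/idP => [/forallP H|].
    apply/andP; split; first (apply/andP; split).
    - apply/forallP => k; rewrite inE ffunE; have [//|ki] := eqVneq k i.
      by have := H k.
    - by rewrite ffunE eqxx.
    - apply/eqP/ffunP => k; rewrite !ffunE; case: eqVneq => [->|//].
      by have := H i; rewrite (negbTE il) /= => /eqP.
  move=> /andP[/andP[/forallP H _] /eqP E]; apply/forallP => k.
  have := H k; rewrite inE ffunE; have [ki _|//] := eqVneq k i.
  by apply/orP; right; rewrite -E ki !ffunE eqxx.
have E k : k \in l -> update_index i j f k = f k.
  by move=> kl; rewrite ffunE; case: eqVneq kl il => // -> ->.
rewrite big_cons ffunE eqxx -[in RHS]mulrA; congr (_ * _).
rewrite [in RHS](eq_big_seq (fun k => y 0 k ^+ f k / (f k)`!%:R)); last by move=> k kl; rewrite E.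
congr (_ * G _ p); rewrite /multi_list /= -catA; congr (_ ++ (_ ++ _)).
  by rewrite ffunE eqxx.
by apply: eq_multi_list => k kl; rewrite E.
Qed.

Definition taylor_coef (G : seq 'I_m -> V -> R) a (alpha : 'I_m -> nat) : R :=
  G (multi_list alpha (enum 'I_m)) a / \prod_(i < m) (alpha i)`!%:R.

Lemma box_expansion_full N G y a :
  box_expansion N.+1 G y (enum 'I_m) [::] a =
  \sum_(f : {ffun 'I_m -> 'I_N.+1}) taylor_coef G a (fun i => f i) * \prod_(i < m) y 0 i ^+ f i.
Proof.
rewrite box_expansion_sum ?enum_uniq //; apply: eq_big => [f|f _].
  by apply/forallP => i; rewrite mem_enum.
rewrite /taylor_coef big_enum /= big_split /= prodfV.
by rewrite [LHS]mulrC -[RHS]mulrA; congr (_ * _); exact: mulrC.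
Qed.

Lemma multi_list_size alpha l : size (multi_list alpha l) = (\sum_(i <- l) alpha i)%N.
Proof. by elim: l => [|i l IH]; rewrite ?big_nil // big_cons /multi_list /= size_cat size_nseq IH. Qed.

(** A crude bound on a multinomial coefficient, geometric in the total degree, by iterating the
    binomial one. *)
Lemma fact_sum_le (alpha : 'I_m -> nat) l :
  ((\sum_(i <- l) alpha i)`! <= 2 ^ (size l * \sum_(i <- l) alpha i) * \prod_(i <- l) (alpha i)`!)%N.
Proof.
elim: l => [|i l IH]; first by rewrite !big_nil.
rewrite !big_cons; apply: leq_trans (fact_double _ _) _.
set s := (\sum_(j <- l) _)%N in IH *.
set q := (alpha i + s)%N; rewrite /= mulSn expnD -mulnA leq_mul2l; apply/orP; right.
rewrite [X in (_ <= X)%N]mulnCA leq_mul2l; apply/orP; right.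
apply: leq_trans IH _; rewrite leq_mul2r; apply/orP; right.
by rewrite leq_exp2l // leq_mul2l /q leq_addl orbT.
Qed.

Variables (r1 C A : R) (G : seq 'I_m -> V -> R).
Hypotheses (C0 : 0 <= C) (A0 : 0 <= A) (TG : taylor_family r1 C A G).
Hypothesis bG : forall beta p, `|p| <= r1 -> `|G beta p| <= C * A ^+ size beta * (size beta)`!%:R.

Lemma taylor_coef_bound a (alpha : 'I_m -> nat) : `|a| <= r1 ->
  `|taylor_coef G a alpha| <= C * \prod_(i < m) (2 ^+ m * A) ^+ alpha i.
Proof.
move=> ar; rewrite /taylor_coef normrM normfV.
set P := \prod_(i < m) (alpha i)`!%:R.
have P0 : 0 < P by apply: prodr_gt0 => i _; rewrite ltr0n fact_gt0.
rewrite (gtr0_norm P0) ler_pdivrMr //.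
apply: le_trans (bG _ ar) _; rewrite multi_list_size -mulrA -[leRHS]mulrA ler_wpM2l //.
rewrite big_enum /=; set s := (\sum_(i < m) alpha i)%N.
have F : s`!%:R <= 2 ^+ (m * s) * P.
  have := fact_sum_le alpha (enum 'I_m); rewrite !big_enum -cardE card_ord -/s => F.
  by rewrite /P -natr_prod -natrX -natrM ler_nat.
have -> : \prod_(i < m) (2 ^+ m * A) ^+ alpha i = 2 ^+ (m * s) * A ^+ s.
  by rewrite prodrXr exprMn exprM.
by rewrite [leRHS]mulrAC [leRHS]mulrC ler_wpM2l ?exprn_ge0.
Qed.

(** The coefficient bound dominates the sum by a product of [m] geometric series, each of sum at
    most 2. *)
Lemma power_series_abs a y N : `|a| <= r1 -> 2 ^+ m * A * `|y| <= 2^-1 ->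
  \sum_(f : {ffun 'I_m -> 'I_N}) `|taylor_coef G a (fun i => f i) * \prod_(i < m) y 0 i ^+ f i|
  <= C * 2 ^+ m.
Proof.
move=> ar yA; set th := 2 ^+ m * A * `|y| in yA.
have th0 : 0 <= th by rewrite !mulr_ge0 // exprn_ge0.
apply: (@le_trans _ _ (C * \sum_(f : {ffun 'I_m -> 'I_N}) \prod_(i < m) th ^+ f i)).
  rewrite mulr_sumr; apply: ler_sum => f _; rewrite normrM.
  apply: (@le_trans _ _ (C * (\prod_(i < m) (2 ^+ m * A) ^+ f i) * \prod_(i < m) `|y| ^+ f i)).
    apply: ler_pM => //; first exact: taylor_coef_bound.
    rewrite normr_prod; apply: ler_prod => i _; rewrite normr_ge0 /= normrX lerXn2r ?nnegrE //.
    exact: coord_le_norm.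
  rewrite -mulrA ler_wpM2l // -big_split /= le_eqVlt; apply/orP; left; apply/eqP.
  by apply: eq_bigr => i _; rewrite -exprMn.
rewrite ler_wpM2l // -(bigA_distr_bigA (fun (_ : 'I_m) (j : 'I_N) => th ^+ j)) /=.
rewrite -[X in 2 ^+ X](card_ord m) -prodr_const; apply: ler_prod => i _.
by rewrite geometric_le2 // sumr_ge0 // => j _; rewrite exprn_ge0.
Qed.

Lemma power_series_error a y N : `|a| + `|y| <= r1 -> 2 ^+ m * A * `|y| <= 2^-1 * 2^-1 ->
  `|\sum_(f : {ffun 'I_m -> 'I_N.+1}) taylor_coef G a (fun i => f i) * \prod_(i < m) y 0 i ^+ f i
    - G [::] (a + y)| <= 2 ^+ m * C * 2^-1 ^+ N.
Proof.
move=> ay yA; rewrite -box_expansion_full.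
have := box_expansion_error N.+1 [::] C0 A0 TG ay yA (enum_uniq 'I_m).
have -> : restrict_coords (enum 'I_m) y = y.
  by apply/rowP => j; rewrite mxE mem_enum.
rewrite expr0 !mulr1 -cardE card_ord => /le_trans; apply.
rewrite exprS mulrCA.
have h : 0 <= (2 : R)^-1 ^+ N by rewrite exprn_ge0 // invr_ge0.
have := exprn_ge0 m (ler0n R 2); have := mulr_ge0 C0 h.
set w := 2 ^+ m; set z := 2^-1 ^+ N in h * => H w0.
by have := mulr_ge0 w0 H; lra.
Qed.

End PowerSeries.

(** * Taylor estimates for the point values *)

Section TaylorOfPointValues.
Context {R : realType} {m : nat}.
Local Notation V := 'rV[R]_m.

Lemma segment_norm (p v : V) (r s t : R) : Num.min 0 t <= s <= Num.max 0 t ->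
  `|p| <= r -> `|p + t *: v| <= r -> `|p + s *: v| <= r.
Proof.
move=> st pr ptr.
have [t0|t0] := eqVneq t 0.
  by move: st; rewrite t0 minxx maxxx -eq_le => /eqP <-; rewrite scale0r addr0.
pose l := s / t.
have l01 : 0 <= l <= 1.
  have [tp|] := boolP (0 <= t).
    have {t0}tp : 0 < t by rewrite lt_def t0.
    move: st; rewrite (min_idPl (ltW tp)) (max_idPr (ltW tp)) => /andP[s0 st].
    by rewrite divr_ge0 ?(ltW tp) //= ler_pdivrMr // mul1r.
  rewrite -ltNge => tn; move: st; rewrite (min_idPr (ltW tn)) (max_idPl (ltW tn)) => /andP[st s0].
  by rewrite /l -mulrNN -invrN divr_ge0 ?oppr_ge0 ?(ltW tn) //= ler_pdivrMr ?oppr_gt0 // mul1r lerN2.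
case/andP: l01 => l0 l1.
have -> : p + s *: v = (1 - l) *: p + l *: (p + t *: v).
  by rewrite scalerDr scalerA divfK // addrA -scalerDl subrK scale1r.
have l2 : 0 <= 1 - l by rewrite subr_ge0.
apply: le_trans (ler_normD _ _) _; 
have -> : `|(1 - l) *: p| = (1 - l) * `|p| by rewrite normrZ ger0_norm.
have -> : `|l *: (p + t *: v)| = l * `|p + t *: v| by rewrite normrZ ger0_norm.
by apply: le_trans (lerD (ler_wpM2l l2 pr) (ler_wpM2l l0 ptr)) _; rewrite -mulrDl subrK mul1r.
Qed.

(** For fixed [N] the estimate involves finitely many values of the family, so it survives a
    pointwise limit; the limit itself is never differentiated. *)
Lemma taylor_family_limit (r1 C A s0 : R) (D : seq 'I_m -> R)
   (H : R -> seq 'I_m -> V -> R) (G : seq 'I_m -> V -> R) :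
  (forall beta, 0 <= D beta) ->
  (forall s, s0 <= s -> taylor_family r1 C A (H s)) ->
  (forall beta p s, `|p| <= r1 -> s0 <= s -> `|H s beta p - G beta p| <= D beta * expR (- s)) ->
  taylor_family r1 C A G.
Proof.
move=> D0 TH HG N beta i p t pr ptr.
pose E := D beta + \sum_(j < N) D (beta ++ nseq j i) * `|t| ^+ j / j`!%:R.
have f0 j : 0 < j`!%:R :> R by rewrite ltr0n fact_gt0.
have E0 : 0 <= E.
  rewrite addr_ge0 // sumr_ge0 // => j _.
  by rewrite !mulr_ge0 ?exprn_ge0 // invr_ge0 ltW.
apply: (@le_of_exp_error _ _ _ E s0) => // s ss.
have T := TH s ss N beta i p t pr ptr.
set X := \sum_(j < N) G _ p * t ^+ j / j`!%:R.
set Y := \sum_(j < N) H s _ p * t ^+ j / j`!%:R in T.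
have -> : G beta (p + t *: delta_mx 0 i) - X =
  (H s beta (p + t *: delta_mx 0 i) - Y) -
  ((H s beta (p + t *: delta_mx 0 i) - G beta (p + t *: delta_mx 0 i)) - (Y - X)) by ring.
apply: le_trans (ler_normB _ _) _; apply: lerD => //.
apply: le_trans (ler_normB _ _) _; rewrite mulrDl; apply: lerD; first exact: HG.
rewrite mulr_suml /Y /X -sumrB; apply: le_trans (ler_norm_sum _ _ _) _.
apply: ler_sum => j _; rewrite -!mulrBl !normrM normfV normrX (gtr0_norm (f0 j)).
have w0 : 0 <= `|t| ^+ j / j`!%:R by rewrite divr_ge0 ?exprn_ge0 // ltW.
have := ler_wpM2r w0 (HG (beta ++ nseq j i) p s pr ss).
rewrite !mulrA => /le_trans; apply.
by rewrite le_eqVlt; apply/orP; left; apply/eqP; ring.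
Qed.

(** At a finite scale the regularized values are differentiable in the centre. Moving the centre by
    +e differentiates the bump along -e, which the sign [(-1) ^+ size beta] compensates; the bounds
    are those assumed, uniform in the scale when the hypothesis is. *)
Lemma taylor_family_rescale (r : R) (N : nat) (C A : R) (u : (V -> R) -> R) (b : V -> R)
  (C' A' sg : R) : 0 <= C -> 0 <= A -> linear_on r u -> derivative_bounds r N C A u ->
  rtest 1 b -> expR (- sg) < r / 2 -> 0 <= C' -> 0 <= A' ->
  (forall beta a, `|a| <= r / 2 ->
     `|u (dseq beta (rescale a sg b))| <= C' * A' ^+ size beta * (size beta)`!%:R) ->
  taylor_family (r / 2) C' (2 * A')
    (fun beta p => (-1) ^+ size beta * u (dseq beta (rescale p sg b))).
Proof.
move=> C0 A0 lu du tb esg C'0 A'0 bu K beta i p t pr ptr.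
set e := delta_mx 0 i in ptr *.
pose H beta p := (-1) ^+ size beta * u (dseq beta (rescale p sg b)).
pose eta := rescale 0 sg b.
have teta : rtest (expR (- sg)) eta.
  have [sb z] := tb; split; first exact: rsmooth_rescale.
  move=> x xs; rewrite /eta /rescale subr0 z ?mulr0 // normrZ ger0_norm ?expR_ge0 //.
  by rewrite -ltr_pdivrMl ?expR_gt0 // -expRN mulr1.
have rE c : rescale c sg b = (fun x => eta (x - c)).
  by apply/funext => x; rewrite /eta /rescale subr0.
have [seta _] := teta.
have dH gam s : `|p + s *: e| <= r / 2 ->
    is_derive s (1 : R) (fun s => H gam (p + s *: e)) (H (rcons gam i) (p + s *: e)).
  move=> psr.
  have lt : expR (- sg) + `|p + s *: e| < r by lra.
  have := is_derive_translate (linear_on_dseq lu gam) (bounded_on_dseq du gam)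
    (const_ge0 C0 A0 gam) teta lt.
  have -> : (fun x => 'D_e eta (x - (p + s *: e))) =
     (fun x => 'D_e (fun x => eta (x - (p + s *: e))) x).
    by exact: esym (@rderives_translate R m (p + s *: e) [:: e] eta seta).
  rewrite -dseq_rcons -rE => D1.
  have := is_deriveZ ((-1) ^+ size gam) D1.
  rewrite /H size_rcons exprS /GRing.scale /= mulrN mulN1r mulNr.
  by under [X in is_derive _ _ X _]eq_fun do rewrite -rE.
have rc gam j : rcons (gam ++ nseq j i) i = gam ++ nseq j.+1 i.
  by rewrite rcons_cat; congr (_ ++ _); elim: j => //= j ->.
have := @taylor_bound R (fun j s => H (beta ++ nseq j i) (p + s *: e)) K t
  (C' * A' ^+ (size beta + K) * (size beta + K)`!%:R).
rewrite scale0r addr0 cats0 => /(_ _ _)T.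
apply: le_trans (T _ _) _.
- by move=> j s _ st; rewrite -rc; apply: dH; exact: segment_norm st pr ptr.
- move=> s st; rewrite /H normrM normrX normrN1 expr1n mul1r.
  have := bu (beta ++ nseq K i) (p + s *: e) (segment_norm st pr ptr).
  by rewrite size_cat size_nseq.
set k := size beta.
have F : (k + K)`!%:R <= 2 ^+ (k + K) * (k`!%:R * K`!%:R) :> R.
  by rewrite -natrX -!natrM ler_nat fact_double.
rewrite ler_pdivrMr ?ltr0n ?fact_gt0 //.
have -> : C' * A' ^+ (k + K) * (k + K)`!%:R * `|t| ^+ K =
  (C' * A' ^+ (k + K) * `|t| ^+ K) * (k + K)`!%:R by ring.
apply: le_trans (ler_wpM2l _ F) _; first by rewrite !mulr_ge0 ?exprn_ge0.
by rewrite !exprMn !exprD le_eqVlt; apply/orP; left; apply/eqP; ring.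
Qed.

End TaylorOfPointValues.

(** * Representation by the density of point values *)

Section Partition.
Context {R : realType} {m : nat}.
Local Notation V := 'rV[R]_m.

Definition spline_rV (x : V) : R := \prod_(i < m) spline (x 0 i).

Lemma rtest_spline_rV : rtest 1 spline_rV.
Proof.
split.
  by apply: rsmooth_prod => i; apply: rsmooth_comp; [exact: rsmooth_spline|exact: rsmooth_coord].
move=> x x1; apply/eqP; rewrite prodf_seq_eq0; apply/hasP.
have [i xi] : exists i, 1 < `|x 0 i|.
  apply: contrapT => H; move: x1; rewrite ltNge => /negP; apply; apply: rV_norm_le => // i.
  by rewrite leNgt; apply/negP => xi; apply: H; exists i.
by exists i; [rewrite mem_index_enum|rewrite spline_support ?eqxx].
Qed.

Lemma spline_rV_ge0 x : 0 <= spline_rV x.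
Proof. by apply: prodr_ge0 => i _; exact: spline_ge0. Qed.

Lemma spline_rV_at0 : spline_rV 0 = 1.
Proof. by apply: big1 => i _; rewrite mxE spline0. Qed.

Lemma spline_sum (y : R) n : \sum_(j < n) spline (y - j%:R) = step (y + 1) - step (y + 1 - n%:R).
Proof.
elim: n => [|n IH]; first by rewrite big_ord0 subr0 subrr.
rewrite big_ord_recr /= IH /spline.
have -> : y - n%:R + 1 = y + 1 - n%:R by ring.
have -> : y + 1 - n.+1%:R = y - n%:R by rewrite -natr1; ring.
by ring.
Qed.

(** The shift by [M] turns indices from 0 to 2 M into the integer points of the cube of half-side
    [M]. *)
Definition lattice_point M (f : {ffun 'I_m -> 'I_(M.*2.+1)}) : V := \row_i ((f i)%:R - M%:R).

Lemma lattice_point_norm M (f : {ffun 'I_m -> 'I_(M.*2.+1)}) : `|lattice_point f| <= M%:R.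
Proof.
apply: rV_norm_le => // i; rewrite mxE ler_norml.
have := ltn_ord (f i); rewrite ltnS => fM.
have : (f i)%:R <= M%:R + M%:R :> R by rewrite -natrD addnn ler_nat.
by have := ler0n R (f i); rewrite lerNl opprB => ? ?; apply/andP; split; lra.
Qed.

Lemma spline_rV_partition M (x : V) : `|x| <= M%:R ->
  \sum_(f : {ffun 'I_m -> 'I_(M.*2.+1)}) spline_rV (x - lattice_point f) = 1.
Proof.
move=> xM.
transitivity (\sum_(f : {ffun 'I_m -> 'I_(M.*2.+1)}) \prod_i spline (x 0 i + M%:R - (f i)%:R)).
  apply: eq_bigr => f _; apply: eq_bigr => i _; rewrite !mxE; congr spline.
  by rewrite opprB addrA.
(* The sum of products factors into one telescoping sum per coordinate. *)
rewrite -(bigA_distr_bigA (fun (i : 'I_m) (j : 'I_(M.*2.+1)) => spline (x 0 i + M%:R - j%:R))) /=.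
apply: big1 => i _; rewrite spline_sum.
have := le_trans (coord_le_norm x i) xM; rewrite ler_norml => /andP[x1 x2].
rewrite step_ge1; last by lra.
have -> : M.*2.+1%:R = M%:R + M%:R + 1 :> R by rewrite -addnn -natr1 natrD.
by rewrite step_le0 ?subr0 //; lra.
Qed.

Lemma rint_spline_gt0 : 0 < rint_rV spline_rV.
Proof.
apply: (rint_rV_gt0 ler01 (rtest_lip_supp rtest_spline_rV) (x0 := 0)); first exact: spline_rV_ge0.
by rewrite spline_rV_at0.
Qed.

Lemma lip_supp_mul L L' M M' (f g : V -> R) : 0 <= M -> 0 <= M' -> lip_supp L f -> lip_supp L' g ->
  (forall x, `|f x| <= M) -> (forall x, `|g x| <= M') -> lip_supp L (fun x => f x * g x).
Proof.
move=> M0 M'0 [[k k0 fk] sf] [[k' k'0 gk] sg] fM gM; split; last first.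
  by move=> x xL; rewrite sf // mul0r.
exists (M * k' + M' * k) => [|x y]; first by rewrite addr_ge0 // mulr_ge0.
have -> : f x * g x - f y * g y = f x * (g x - g y) + g y * (f x - f y) by ring.
apply: le_trans (ler_normD _ _) _; rewrite !normrM mulrDl -!mulrA.
by apply: lerD; apply: ler_pM.
Qed.

Lemma rderives_cst_cons v vs (c : R) (x : V) : rderives (rcons vs v) (fun=> c) x = 0.
Proof.
rewrite rderives_rcons; have -> : (fun x : V => 'D_v (fun=> c) x) = (fun=> 0).
  by apply/funext => y; rewrite -[fun=> c]/(cst c) derive_cst.
by rewrite rderives_cst0.
Qed.

(** On the unit ball the value is O(h) by the Lipschitz bound, and every derivative of positive
    order carries a factor [h] from the dilation. Order [N.+1] supplies a first derivative even when
    [N] is 0. *)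
Lemma wbound_local_variation N B h (a w : V) (phi : V -> R) : rsmooth phi -> bound_CN N.+1 phi B ->
  0 <= h <= 1 -> `|w| <= 1 -> wbound N 1 (B * h) (fun y => phi (h *: y + a) - phi a) w.
Proof.
move=> sp H /andP[h0 h1] w1; have B0 := bound_CN_ge0 H.
have sL := rsmooth_comp_affine (@affine_map_scale_shift R V h a) sp.
move=> vs sz v1; rewrite expr1n mulr1.
have B1 : bound_CN 1 phi B by move=> x; apply: wbound_leN (H x).
case/lastP: vs sz v1 => [_ _|vs v] /=.
  apply: le_trans (bound_CN_lipschitz sp B1 _ _) _; rewrite addrK normrZ (ger0_norm h0).
  by rewrite ler_wpM2l // ler_piMr.
move=> sz v1; rewrite rderives_sub //; last exact: rsmooth_cst.
rewrite rderives_cst_cons subr0 (rderives_comp_affine _ (@affine_map_scale_shift R V h a) sp).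
rewrite rderives_scaled_directions // normrM.
have := H (h *: w + a) (rcons vs v) (leqW sz) v1; rewrite expr1n mulr1 => Hb.
rewrite mulrC; apply: ler_pM => //.
rewrite size_rcons ger0_norm ?exprn_ge0 // exprS ler_piMr // exprn_ile1 //.
Qed.

End Partition.

Section Representation.
Context {R : realType} {m : nat}.
Local Notation V := 'rV[R]_m.
Implicit Types (a x y p : V) (phi : V -> R).

Lemma taylor_family_lipschitz (r1 C A : R) (G : seq 'I_m -> V -> R) : 0 <= C -> 0 <= A ->
  taylor_family r1 C A G -> forall p q, `|p| <= r1 / 3 -> `|q| <= r1 / 3 ->
  `|G [::] p - G [::] q| <= m%:R * (C * A) * `|p - q|.
Proof.
move=> C0 A0 TG p q pr qr; set y := p - q.
(* The reason for the radius [r1 / 3]. The coordinates of [p - q] are then added one by one, with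
   the one-term Taylor estimate at each stage. *)
have yr : `|q| + `|y| <= r1 by have := ler_normB p q; rewrite -/y; lra.
have H l : uniq l -> `|G [::] (q + restrict_coords l y) - G [::] q| <= (size l)%:R * (C * A) * `|y|.
  elim: l => [_|i l IH /= /andP[il ul]].
    have -> : restrict_coords [::] y = 0 by apply/rowP => j; rewrite !mxE.
    by rewrite addr0 subrr normr0 !mul0r.
  have nr l' : `|q + restrict_coords l' y| <= r1.
    apply: le_trans (ler_normD _ _) _; apply: le_trans yr; rewrite lerD2l.
    exact: restrict_coords_norm.
  have e : q + restrict_coords (i :: l) y = q + restrict_coords l y + y 0 i *: delta_mx 0 i.
    by rewrite restrict_coords_cons // addrA.
  have := nr (i :: l); rewrite e => nr'.
  have := TG 1%N [::] i (q + restrict_coords l y) (y 0 i) (nr l) nr'.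
  rewrite big_ord1 /= !fact0 !expr0 expr1 !divr1 !mulr1 => T.
  set X := G [::] (q + restrict_coords l y + _) in T *.
  set Z := G [::] (q + restrict_coords l y) in T IH *.
  have -> : X - G [::] q = (X - Z) + (Z - G [::] q) by ring.
  apply: le_trans (ler_normD _ _) _; apply: le_trans (lerD T (IH ul)) _.
  have := ler_wpM2l (mulr_ge0 C0 A0) (coord_le_norm y i).
  by rewrite -natr1; lra.
have := H (enum 'I_m) (enum_uniq _); rewrite -cardE card_ord.
have -> : restrict_coords (enum 'I_m) y = y by apply/rowP => j; rewrite mxE mem_enum.
by rewrite /y [q + _]addrC subrK.
Qed.

(* Comparing [u] with the integral against [g] on each piece of a partition of
   unity at scale [h]: the pieces agree up to O(h^(m+1)), and there are O(h^-m) of them. *)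
Lemma representation (r r2 : R) (N : nat) (C : R) (u : (V -> R) -> R) (b : V -> R)
  (s0 C' L kap : R) (g : V -> R) :
  0 < r2 -> r2 <= 1 -> r2 <= r / 2 -> linear_on r u -> 0 < kap ->
  rtest 1 b -> (forall x, 0 <= b x) -> rint_rV b = 1 ->
  (forall x, kap * b x = spline_rV x) -> expR (- s0) < r / 2 -> 0 <= C' -> 0 <= L ->
  (forall a sg, `|a| <= r / 2 -> s0 <= sg -> `|u (rescale a sg b) - g a| <= C' * expR (- sg)) ->
  (forall chi B a sg, rtest 1 chi -> bound_CN N chi B -> `|a| <= r / 2 -> s0 <= sg ->
     `|u (rescale a sg chi)| <= C' * B) ->
  (forall x, `|x| <= r2 -> `|g x| <= C) ->
  (forall x y, `|x| <= r2 -> `|y| <= r2 -> `|g x - g y| <= L * `|x - y|) ->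
  forall phi, rtest r2 phi ->
    lip_supp r2 (fun s => g s * phi s) /\ u phi = rint_rV (fun s => g s * phi s).
Proof.
move=> r20 r21 r2r lu kap0 tb b0 Ib kb es0 C'0 L0 gu uC' gC gL phi tphi.
have [sphi zphi] := tphi; have [sb zb] := tb.
have [Bp HBp] := rtest_bound_rV N.+1 tphi; have [Bb HBb] := rtest_bound_rV N tb.
have Bp0 := bound_CN_ge0 HBp; have Bb0 := bound_CN_ge0 HBb.
have C0 : 0 <= C by apply: le_trans (gC 0 _) => //; rewrite normr0 ltW.
have lipp : forall x y, `|phi x - phi y| <= Bp * `|x - y|.
  by apply: bound_CN_lipschitz => // x; apply: wbound_leN (HBp x).
have phiB x : `|phi x| <= Bp by exact: wbound_value (HBp x).
have bB x : `|b x| <= Bb by exact: wbound_value (HBb x).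
pose K := C * Bp + L * Bp.
have K0 : 0 <= K by rewrite addr_ge0 // mulr_ge0.
pose gp := fun s => g s * phi s.
have gpB x : `|gp x| <= C * Bp.
  have [xr|xr] := leP `|x| r2; first by rewrite normrM ler_pM // gC.
  by rewrite /gp zphi // mulr0 normr0 mulr_ge0.
have gpL x y : `|gp x - gp y| <= K * `|x - y|.
  wlog xr : x y / `|x| <= r2 => [W|].
    have [xr|xr] := boolP (`|x| <= r2); first exact: W.
    have [yr|yr] := boolP (`|y| <= r2); first by rewrite distrC [`|x - y|]distrC; exact: W.
    rewrite -!ltNge in xr yr.
    by rewrite /gp !zphi // !mulr0 subrr normr0 mulr_ge0.
  have [yr|yr] := leP `|y| r2.
    have -> : gp x - gp y = g x * (phi x - phi y) + (g x - g y) * phi y by rewrite /gp; ring.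
    apply: le_trans (ler_normD _ _) _; rewrite !normrM mulrDl -!mulrA.
    apply: lerD; first by apply: ler_pM => //; exact: gC.
    by rewrite [Bp * _]mulrC mulrA; apply: ler_pM => //; exact: gL.
  have -> : gp x - gp y = g x * (phi x - phi y) by rewrite /gp (zphi y yr) mulr0 !subr0.
  rewrite normrM mulrDl -!mulrA; apply: (@le_trans _ _ (C * (Bp * `|x - y|))).
    by apply: ler_pM => //; exact: gC.
  by rewrite lerDl !mulr_ge0.
have lgp : lip_supp r2 gp.
  by split; [exists K|move=> x xr; rewrite /gp zphi // mulr0].
split=> //.
(* Per unit of [h]: the fluctuation of [phi] on a piece, the error of the regularized point value,
   and the variation of [g * phi] over a piece. *)
pose Q := C' * (2 ^+ N * (Bb * Bp)) + Bp * C' + K.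
have Q0 : 0 <= Q by rewrite !addr_ge0 // !mulr_ge0 // exprn_ge0.
suff main M : (0 < M)%N -> r2 * expR s0 <= M%:R ->
    `|u phi - rint_rV gp| <= (3 * r2) ^+ m * kap * Q * (r2 / M%:R).
  apply/eqP; rewrite -subr_eq0 -normr_le0; apply/ler_addgt0Pr => e e0; rewrite add0r.
  pose D := (3 * r2) ^+ m * kap * Q * r2.
  have D0 : 0 <= D by rewrite !mulr_ge0 ?exprn_ge0 ?mulr_ge0 // ltW.
  pose M := (Num.truncn (r2 * expR s0 + D / e)).+1.
  have MB : r2 * expR s0 + D / e <= M%:R by rewrite ltW // truncnS_gt.
  have p1 : 0 <= r2 * expR s0 by rewrite mulr_ge0 ?expR_ge0 // ltW.
  have p2 : 0 <= D / e by rewrite divr_ge0 // ltW.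
  apply: le_trans (main M isT _) _; first by lra.
  rewrite mulrA -/D ler_pdivrMr ?ltr0n // mulrC -ler_pdivrMr //.
  by lra.
move=> M0 Ms; have MR : 0 < M%:R :> R by rewrite ltr0n.
pose h := r2 / M%:R; have h0 : 0 < h by rewrite divr_gt0.
have h1 : h <= 1.
  by rewrite ler_pdivrMr // mul1r (le_trans r21) // ler1n.
(* The scale at which the rescaled bumps have radius [h], the mesh of the lattice. *)
pose sg := - ln h.
have esg : expR (- sg) = h by rewrite opprK lnK ?posrE.
have esg' : expR sg = h^-1 by rewrite -[sg]opprK expRN esg.
have ss : s0 <= sg.
  rewrite -ler_expR esg' invf_div ler_pdivlMr // mulrC.
  exact: Ms.
pose af (f : {ffun 'I_m -> 'I_(M.*2.+1)}) := h *: lattice_point f : V.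
have afr f : `|af f| <= r2.
  rewrite normrZ (gtr0_norm h0) /h mulrAC ler_pdivrMr //.
  by apply: ler_wpM2l; [exact: ltW|exact: lattice_point_norm].
have afr' f : `|af f| <= r / 2 by exact: le_trans (afr f) r2r.
pose bf f (s : V) := b (expR sg *: (s - af f)).
have hm : h ^+ m * h^-1 ^+ m = 1 by rewrite -exprMn divff ?expr1n // gt_eqF.
have part s : `|s| <= r2 -> \sum_f kap * bf f s = 1.
  move=> sr; rewrite -[RHS](@spline_rV_partition R m M (h^-1 *: s)); last first.
    by rewrite normrZ gtr0_norm ?invr_gt0 // /h invf_div mulrAC ler_pdivrMr // ler_wpM2l.
  apply: eq_bigr => f _; rewrite kb /bf esg'; congr spline_rV.
  by rewrite scalerBr /af scalerA mulVf ?scale1r // gt_eqF.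
have dphi f : rsmooth (fun w : V => phi (h *: w + af f) - phi (af f)).
  apply: rsmooth_sub; last exact: rsmooth_cst.
  exact: (rsmooth_comp_affine (@affine_map_scale_shift R V h (af f)) sphi).
pose vf f (w : V) := (phi (h *: w + af f) - phi (af f)) * b w.
have tv f : rtest 1 (vf f) by exact: rtest_mull.
have es : expR (- sg) <= r / 2 by apply: le_trans (ltW es0); rewrite ler_expR lerN2.
have trb f : rtest r (rescale (af f) sg b).
  by apply: rtest_rescale.
have trv f : rtest r (rescale (af f) sg (vf f)).
  by apply: rtest_rescale.
(* On a piece, [phi] is its value at the centre plus a fluctuation; the first part gives the point
   value of [u], and the second has a profile [vf f] of C^N norm O(h). *)
pose term f (s : V) := phi (af f) * rescale (af f) sg b s + rescale (af f) sg (vf f) s.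
have tterm f : rtest r (term f) by exact: rtest_lin.
have termE f s : phi s * bf f s = h ^+ m * term f s.
  rewrite /term /rescale expRM_natl /vf -/(bf f s).
  have -> : h *: (expR sg *: (s - af f)) + af f = s by rewrite esg' scalerA divff ?scale1r ?subrK // gt_eqF.
  have -> : h ^+ m * (phi (af f) * (expR sg ^+ m * bf f s) + expR sg ^+ m * ((phi s - phi (af f)) * bf f s))
    = (h ^+ m * expR sg ^+ m) * (phi s * bf f s) by ring.
  by rewrite esg' hm mul1r.
have uE : u phi = \sum_f kap * h ^+ m * u (term f).
  rewrite (_ : phi = (fun s => \sum_f kap * h ^+ m * term f s)); last first.
    apply/funext => s.
    have -> : \sum_f kap * h ^+ m * term f s = \sum_f (kap * bf f s) * phi s.
      by apply: eq_bigr => f _; rewrite -mulrA -termE; ring.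
    rewrite -mulr_suml; have [sr|sr] := leP `|s| r2; first by rewrite part // mul1r.
    by rewrite zphi // mulr0.
  rewrite (linear_on_sum _ lu).
    by apply: eq_bigr => f _; rewrite (linear_on_scale _ lu).
  move=> f; have := rtest_lin (kap * h ^+ m) (tterm f) (@rtest0 _ _ r).
  by under eq_fun do rewrite addr0.
have lb f : lip_supp (1 / expR sg + `|af f|) (bf f).
  have := lip_supp_affine (af f) (expR_gt0 sg) (rtest_lip_supp tb).
  by rewrite normr1.
have lbg f : lip_supp r2 (fun s => gp s * bf f s).
  exact: (lip_supp_mul (mulr_ge0 C0 Bp0) Bb0 lgp (lb f) gpB (fun x => bB _)).
have r20' : 0 <= r2 by exact: ltW.
have lbgk f : lip_supp r2 (fun s => kap * (gp s * bf f s)).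
  by have := lip_supp_lin kap (lbg f) (lip_supp0 r2); under eq_fun do rewrite addr0.
have IE : rint_rV gp = \sum_f kap * rint_rV (fun s => gp s * bf f s).
  have -> : rint_rV gp = rint_rV (fun s => \sum_f kap * (gp s * bf f s)).
    congr rint_rV; apply/funext => s.
    have -> : \sum_f kap * (gp s * bf f s) = \sum_f (kap * bf f s) * gp s.
      by apply: eq_bigr => f _; ring.
    rewrite -mulr_suml; have [sr|sr] := leP `|s| r2; first by rewrite part // mul1r.
    by rewrite /gp zphi // !mulr0.
  rewrite (rint_rV_sum _ r20' lbgk); apply: eq_bigr => f _.
  exact: rint_rV_scale r20' (lbg f).
have Ibf f : rint_rV (bf f) = h ^+ m.
  by rewrite (rint_rV_affine (af f) (expR_gt0 sg) ler01 (rtest_lip_supp tb)) Ib mulr1 esg' invrK.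
have e1 f : `|u (term f) - gp (af f)| <= (C' * (2 ^+ N * (Bb * Bp)) + Bp * C') * h.
  rewrite lu // /gp mulrC.
  have -> : u (rescale (af f) sg b) * phi (af f) + u (rescale (af f) sg (vf f)) - g (af f) * phi (af f) =
    u (rescale (af f) sg (vf f)) + phi (af f) * (u (rescale (af f) sg b) - g (af f)) by ring.
  apply: le_trans (ler_normD _ _) _; rewrite mulrDl; apply: lerD.
    rewrite -!mulrA; apply: uC' => // w.
    have [w1|w1] := leP `|w| 1; last first.
      have W0 := @rtest_wbound_outside R V 1 _ N 1 w ler01 (tv f) w1.
      apply: wbound_le W0 => //.
      by rewrite !mulr_ge0 ?exprn_ge0 // ltW.
    have h01 : 0 <= h <= 1 by rewrite (ltW h0).
    have W := wbound_mul ler01 ler01 (dphi f) sb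
      (wbound_local_variation (af f) sphi HBp h01 w1) (HBb w).
    have := wbound_weight1 _ W; rewrite -[1 + 1]/(2 : R) => /(_ (ler1n _ 2)).
    by have -> : Bp * h * Bb * 2 ^+ N = 2 ^+ N * (Bb * (Bp * h)) by ring.
  rewrite normrM -mulrA; apply: ler_pM => //.
  by rewrite -[in leRHS]esg; exact: gu.
have e2 f : `|gp (af f) * h ^+ m - rint_rV (fun s => gp s * bf f s)| <= K * h * h ^+ m.
  set LL := Num.max r2 (1 / expR sg + `|af f|).
  have LL0 : 0 <= LL by rewrite le_max r20'.
  have l1 : lip_supp LL (bf f) by apply: lip_supp_le (lb f); rewrite le_max lexx orbT.
  have l2 : lip_supp LL (fun s => gp s * bf f s) by apply: lip_supp_le (lbg f); rewrite le_max lexx.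
  have l3 : lip_supp LL (fun s => -1 * (gp s * bf f s)).
    by have := lip_supp_lin (-1) l2 (lip_supp0 LL); under eq_fun do rewrite addr0.
  have -> : gp (af f) * h ^+ m - rint_rV (fun s => gp s * bf f s) =
     rint_rV (fun s => gp (af f) * bf f s + -1 * (gp s * bf f s)).
    by rewrite (rint_rV_lin _ LL0 l1 l3) (rint_rV_scale _ LL0 l2) Ibf mulN1r.
  rewrite -(Ibf f); apply: (rint_rV_abs_le LL0 l1); first exact: lip_supp_lin.
  move=> s; rewrite mulN1r -mulrBl normrM [`|bf f s|]ger0_norm ?b0 //.
  have [sh|sh] := leP `|s - af f| h.
    rewrite ler_wpM2r ?b0 //; apply: le_trans (gpL _ _) _.
    by rewrite distrC ler_wpM2l.
  rewrite [bf f s](_ : _ = 0) ?mulr0 // /bf zb // normrZ gtr0_norm ?expR_gt0 // esg' mulrC.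
  by rewrite ltr_pdivlMr // mul1r.
rewrite uE IE -sumrB.
apply: le_trans (ler_norm_sum _ _ _) _.
apply: (@le_trans _ _ (\sum_(f : {ffun 'I_m -> 'I_(M.*2.+1)}) kap * h ^+ m * Q * h)).
  apply: ler_sum => f _.
  have -> : kap * h ^+ m * u (term f) - kap * rint_rV (fun s => gp s * bf f s) =
    kap * (h ^+ m * (u (term f) - gp (af f)) + (gp (af f) * h ^+ m - rint_rV (fun s => gp s * bf f s))).
    by ring.
  rewrite normrM gtr0_norm //.
  have -> : kap * h ^+ m * Q * h = kap * (h ^+ m * (Q * h)) by ring.
  rewrite ler_wpM2l ?(ltW kap0) //.
  apply: le_trans (ler_normD _ _) _; rewrite normrM [`|h ^+ m|]ger0_norm ?exprn_ge0 ?(ltW h0) //.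
  have hm0 : 0 <= h ^+ m by rewrite exprn_ge0 // ltW.
  apply: le_trans (lerD (ler_wpM2l hm0 (e1 f)) (e2 f)) _.
  by rewrite le_eqVlt; apply/orP; left; apply/eqP; rewrite /Q; ring.
rewrite sumr_const card_ffun !card_ord -[X in X <= _]mulr_natl -/h.
have -> : (3 * r2) ^+ m * kap * Q * h = (3 * r2) ^+ m * (kap * Q * h) by ring.
have -> : (M.*2.+1 ^ m)%:R * (kap * h ^+ m * Q * h) = (M.*2.+1%:R * h) ^+ m * (kap * Q * h).
  by rewrite natrX [(M.*2.+1%:R * h) ^+ m]exprMn; ring.
rewrite ler_wpM2r ?mulr_ge0 ?(ltW kap0) ?(ltW h0) //.
rewrite lerXn2r ?nnegrE ?mulr_ge0 ?(ltW r20) ?(ltW h0) //.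
(* The number of pieces is (2 M + 1)^m and 2 M + 1 <= 3 M, so this number times [h ^+ m] stays
   bounded. *)
have -> : 3 * r2 = (3 * M%:R) * h by rewrite /h; field; rewrite gt_eqF.
apply: ler_wpM2r; first exact: ltW.
by rewrite -natrM ler_nat -addnn; clear -M0; lia.
Qed.

End Representation.

Lemma analytic_of_derivative_bounds {R : realType} {m : nat} (r : R) (N : nat) (C A : R)
    (u : ('rV[R]_m -> R) -> R) :
  0 < r -> 0 <= C -> 0 <= A -> linear_on r u -> derivative_bounds r N C A u ->
  exists (r2 K : R) (g : 'rV[R]_m -> R) (c : 'rV[R]_m -> ('I_m -> nat) -> R),
  [/\ 0 < r2, r2 <= r,
    forall (a y : 'rV[R]_m) (n : nat), `|a| <= r2 -> `|y| <= r2 ->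
      \sum_(f : {ffun 'I_m -> 'I_n}) `|c a (fun i => f i) * \prod_(i < m) y 0 i ^+ f i| <= K,
    forall (a y : 'rV[R]_m) (n : nat), `|a| <= r2 -> `|y| <= r2 ->
      `|\sum_(f : {ffun 'I_m -> 'I_n.+1}) c a (fun i => f i) * \prod_(i < m) y 0 i ^+ f i
        - g (a + y)| <= K * 2^-1 ^+ n
  & forall phi, rtest r2 phi ->
      lip_supp r2 (fun s => g s * phi s) /\ u phi = rint_rV (fun s => g s * phi s)].
Proof.
move=> r0 C0 A0 lu du.
have I0 := @rint_spline_gt0 R m; set kap := rint_rV _ in I0.
(* Normalized to integral 1 so that the limits are point values; [kap * b] recovers the partition of
   unity. *)
pose b : 'rV[R]_m -> R := fun x => kap^-1 * spline_rV x.
have tb : rtest 1 b.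
  have := rtest_lin kap^-1 (@rtest_spline_rV R m) (@rtest0 _ _ 1).
  by under eq_fun do rewrite addr0.
have b0 x : 0 <= b x by rewrite mulr_ge0 ?spline_rV_ge0 // invr_ge0 ltW.
have Ib : rint_rV b = 1.
  by rewrite (rint_rV_scale _ ler01 (rtest_lip_supp (@rtest_spline_rV R m))) mulVf // gt_eqF.
have kb x : kap * b x = spline_rV x by rewrite mulrA divff ?mul1r // gt_eqF.
have [s0 [C' [A' [G [[s00 es0 C'0 A'1] bu gu uC']]]]] := point_values r0 C0 A0 lu du tb.
have A'0 : 0 <= A' by apply: le_trans A'1.
pose G' beta (a : 'rV[R]_m) := (-1) ^+ size beta * G beta a.
have es s : s0 <= s -> expR (- s) < r / 2.
  by move=> ss; apply: le_lt_trans es0; rewrite ler_expR lerN2.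
pose D (beta : seq 'I_m) := C' * A' ^+ size beta * (size beta)`!%:R.
have D0 beta : 0 <= D beta by rewrite !mulr_ge0 // exprn_ge0.
pose H s beta (p : 'rV[R]_m) := (-1) ^+ size beta * u (dseq beta (rescale p s b)).
have HG beta p s : `|p| <= r / 2 -> s0 <= s -> `|H s beta p - G' beta p| <= D beta * expR (- s).
  by move=> pr ss; rewrite -mulrBr normrM normrX normrN1 expr1n mul1r; exact: gu.
have TH s : s0 <= s -> taylor_family (r / 2) C' (2 * A') (H s).
  move=> ss; apply: (taylor_family_rescale C0 A0 lu du tb (es s ss) C'0 A'0).
  by move=> beta a ar; exact: bu.
have A20 : 0 <= 2 * A' by rewrite mulr_ge0.
have TG : taylor_family (r / 2) C' (2 * A') G' := taylor_family_limit D0 TH HG.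
have bG beta p : `|p| <= r / 2 -> `|G' beta p| <= C' * (2 * A') ^+ size beta * (size beta)`!%:R.
  move=> pr; apply: (@le_trans _ _ (D beta)).
    apply: (@le_of_exp_error _ _ _ (D beta) s0) => // s ss.
    have -> : G' beta p = H s beta p - (H s beta p - G' beta p) by ring.
    apply: le_trans (ler_normB _ _) _; apply: lerD; last exact: HG.
    by rewrite /H normrM normrX normrN1 expr1n mul1r; exact: bu.
  by rewrite ler_wpM2r // ler_wpM2l // exprMn ler_peMl ?exprn_ge0 // exprn_ege1 // ler1n.
pose w := 2 ^+ m * (2 * A').
have w0 : 0 <= w by rewrite mulr_ge0 // exprn_ge0.
pose q := (2^-1 * 2^-1) / (w + 1).
have q0 : 0 < q by rewrite !mulr_gt0 ?invr_gt0 // ltr_wpDl.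
(* [r / 6] is a third of the radius [r / 2] on which point values exist, as the Lipschitz estimate
   requires, and leaves room for [a + y]; [q] secures the smallness condition of the power
   series. *)
pose r2 := Num.min (Num.min 1 (r / 6)) q.
have r20 : 0 < r2 by rewrite !lt_min ltr01 q0 divr_gt0.
have r21 : r2 <= 1 by rewrite !ge_min lexx.
have r26 : r2 <= r / 6 by rewrite !ge_min lexx orbT.
have r2q : r2 <= q by rewrite ge_min lexx orbT.
have wy (y : 'rV[R]_m) : `|y| <= r2 -> w * `|y| <= 2^-1 * 2^-1.
  move=> /le_trans/(_ r2q); rewrite ler_pdivlMr ?ltr_wpDl // => yw.
  by have := normr_ge0 y; nra.
have h12 : 2^-1 * 2^-1 <= 2^-1 :> R by lra.
exists r2; exists (C' * 2 ^+ m); exists (G' [::]); exists (taylor_coef G').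
split => //.
- by lra.
- move=> a y n ar yr; apply: (power_series_abs C'0 A20 bG).
    by lra.
  by apply: le_trans (wy y yr) h12.
- move=> a y n ar yr; have ay : `|a| + `|y| <= r / 2 by lra.
  have := power_series_error C'0 A20 TG n ay (wy y yr).
  by rewrite [2 ^+ m * C']mulrC.
- apply: (@representation R m r r2 N C' u b s0 C' (m%:R * (C' * (2 * A'))) kap (G' [::])) => //.
  + by lra.
  + by rewrite !mulr_ge0.
  + by move=> a s ar ss; have := HG [::] a s ar ss; rewrite /H /D /= !mul1r !mulr1.
  + move=> x xr; have := bG [::] x; rewrite /= expr0 !mulr1; apply; lra.
  + by move=> x y xr yr; apply: (taylor_family_lipschitz C'0 A20 TG); lra.
Qed.

(** The term of order k of the series of e^(k+1) is at most e^(k+1). *)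
Lemma pow_le_expR_fact {R : realType} (k : nat) :
  k.+1%:R ^+ k <= expR 1 * expR 1 ^+ k * k`!%:R :> R.
Proof.
have f0 : 0 < k`!%:R :> R by rewrite ltr0n fact_gt0.
rewrite -exprS -expRM_natl mulr1 -ler_pdivrMr //.
case: k f0 => [|k] _; last first.
  by have := @expR_ge1Dxn R k.+2%:R k (ler0n _ _); lra.
by have := @expR_ge1Dx R 1; rewrite expr0 fact0 invr1 mul1r; lra.
Qed.

(** * Derivative bounds from a chain of equations *)

Section FiniteDifferences.
Context {R : realType} {m : nat}.
Local Notation V := 'rV[R]_m.
Implicit Types (psi X : V -> R).

Fixpoint diffs (h : R) (beta : seq 'I_m) X : V -> R :=
  match beta with
  | [::] => X
  | i :: beta' => fun x => diffs h beta' X x - diffs h beta' X (x - h *: delta_mx 0 i)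
  end.

Lemma diffs_translate h beta X b : 
  diffs h beta (fun x => X (x - b)) = (fun x => diffs h beta X (x - b)).
Proof.
elim: beta => [//|i beta IH] /=; rewrite IH; apply/funext => x.
by congr (_ - diffs _ _ _ _); rewrite addrAC.
Qed.

Lemma norm_scale_delta (t : R) (i : 'I_m) : 0 <= t -> `|t *: (delta_mx 0 i : V)| <= t.
Proof.
move=> t0; rewrite normrZ ger0_norm // -[leRHS]mulr1 ler_wpM2l //; exact: delta_mx_norm.
Qed.

Lemma rtest_diffs h beta X sg : 0 <= h -> rtest sg X -> rtest (sg + (size beta)%:R * h) (diffs h beta X).
Proof.
move=> h0 tX; elim: beta => [|i beta IH] /=; first by rewrite mul0r addr0.
have le1 : sg + (size beta)%:R * h <= sg + (size beta).+1%:R * h.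
  by rewrite lerD2l ler_wpM2r // ler_nat.
have le2 : sg + (size beta)%:R * h + `|h *: (delta_mx 0 i : V)| <= sg + (size beta).+1%:R * h.
  by rewrite -natr1 mulrDl mul1r addrA lerD2l norm_scale_delta.
have t1 := rtest_leW le1 IH.
have t2 := rtest_leW le2 (rtest_translate (h *: delta_mx 0 i) IH).
have -> : (fun x => diffs h beta X x - diffs h beta X (x - h *: delta_mx 0 i)) =
   (fun x => -1 * diffs h beta X (x - h *: delta_mx 0 i) + diffs h beta X x).
  by apply/funext => x; rewrite mulN1r addrC.
exact: rtest_lin.
Qed.

Lemma bound_CN_diffs N h beta X B sg : 0 <= h -> rtest sg X -> bound_CN N X B ->
  bound_CN N (diffs h beta X) (2 ^+ size beta * B).
Proof.
move=> h0 tX HB; elim: beta => [|i beta IH] /=; first by rewrite expr0 mul1r.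
have [sd _] := rtest_diffs beta h0 tX.
have sd' : rsmooth (fun x => diffs h beta X (x - h *: delta_mx 0 i)).
  by have [] := rtest_translate (h *: delta_mx 0 i) (rtest_diffs beta h0 tX).
have -> : 2 ^+ (size beta).+1 * B = 2 ^+ size beta * B + 2 ^+ size beta * B by rewrite exprS; ring.
have IH' := bound_CN_translate (h *: delta_mx 0 i) sd IH.
by move=> x; exact: (wbound_sub sd sd' (IH x) (IH' x)).
Qed.

Variables (rho : R) (G : nat -> (V -> R) -> (V -> R) -> R) (w : (V -> R) -> R).
Variables (N : nat) (C A c0 : R).
Hypotheses (rho0 : 0 < rho) (C0 : 0 <= C) (A0 : 0 <= A) (c0n : c0 != 0).
Hypothesis Glin : forall k psi, rtest rho psi -> linear_on rho (G k psi).
Hypothesis Gbnd : forall k psi B, rtest rho psi -> bound_CN N psi B ->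
  bounded_on rho N (C * A ^+ k * B) (G k psi).
Hypothesis Gstep : forall k i psi X, rtest rho psi -> rtest rho X ->
  G k.+1 psi (fun x => 'D_(delta_mx 0 i) X x) = G k (fun x => 'D_(delta_mx 0 i) psi x) X.
Hypothesis Gbase : forall psi X, rtest rho psi -> rtest rho X -> G 0 psi X = c0 * rint_rV X * w psi.

(** Slide the inner difference along the new direction. By [Gstep] and the induction hypothesis, the
    derivative of the resulting function of the shift is minus [h ^+ k] times a value of [G 0], and
    by [Gbase] that value depends on the translate of [X] only through its integral. The derivative
    is thus constant and the difference is exactly [h] times it, up to sign. *)
Lemma finite_difference h beta psi X sg : 0 <= h -> rtest rho psi -> rtest sg X -> 0 <= sg ->
  sg + (size beta)%:R * h < rho ->
  G (size beta) psi (diffs h beta X) = h ^+ size beta * G 0 (dseq beta psi) X.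
Proof.
move=> h0; elim: beta psi X sg => [|i beta IH] psi X sg tp tX sg0 /= lt; first by rewrite expr0 mul1r.
set k := size beta in IH lt *; set e : V := delta_mx 0 i.
have tp' : rtest rho (fun x => 'D_e psi x) by exact: rtest_derive.
have ltk : sg + k%:R * h + h < rho by move: lt; rewrite -natr1 mulrDl mul1r addrA.
have tY := rtest_diffs beta h0 tX; have [sY _] := tY; rewrite -/k in tY.
set Y := diffs h beta X in tY sY *.
have [B HB] := rtest_bound_rV N tp; have B0 := bound_CN_ge0 HB.
pose F t := G k.+1 psi (fun x => Y (x - (0 + t *: e))).
pose K := h ^+ k * G 0 (dseq (i :: beta) psi) X.
have tYt t : 0 <= t <= h -> rtest rho (fun x => Y (x - (0 + t *: e))).
  move=> /andP[t0 th]; apply: rtest_leW (rtest_translate (0 + t *: e) tY).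
  by rewrite add0r; apply: le_trans (ltW ltk); rewrite lerD2l (le_trans (norm_scale_delta i t0)).
have dF t : 0 <= t <= h -> is_derive t (1 : R) F (- K).
  move=> th; have /andP[t0 tle] := th.
  have ltt : sg + k%:R * h + `|0 + t *: e| < rho.
    by rewrite add0r; apply: le_lt_trans ltk; rewrite lerD2l (le_trans (norm_scale_delta i t0)).
  have CA : 0 <= C * A ^+ k.+1 * B by rewrite !mulr_ge0 ?exprn_ge0.
  apply: (is_derive_eq (is_derive_translate (Glin k.+1 tp) (Gbnd k.+1 tp HB) CA tY ltt)).
  congr (- _).
  have := rderives_translate (0 + t *: e) [:: e] sY => /= <-.
  rewrite Gstep //; last exact: tYt.
  have -> : (fun x => Y (x - (0 + t *: e))) = diffs h beta (fun x => X (x - (0 + t *: e))).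
    by rewrite diffs_translate.
  have tXt := rtest_translate (0 + t *: e) tX.
  rewrite (IH _ _ _ tp' tXt); first last.
  - apply: le_lt_trans ltk; rewrite addrAC lerD2l add0r; exact: le_trans (norm_scale_delta i t0) tle.
  - by rewrite addr_ge0.
  have td : rtest rho (dseq beta (fun x => 'D_e psi x)) by exact: rtest_derives.
  have tX1 : rtest rho X by apply: rtest_leW tX; apply: le_trans (ltW ltk); rewrite -addrA lerDl addr_ge0 // mulr_ge0.
  have tX2 : rtest rho (fun x => X (x - (0 + t *: e))).
    apply: rtest_leW tXt; apply: le_trans (ltW ltk); rewrite add0r -addrA lerD2l.
    by apply: le_trans (norm_scale_delta i t0) _; apply: le_trans tle _; rewrite lerDr mulr_ge0.
  rewrite /K; congr (_ * _); rewrite (Gbase td tX2).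
  have -> : dseq (i :: beta) psi = dseq beta (fun x => 'D_e psi x).
    rewrite /dseq /=; apply: (@derive_rderives R V psi); by case: tp.
  rewrite (Gbase td tX1); congr (_ * _ * _).
  have := rint_rV_affine (0 + t *: e) ltr01 sg0 (rtest_lip_supp tX).
  rewrite invr1 expr1n mul1r => <-; congr rint_rV; apply/funext => x; by rewrite scale1r.
have [c _ E] := mean_value h0 dF.
have h0h : 0 <= (0 : R) <= h by rewrite lexx.
have hhh : 0 <= h <= h by rewrite h0 lexx.
have := Glin k.+1 tp (-1) (tYt h hhh) (tYt 0 h0h).
rewrite -/(F h) -/(F 0).
have -> : (fun x => -1 * Y (x - (0 + h *: e)) + Y (x - (0 + 0 *: e))) = (fun x => Y x - Y (x - h *: e)).
  by apply/funext => x; rewrite mulN1r scale0r addr0 subr0 add0r addrC.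
move=> ->; rewrite mulN1r exprSr mulrAC -/K.
by move: E; rewrite subr0 => E; have -> : - F h + F 0 = - (F h - F 0) by [rewrite opprB addrC]; rewrite E mulNr opprK.
Qed.

(* Differencing with step of order 1 / k turns k derivatives of psi into
   k differences of a fixed bump, at the cost k^k ~ e^k k!. *)
Lemma derivative_bounds_of_chain : exists C' A', [/\ 0 <= C', 0 <= A' & derivative_bounds rho N C' A' w].
Proof.
(* The k differences of step [sg / k.+1] enlarge the support of the bump by at most [sg], so
   everything stays within radius [rho / 2]. *)
pose sg := rho / 4.
have sg0 : 0 < sg by rewrite divr_gt0.
have sgi : 0 < sg^-1 by rewrite invr_gt0.
pose X0 : V -> R := fun x => spline_rV (sg^-1 *: (x - 0)).
have tX0 : rtest sg X0.
  have [s1 z1] := @rtest_spline_rV R m; split.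
    have am := @affine_map_scale_shift R V (sg^-1) (sg^-1 *: - 0).
    have := rsmooth_comp_affine am s1; rewrite (_ : (fun x => _) = X0) //.
    by apply/funext => x; rewrite /X0 scalerDr.
  move=> x xs; apply: z1; rewrite subr0 normrZ gtr0_norm //.
  by rewrite mulrC ltr_pdivlMr // mul1r.
pose I := rint_rV X0.
have I0 : 0 < I.
  have lipS := rtest_lip_supp (@rtest_spline_rV R m).
  rewrite /I /X0 (rint_rV_affine 0 sgi ler01 lipS) mulr_gt0 ?exprn_gt0 ?invr_gt0 //.
  exact: rint_spline_gt0.
have [B HB] := rtest_bound_rV N tX0; have B0 := bound_CN_ge0 HB.
pose D := `|c0| * I; have D0 : 0 < D by rewrite mulr_gt0 ?normr_gt0.
exists (C * B * expR 1 / D), (2 * A * sg^-1 * expR 1).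
split; first by rewrite !mulr_ge0 // invr_ge0 ltW.
  by rewrite !mulr_ge0 // ltW.
move=> beta psi Bp tp Hp; have Bp0 := bound_CN_ge0 Hp.
set k := size beta; pose h := sg / k.+1%:R.
have h0 : 0 < h by rewrite divr_gt0.
have kh : k%:R * h <= sg.
  rewrite /h mulrCA -[leRHS]mulr1 ler_wpM2l ?(ltW sg0) // ler_pdivrMr // mul1r ler_nat; exact: leqnSn.
have lt : sg + k%:R * h < rho.
  by apply: (@le_lt_trans _ _ (sg + sg)); [rewrite lerD2l|rewrite /sg; have := rho0; lra].
have E := finite_difference (ltW h0) tp tX0 (ltW sg0) lt.
have tdX : rtest rho (diffs h beta X0) := rtest_leW (ltW lt) (rtest_diffs beta (ltW h0) tX0).
have M := Gbnd k tp Hp tdX (bound_CN_diffs beta (ltW h0) tX0 HB).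
have td : rtest rho (dseq beta psi) by exact: rtest_derives.
have tX1 : rtest rho X0 by apply: rtest_leW tX0; rewrite /sg; have := rho0; lra.
move: M; rewrite -/k E -/k Gbase // -/I !normrM (gtr0_norm I0) -/D.
have hk : 0 < h ^+ k by rewrite exprn_gt0.
rewrite (gtr0_norm hk) => M.
have hki : (h ^+ k)^-1 = sg^-1 ^+ k * k.+1%:R ^+ k by rewrite /h exprMn invfM -!exprVn invrK.
have W : `|w (dseq beta psi)| <= C * A ^+ k * Bp * (2 ^+ k * B) * (h ^+ k)^-1 / D.
  rewrite ler_pdivlMr // ler_pdivlMr //; apply: le_trans M.
  by rewrite le_eqVlt; apply/orP; left; apply/eqP; ring.
apply: le_trans W _; rewrite hki.
have P := @pow_le_expR_fact R k.
have Q : 0 <= C * A ^+ k * Bp * (2 ^+ k * B) * sg^-1 ^+ k / D.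
  by rewrite !mulr_ge0 ?exprn_ge0 ?invr_ge0 // ltW.
have := ler_wpM2l Q P.
rewrite !exprMn; set ek := expR 1 ^+ k; set fk := k`!%:R; set kk := k.+1%:R ^+ k => H.
apply: le_trans (le_trans _ H) _; rewrite le_eqVlt; apply/orP; left; apply/eqP; ring.
Qed.

End FiniteDifferences.

(** * Real and imaginary parts of complex distributions *)

Local Open Scope complex_scope.

Section ComplexBridge.
Context {R : realType}.

(** A boolean index lets the real theory be applied to both parts by a single argument. *)
Definition part (re : bool) (z : R[i]) : R := if re then complex.Re z else complex.Im z.

Lemma part_add re (z w : R[i]) : part re (z + w) = part re z + part re w.
Proof. by case: re; case: z w => [a b] [c d]. Qed.

Lemma part_opp re (z : R[i]) : part re (- z) = - part re z.
Proof. by case: re; case: z => [a b]. Qed.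

Lemma part_real_mul re (a : R) (z : R[i]) : part re (a%:C * z) = a * part re z.
Proof. by case: re; case: z => [b c] /=; rewrite mul0r ?subr0 ?addr0. Qed.

Lemma part_eq (z w : R[i]) : (forall re, part re z = part re w) -> z = w.
Proof. by case: z w => [a b] [c d] H; have := H true; have := H false; rewrite /= => -> ->. Qed.

Lemma normc_le (z : R[i]) : Normc.normc z <= `|complex.Re z| + `|complex.Im z|.
Proof.
case: z => a b /=; rewrite -[leRHS]ger0_norm ?addr_ge0 // -sqrtr_sqr ler_sqrt ?sqr_ge0 //.
rewrite sqrrD !real_normK ?num_real // -addrA lerD2l lerDr.
by rewrite mulrn_wge0 // mulr_ge0.
Qed.

Lemma part_le_normc re (z : R[i]) : `|part re z| <= Normc.normc z.
Proof.
case: z => a b /=; case: re => /=; rewrite -sqrtr_sqr ler_sqrt ?addr_ge0 ?sqr_ge0 //.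
  by rewrite lerDl sqr_ge0.
by rewrite lerDr sqr_ge0.
Qed.

Section OnSpace.
Context {V : normedModType R}.
Implicit Types (phi : V -> R[i]) (psi : V -> R).

Lemma part_Cderives re vs phi :
  (fun x => part re (Cderives vs phi x)) = rderives vs (fun x => part re (phi x)).
Proof.
elim: vs => [//|v vs IH]; apply/funext => x.
rewrite -[RHS]/('D_v (rderives vs (fun x => part re (phi x))) x) -IH.
by case: re {IH}.
Qed.

Lemma smoothP phi : smooth phi <-> forall re, rsmooth (fun x => part re (phi x)).
Proof.
split=> [H re vs x|H vs x].
  rewrite -part_Cderives; have [H1 H2] := H vs x.
  by case: re.
have E1 := part_Cderives true vs phi; have E2 := part_Cderives false vs phi.
have H1 := H true vs x; have H2 := H false vs x.
by rewrite -E1 in H1; rewrite -E2 in H2; split.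
Qed.

Lemma CN_norm_le_parts N phi B1 B2 : bound_CN N (fun x => part true (phi x)) B1 ->
  bound_CN N (fun x => part false (phi x)) B2 -> CN_norm_le N phi (B1 + B2).
Proof.
move=> H1 H2 vs sz v1 x; apply: le_trans (normc_le _) _.
have := H1 x vs sz v1; have := H2 x vs sz v1; rewrite expr1n !mulr1 -!part_Cderives /= => H H'.
exact: lerD.
Qed.

Definition cx psi : V -> R[i] := fun x => (psi x)%:C.

Lemma test_fun_ball (Om : set V) (rho : R) phi : compact [set x : V | `|x| <= rho] ->
  [set x : V | `|x| <= rho] `<=` Om -> (forall re, rtest rho (fun x => part re (phi x))) ->
  test_fun_in [set x : V | `|x| <= rho] phi /\ test_fun Om phi.
Proof.
move=> cK sK tp.
have T : test_fun_in [set x : V | `|x| <= rho] phi.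
  split; first by apply/smoothP => re; case: (tp re).
  move=> x /= /negP; rewrite -ltNge => xr; apply: part_eq => re.
  by have [_ ->] := tp re; rewrite //; case: re.
by split => //; exists [set x : V | `|x| <= rho].
Qed.

End OnSpace.
End ComplexBridge.

Lemma rint0 {R : realType} : rint (fun _ : R => 0) = 0 :> R.
Proof. by rewrite /rint Rintegral_cst // mul0r. Qed.

Lemma rtest_plane_slices {R : realType} (L : R) (a : R * R -> R) : 0 <= L -> rtest L a ->
  (forall x, lip_supp L (fun y => a (x, y))) /\ lip_supp L (fun x => rint (fun y => a (x, y))).
Proof.
move=> L0 ta; have [sa za] := ta.
have [B HB] := rtest_bound_plane 1 ta; have B0 := bound_CN_ge0 HB.
have lip := bound_CN_lipschitz sa HB.
have sl x : lip_supp L (fun y => a (x, y)).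
  split; last by move=> y yL; apply: za; rewrite prod_normE /= lt_max yL orbT.
  exists B => // y y'; apply: le_trans (lip _ _) _.
  by rewrite prod_normE /= subrr normr0 max_r.
split=> //; split; last first.
  move=> x xL; rewrite (_ : (fun y => _) = (fun=> 0)) ?rint0 //.
  by apply/funext => y; apply: za; rewrite prod_normE /= lt_max xL.
have cl x : continuous (fun y => a (x, y)) by apply: lipschitz_continuous; case: (sl x).
exists (2 * L * B); first by rewrite mulr_ge0 // mulr_ge0.
move=> x x'; have [_ s1] := sl x; have [_ s2] := sl x'.
rewrite addrC -mulN1r -(rint_lin (-1) (cl x') (cl x) s2 s1) -mulrA.
have [l3 s3] := lip_supp_lin (-1) (sl x') (sl x).
apply: (rint_bound L0 (lipschitz_continuous l3) s3) => y.
rewrite mulN1r addrC; apply: le_trans (lip _ _) _.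
by rewrite prod_normE /= subrr normr0 max_l.
Qed.

Lemma rint_scale {R : realType} (L c : R) (f : R -> R) : lip_supp L f ->
  rint (fun x => f x * c) = rint f * c.
Proof.
move=> [lf sf]; have [l0 s0] := @lip_supp0 R R L.
have := rint_lin c (lipschitz_continuous lf) (lipschitz_continuous l0) sf s0.
rewrite rint0 addr0 mulrC => <-; congr rint; apply/funext => x; by rewrite addr0 mulrC.
Qed.

Lemma rint_plane_scale {R : realType} (L c : R) (a : R * R -> R) : 0 <= L -> rtest L a ->
  rint (fun x => rint (fun y => a (x, y) * c)) = rint (fun x => rint (fun y => a (x, y))) * c.
Proof.
move=> L0 ta; have [sl li] := rtest_plane_slices L0 ta.
rewrite -(rint_scale _ li); congr rint; apply/funext => x; exact: rint_scale (sl x).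
Qed.

(** * The weights kappa(z) / z^k *)

Section AnnularWeights.
Context {R : realType}.
Variables (eps : R) (eps0 : 0 < eps).
Local Notation P := (R * R)%type.
Implicit Types z : P.

Definition sqmod z : R := (z.1 ^+ 2 + z.2 ^+ 2) / eps ^+ 2.

Lemma rsmooth_fst : rsmooth (fun z : P => z.1).
Proof. exact: (rsmooth_comp_affine (@affine_map_fst R R R) rsmooth_id). Qed.

Lemma rsmooth_snd : rsmooth (fun z : P => z.2).
Proof. exact: (rsmooth_comp_affine (@affine_map_snd R R R) rsmooth_id). Qed.

Lemma rsmooth_sqmod : rsmooth sqmod.
Proof.
apply: rsmooth_mul; last exact: rsmooth_cst.
by apply: rsmooth_add; under eq_fun do rewrite expr2; apply: rsmooth_mul;
  [exact: rsmooth_fst|exact: rsmooth_fst|exact: rsmooth_snd|exact: rsmooth_snd].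
Qed.

Lemma sqmod_ge0 z : 0 <= sqmod z.
Proof. by rewrite divr_ge0 ?addr_ge0 ?sqr_ge0. Qed.

Lemma sqmod_gt z : 2 * eps < `|z| -> 3 < sqmod z.
Proof.
move=> H; rewrite ltr_pdivlMr ?exprn_gt0 //.
have e2 : 0 < eps ^+ 2 by rewrite exprn_gt0.
have K (a : R) : 2 * eps < `|a| -> 3 * eps ^+ 2 < a ^+ 2.
  move=> ha; rewrite -(real_normK (num_real a)).
  have h1 : 0 < `|a| - 2 * eps by rewrite subr_gt0.
  have h2 : 0 < `|a| + 2 * eps by rewrite ltr_wpDl // mulr_gt0.
  by have := mulr_gt0 h1 h2; lra.
move: H; rewrite prod_normE /= lt_max => /orP[] /K.
  by have := sqr_ge0 z.2; lra.
by have := sqr_ge0 z.1; lra.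
Qed.

Definition cutoff z : R := step (2 - sqmod z).

Definition step' (y : R) : R := 'D_1 (@step R) y.

Lemma rsmooth_step' : rsmooth step'.
Proof. exact: rsmooth_derive (@rsmooth_step R). Qed.

Lemma step'_outside (y : R) : y < 0 \/ 1 < y -> step' y = 0.
Proof.
case=> H.
  rewrite /step' (@near_eq_derive _ _ _ _ (cst (0 : R))) ?derive_cst //.
  near=> t; rewrite step_le0 //; apply: ltW; near: t; exact: lt_nbhsl.
rewrite /step' (@near_eq_derive _ _ _ _ (cst (1 : R))) ?derive_cst //.
near=> t; rewrite step_ge1 //; apply: ltW; near: t; exact: lt_nbhsr.
Unshelve. all: by end_near. Qed.

Lemma is_derive_step (y : R) : is_derive y (1 : R) (@step R) (step' y).
Proof.
apply: derivableP; apply: diff_derivable; apply: rsmooth_differentiable; exact: rsmooth_step.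
Qed.

Lemma step'_ge0 (y : R) : 0 <= step' y.
Proof.
have [+ _] := is_derive_step y; rewrite /derivable => cv.
rewrite /step' /derive; apply: limr_ge => //.
near=> h; rewrite /= [h%:A]mulr1 /GRing.scale /=.
have [hp|] := boolP (0 < h).
  by rewrite mulr_ge0 ?invr_ge0 ?(ltW hp) // subr_ge0 step_nondecreasing // lerDr ltW.
rewrite -leNgt => hn; rewrite mulr_le0 ?invr_le0 // subr_le0 step_nondecreasing //.
by rewrite gerDr.
Unshelve. all: by end_near. Qed.

Lemma step'_pos : exists2 c : R, 0 <= c <= 1 & step' c = 1.
Proof.
have [c c01] := @mean_value R (@step R) step' 0 1 ler01 (fun x _ => is_derive_step x).
by rewrite step_ge1 // step_le0 // !subr0 mulr1 => E; exists c.
Qed.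

(** The derivative of the profile of [cutoff], so that the d-bar derivative of [cutoff] is exactly -
    (z / eps^2) kappa(z). It vanishes unless eps^2 <= |z|^2 <= 2 eps^2. *)
Definition kappa z : R := step' (2 - sqmod z).

Lemma kappa_ge0 z : 0 <= kappa z. Proof. exact: step'_ge0. Qed.

Lemma kappa_support z : kappa z != 0 -> 1 <= sqmod z <= 2.
Proof.
move=> k0; apply: contraT; rewrite negb_and -!ltNge => H; case/negP: k0; apply/eqP.
by apply: step'_outside; case/orP: H => H; [right|left]; lra.
Qed.

(** The numerator is 1 for [sqmod z <= 2] and cuts off at 3; the [flat] term vanishes for
    [sqmod z >= 1] and keeps the denominator positive at the origin. *)
Definition inv_coef z : R := step (3 - sqmod z) / (eps ^+ 2 * (sqmod z + flat 0 (1 - sqmod z))).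

Lemma inv_denom z : 0 < eps ^+ 2 * (sqmod z + flat 0 (1 - sqmod z)).
Proof.
rewrite mulr_gt0 ?exprn_gt0 //; have := sqmod_ge0 z; rewrite le_eqVlt => /orP[/eqP <-|H].
  by rewrite add0r subr0 flat_gt0.
by rewrite ltr_pwDl // flat_ge0.
Qed.

Lemma rsmooth_sqmod_comp (g : R -> R) (a : R) : rsmooth g -> rsmooth (fun z => g (a - sqmod z)).
Proof.
move=> sg; apply: rsmooth_comp => //; apply: rsmooth_sub; [exact: rsmooth_cst|exact: rsmooth_sqmod].
Qed.

Lemma rsmooth_inv_coef : rsmooth inv_coef.
Proof.
apply: rsmooth_mul; first exact: rsmooth_sqmod_comp (@rsmooth_step R).
apply: rsmooth_inv; first by move=> z; rewrite gt_eqF // inv_denom.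
apply: rsmooth_scale; apply: rsmooth_add; first exact: rsmooth_sqmod.
exact: rsmooth_sqmod_comp (@rsmooth_flat R).
Qed.

Lemma rtest_inv_coef : rtest (2 * eps) inv_coef.
Proof.
split; first exact: rsmooth_inv_coef.
by move=> z /sqmod_gt H; rewrite /inv_coef step_le0 ?mul0r //; lra.
Qed.

Lemma rtest_kappa : rtest (2 * eps) kappa.
Proof.
split; first exact: rsmooth_sqmod_comp rsmooth_step'.
by move=> z /sqmod_gt H; apply: step'_outside; left; lra.
Qed.

Lemma rtest_cutoff : rtest (2 * eps) cutoff.
Proof.
split; first exact: rsmooth_sqmod_comp (@rsmooth_step R).
by move=> z /sqmod_gt H; apply: step_le0; lra.
Qed.

(* kappa(z) / z^k as a pair (real part, imaginary part); inv_coef is |z|^-2 on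
   the support of kappa. *)
Fixpoint omega k : (P -> R) * (P -> R) :=
  match k with
  | 0 => (kappa, fun=> 0)
  | k.+1 => let w := omega k in
     (fun z => inv_coef z * (z.1 * w.1 z + z.2 * w.2 z),
      fun z => inv_coef z * (z.1 * w.2 z - z.2 * w.1 z))
  end.

Lemma rtest_omega k : rtest (2 * eps) (omega k).1 /\ rtest (2 * eps) (omega k).2.
Proof.
elim: k => [|k [[s1 z1] [s2 z2]]] /=; first by split; [exact: rtest_kappa|exact: rtest0].
have sx := rsmooth_fst; have sy := rsmooth_snd; have si := rsmooth_inv_coef.
split; split.
- by apply: rsmooth_mul => //; apply: rsmooth_add; exact: rsmooth_mul.
- by move=> z zr; rewrite z1 // z2 // !mulr0 addr0 mulr0.
- by apply: rsmooth_mul => //; apply: rsmooth_sub; exact: rsmooth_mul.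
- by move=> z zr; rewrite z1 // z2 // !mulr0 subr0 mulr0.
Qed.

Lemma omega_support k z : kappa z = 0 -> (omega k).1 z = 0 /\ (omega k).2 z = 0.
Proof.
move=> k0; elim: k => [//|k [H1 H2]] /=.
by rewrite H1 H2 !mulr0 addr0 subr0 mulr0.
Qed.

Lemma inv_coefE z : kappa z != 0 -> inv_coef z * (z.1 ^+ 2 + z.2 ^+ 2) = 1.
Proof.
move=> /kappa_support /andP[t1 t2].
have -> : z.1 ^+ 2 + z.2 ^+ 2 = eps ^+ 2 * sqmod z.
  by rewrite /sqmod mulrC divfK // expf_neq0 // gt_eqF.
rewrite /inv_coef step_ge1; last by lra.
rewrite flat_le0 ?addr0; last by lra.
by rewrite mul1r mulVf // mulf_neq0 ?expf_neq0 ?gt_eqF //; lra.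
Qed.

Lemma omega_succ k z :
  z.1 * (omega k.+1).1 z - z.2 * (omega k.+1).2 z = (omega k).1 z /\
  z.1 * (omega k.+1).2 z + z.2 * (omega k.+1).1 z = (omega k).2 z.
Proof.
have [k0|kn] := eqVneq (kappa z) 0.
  have [-> ->] := omega_support k.+1 k0; have [-> ->] := omega_support k k0.
  by rewrite !mulr0 subr0 addr0.
have E := inv_coefE kn; rewrite /=.
set a := (omega k).1 z; set b := (omega k).2 z; set q := inv_coef z in E *.
split.
  have -> : z.1 * (q * (z.1 * a + z.2 * b)) - z.2 * (q * (z.1 * b - z.2 * a)) =
    q * (z.1 ^+ 2 + z.2 ^+ 2) * a by ring.
  by rewrite E mul1r.
have -> : z.1 * (q * (z.1 * b - z.2 * a)) + z.2 * (q * (z.1 * a + z.2 * b)) =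
    q * (z.1 ^+ 2 + z.2 ^+ 2) * b by ring.
by rewrite E mul1r.
Qed.

(** Each division by z multiplies by functions of weight 1, so [omega k] has weight k + 1 with a
    geometric constant. Returning to weight 1 costs (k + 1)^N, at most 2^(N k): polynomial in k
    because N is fixed. *)
Lemma omega_bound N : exists C A : R, [/\ 0 <= C, 0 <= A & forall k,
  bound_CN N (omega k).1 (C * A ^+ k) /\ bound_CN N (omega k).2 (C * A ^+ k)].
Proof.
have [sx sy] := (rsmooth_fst, rsmooth_snd).
have tx : rtest (2 * eps) (fun z => inv_coef z * z.1).
  have := rtest_mull sx rtest_inv_coef; by under eq_fun do rewrite mulrC.
have ty : rtest (2 * eps) (fun z => inv_coef z * z.2).
  have := rtest_mull sy rtest_inv_coef; by under eq_fun do rewrite mulrC.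
have [Bx Hx] := rtest_bound_plane N tx; have [By Hy] := rtest_bound_plane N ty.
have [Bk Hk] := rtest_bound_plane N rtest_kappa.
have Bx0 := bound_CN_ge0 Hx; have By0 := bound_CN_ge0 Hy; have Bk0 := bound_CN_ge0 Hk.
pose Bp := Bx + By; have Bp0 : 0 <= Bp by rewrite addr_ge0.
have W k z : wbound N k.+1%:R (Bk * Bp ^+ k) (omega k).1 z /\ wbound N k.+1%:R (Bk * Bp ^+ k) (omega k).2 z.
  elim: k => [|k [H1 H2]].
    rewrite expr0 mulr1; split; first exact: Hk.
    move=> vs sz v1; apply: le_trans (@wbound_cst R _ N 1 0 z ler01 vs sz v1) _.
    by rewrite normr0 mul0r mulr_ge0 // exprn_ge0.
  have [[s1 _] [s2 _]] := rtest_omega k.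
  have [sxi _] := tx; have [syi _] := ty.
  have k0 : 0 <= k.+1%:R :> R by [].
  have nE : 1 + k.+1%:R = k.+2%:R :> R by rewrite -[RHS]natr1 addrC.
  have M1 := wbound_mul ler01 k0 sxi s1 (Hx z) H1.
  have M2 := wbound_mul ler01 k0 syi s2 (Hy z) H2.
  have M3 := wbound_mul ler01 k0 sxi s2 (Hx z) H2.
  have M4 := wbound_mul ler01 k0 syi s1 (Hy z) H1.
  rewrite nE in M1 M2 M3 M4.
  have -> : Bk * Bp ^+ k.+1 = Bx * (Bk * Bp ^+ k) + By * (Bk * Bp ^+ k) by rewrite exprS /Bp; ring.
  split.
    have -> : (omega k.+1).1 = (fun z => inv_coef z * z.1 * (omega k).1 z + inv_coef z * z.2 * (omega k).2 z).
      by apply/funext => t /=; ring.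
    by apply: wbound_add => //; exact: rsmooth_mul.
  have -> : (omega k.+1).2 = (fun z => inv_coef z * z.1 * (omega k).2 z - inv_coef z * z.2 * (omega k).1 z).
    by apply/funext => t /=; ring.
  by apply: wbound_sub => //; exact: rsmooth_mul.
have k2 k : k.+1%:R ^+ N <= (2 ^+ N) ^+ k :> R.
  rewrite exprAC lerXn2r ?nnegrE ?exprn_ge0 // -natrX ler_nat.
  by elim: k => // k IH; rewrite expnS mul2n -addnn -addn1; apply: leq_add; rewrite // expn_gt0.
exists Bk, (2 ^+ N * Bp); split => //; first by rewrite mulr_ge0 // exprn_ge0.
move=> k; have Q (f : P -> R) : (forall z, wbound N k.+1%:R (Bk * Bp ^+ k) f z) ->
    bound_CN N f (Bk * (2 ^+ N * Bp) ^+ k).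
  move=> Hf z; have k1 : 1 <= k.+1%:R :> R by rewrite ler1n.
  move=> vs sz v1; apply: le_trans (wbound_weight1 k1 (Hf z) sz v1) _.
  rewrite expr1n !mulr1.
  rewrite -mulrA ler_wpM2l // exprMn mulrC ler_wpM2r ?exprn_ge0 //; exact: k2.
by split; apply: Q => z; case: (W k z).
Qed.

Lemma derive_sqmod (v z : P) :
  'D_v (fun z => 2 - sqmod z) z = - (2 / eps ^+ 2) * (z.1 * v.1 + z.2 * v.2).
Proof.
have e : (fun z => 2 - sqmod z) = (fun z => 2 - eps ^- 2 * (z.1 * z.1 + z.2 * z.2)).
  by apply/funext => w; rewrite /sqmod mulrC !expr2.
have sx := rsmooth_fst; have sy := rsmooth_snd.
have sxx : rsmooth (fun z : P => z.1 * z.1) by exact: rsmooth_mul.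
have syy : rsmooth (fun z : P => z.2 * z.2) by exact: rsmooth_mul.
have sxy : rsmooth (fun z : P => z.1 * z.1 + z.2 * z.2) by exact: rsmooth_add.
rewrite e.
have := rderives_sub [:: v] (@rsmooth_cst R P 2) (rsmooth_scale (eps ^- 2) sxy).
move=> /(congr1 (fun f => f z)) /= ->.
have -> : 'D_v (fun _ : P => 2 : R) z = 0 by exact: derive_cst.
have := rderives_scale (eps ^- 2) [:: v] sxy => /(congr1 (fun f => f z)) /= ->.
have := rderives_add [:: v] sxx syy => /(congr1 (fun f => f z)) /= ->.
have := derive_mul v sx sx => /(congr1 (fun f => f z)) /= ->.
have := derive_mul v sy sy => /(congr1 (fun f => f z)) /= ->.
rewrite (affine_map_derive z v (@affine_map_fst R R R)) (affine_map_derive z v (@affine_map_snd R R R)).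
by ring.
Qed.

Lemma derive_cutoff (v z : P) :
  'D_v cutoff z = - (2 / eps ^+ 2) * (z.1 * v.1 + z.2 * v.2) * kappa z.
Proof.
have s2 : rsmooth (fun z => 2 - sqmod z) by apply: rsmooth_sub; [exact: rsmooth_cst|exact: rsmooth_sqmod].
have := derive_comp1 v (@rsmooth_step R) (rsmooth_differentiable z s2).
by rewrite derive_sqmod.
Qed.

Lemma kappa_integral_pos : 0 < rint (fun x => rint (fun y => kappa (x, y))).
Proof.
have L0 : 0 <= 2 * eps by rewrite mulr_ge0 // ltW.
have [sl [li si]] := rtest_plane_slices L0 rtest_kappa.
have [c /andP[c0 c1] kc] := step'_pos.
(* At the point with this first coordinate and second coordinate 0, [sqmod] equals [2 - c], so
   [kappa] takes the value [step' c = 1]. *)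
apply: (@rint_gt0 R _ (2 * eps) (eps * Num.sqrt (2 - c)) (lipschitz_continuous li) si).
  by move=> x; apply: rint_ge0 => y; exact: kappa_ge0.
have [ly sy] := sl (eps * Num.sqrt (2 - c)).
apply: (@rint_gt0 R _ (2 * eps) 0 (lipschitz_continuous ly) sy); first by move=> y; exact: kappa_ge0.
rewrite /kappa /sqmod /= expr0n /= addr0 exprMn sqr_sqrtr; last by lra.
rewrite mulrAC divff ?expf_neq0 ?gt_eqF // mul1r.
have -> : 2 - (2 - c) = c by ring.
by rewrite kc.
Qed.

End AnnularWeights.

Lemma part_Cintegral {R : realType} re (F : R -> R[i]) :
  part re (Cintegral F) = rint (fun x => part re (F x)).
Proof. by case: re. Qed.

Lemma part_Cintegral_rV {R : realType} re m (F : 'rV[R]_m -> R[i]) :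
  part re (Cintegral_rV F) = rint_rV (fun x => part re (F x)).
Proof.
elim: m F => [//|k IH] F; rewrite /= part_Cintegral; congr rint; apply/funext => x.
exact: IH.
Qed.

(** * Product test functions in (z, s, t) *)

Section Tensor.
Context {R : realType} {m : nat}.
Local Notation V := 'rV[R]_m.
Local Notation P := (R * R)%type.
Local Notation E := (zst_space R m).
Implicit Types (a b : P -> R) (psi X : V -> R) (p : E) (e : V).

Definition rtens a psi X : E -> R := fun p => a p.1.1 * (psi p.1.2 * X p.2).

Definition tens a b psi X : E -> R[i] := fun p => rtens a psi X p +i* rtens b psi X p.

Lemma part_tens re a b psi X :
  (fun p => part re (tens a b psi X p)) = rtens (if re then a else b) psi X.
Proof. by case: re. Qed.

Lemma affine_proj_z : affine_map (fun p : E => p.1.1) (fun p : E => p.1.1) 1.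
Proof.
have := affine_map_comp ler01 (@affine_map_fst R (P * V)%type V) (@affine_map_fst R P V).
by rewrite mulr1.
Qed.

Lemma affine_proj_s : affine_map (fun p : E => p.1.2) (fun p : E => p.1.2) 1.
Proof.
have := affine_map_comp ler01 (@affine_map_fst R (P * V)%type V) (@affine_map_snd R P V).
by rewrite mulr1.
Qed.

Lemma affine_proj_t : affine_map (fun p : E => p.2) (fun p : E => p.2) 1.
Proof. exact: (@affine_map_snd R (P * V)%type V). Qed.

Lemma rsmooth_rtens a psi X : rsmooth a -> rsmooth psi -> rsmooth X -> rsmooth (rtens a psi X).
Proof.
move=> sa sp sX; apply: rsmooth_mul; first exact: (rsmooth_comp_affine affine_proj_z sa).
by apply: rsmooth_mul; [exact: (rsmooth_comp_affine affine_proj_s sp)|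
                        exact: (rsmooth_comp_affine affine_proj_t sX)].
Qed.

Lemma E_normE p : `|p| = Num.max (Num.max `|p.1.1| `|p.1.2|) `|p.2|.
Proof. by rewrite [LHS]prod_normE [`|p.1|]prod_normE. Qed.

Lemma rtest_rtens r a psi X : rtest r a -> rtest r psi -> rtest r X -> rtest r (rtens a psi X).
Proof.
move=> [sa za] [sp zp] [sX zX]; split; first exact: rsmooth_rtens.
move=> p; rewrite E_normE 2!lt_max /rtens => /orP[/orP[]|] h.
- by rewrite (za _ h) mul0r.
- by rewrite (zp _ h) mul0r mulr0.
- by rewrite (zX _ h) !mulr0.
Qed.

Lemma compact_ball_E (r : R) : compact [set p : E | `|p| <= r].
Proof.
have -> : [set p : E | `|p| <= r] =
  ([set z : P | `|z| <= r] `*` [set x : V | `|x| <= r]) `*` [set x : V | `|x| <= r].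
  apply/seteqP; split=> -[[z s] t] /=; rewrite E_normE /= !ge_max.
    by move=> /andP[/andP[]].
  by move=> [[-> ->] ->].
apply: compact_setX; last exact: compact_norm_le_rV.
by apply: compact_setX; [exact: compact_norm_le_plane|exact: compact_norm_le_rV].
Qed.

Lemma derive_rtens a psi X (v p : E) : rsmooth a -> rsmooth psi -> rsmooth X ->
  'D_v (rtens a psi X) p = 'D_(v.1.1) a p.1.1 * (psi p.1.2 * X p.2) +
    a p.1.1 * ('D_(v.1.2) psi p.1.2 * X p.2 + psi p.1.2 * 'D_(v.2) X p.2).
Proof.
move=> sa sp sX.
have s1 := rsmooth_comp_affine affine_proj_z sa.
have s2 := rsmooth_comp_affine affine_proj_s sp.
have s3 := rsmooth_comp_affine affine_proj_t sX.
have := derive_mul v s1 (rsmooth_mul s2 s3) => /(congr1 (fun f => f p)) /= ->.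
have := derive_mul v s2 s3 => /(congr1 (fun f => f p)) /= ->.
have := rderives_comp_affine [:: v] affine_proj_z sa => /(congr1 (fun f => f p)) /= ->.
have := rderives_comp_affine [:: v] affine_proj_s sp => /(congr1 (fun f => f p)) /= ->.
by have := rderives_comp_affine [:: v] affine_proj_t sX => /(congr1 (fun f => f p)) /= ->.
Qed.

Lemma derive_rtens_t e a psi X : rsmooth a -> rsmooth psi -> rsmooth X ->
  (fun p => 'D_(zst 0 0 0 e) (rtens a psi X) p) = rtens a psi (fun t => 'D_e X t).
Proof.
move=> sa sp sX; apply/funext => p; rewrite derive_rtens //= /rtens.
have -> : 'D_(0, 0) a p.1.1 = 0 by exact: derive0.
by rewrite derive0 !mul0r !add0r.
Qed.

Lemma derive_rtens_s e a psi X : rsmooth a -> rsmooth psi -> rsmooth X ->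
  (fun p => 'D_(zst 0 0 e 0) (rtens a psi X) p) = rtens a (fun s => 'D_e psi s) X.
Proof.
move=> sa sp sX; apply/funext => p; rewrite derive_rtens //= /rtens.
have -> : 'D_(0, 0) a p.1.1 = 0 by exact: derive0.
by rewrite derive0 !mul0r mulr0 addr0 add0r.
Qed.

Lemma derive_rtens_z (x y : R) a psi X : rsmooth a -> rsmooth psi -> rsmooth X ->
  (fun p => 'D_(zst x y 0 0) (rtens a psi X) p) = rtens (fun z => 'D_(x, y) a z) psi X.
Proof.
move=> sa sp sX; apply/funext => p; rewrite derive_rtens //= /rtens.
by rewrite !derive0 !mul0r mulr0 addr0 mulr0 addr0.
Qed.

Lemma Cderive_tens (v : E) a b psi X : Cderive v (tens a b psi X) =
  (fun p => 'D_v (rtens a psi X) p +i* 'D_v (rtens b psi X) p).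
Proof. by []. Qed.

(** Three factors of weight 1 make a product of weight 3. *)
Lemma bound_CN_rtens N a psi X Ba Bp BX : rsmooth a -> rsmooth psi -> rsmooth X ->
  bound_CN N a Ba -> bound_CN N psi Bp -> bound_CN N X BX ->
  bound_CN N (rtens a psi X) (3 ^+ N * Ba * Bp * BX).
Proof.
move=> sa sp sX Ha Hp HX p.
have s1 := rsmooth_comp_affine affine_proj_z sa.
have s2 := rsmooth_comp_affine affine_proj_s sp.
have s3 := rsmooth_comp_affine affine_proj_t sX.
have W1 := wbound_comp_affine ltr01 affine_proj_z sa (Ha p.1.1).
have W2 := wbound_comp_affine ltr01 affine_proj_s sp (Hp p.1.2).
have W3 := wbound_comp_affine ltr01 affine_proj_t sX (HX p.2).
rewrite mulr1 in W1 W2 W3.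
have W23 := wbound_mul ler01 ler01 s2 s3 W2 W3.
have W := wbound_mul ler01 (addr_ge0 ler01 ler01) s1 (rsmooth_mul s2 s3) W1 W23.
have e3 : 1 + (1 + 1) = 3 :> R by ring.
rewrite e3 in W; have h3 : 1 <= 3 :> R by rewrite ler1n.
move=> vs sz v1; apply: le_trans (wbound_weight1 h3 W sz v1) _.
by rewrite le_eqVlt; apply/orP; left; apply/eqP; ring.
Qed.

Lemma CN_norm_le_tens N a b psi X Ba Bb Bp BX : rsmooth a -> rsmooth b -> rsmooth psi -> rsmooth X ->
  bound_CN N a Ba -> bound_CN N b Bb -> bound_CN N psi Bp -> bound_CN N X BX ->
  CN_norm_le N (tens a b psi X) (3 ^+ N * (Ba + Bb) * Bp * BX).
Proof.
move=> sa sb sp sX Ha Hb Hp HX.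
have -> : 3 ^+ N * (Ba + Bb) * Bp * BX = 3 ^+ N * Ba * Bp * BX + 3 ^+ N * Bb * Bp * BX by ring.
by apply: CN_norm_le_parts; rewrite part_tens; exact: bound_CN_rtens.
Qed.

End Tensor.

(** * The chain of equations satisfied by f *)

Section Chain.
Context {R : realType} {m : nat}.
Local Notation V := 'rV[R]_m.
Local Notation P := (R * R)%type.
Local Notation E := (zst_space R m).
Variables (U : set V) (v : 'I_m -> (V -> R[i]) -> R[i]).
Variables (Om : set E) (f : (E -> R[i]) -> R[i]) (rho : R).
Hypotheses (rho0 : 0 < rho) (ballOm : [set p : E | `|p| <= rho] `<=` Om)
  (ballU : [set x : V | `|x| <= rho] `<=` U).
Hypothesis (hv : forall j, is_distribution U (v j)).
Hypothesis (hf : is_distribution Om f).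
Hypothesis (hz : dist_eq Om (dist_dzbar f) dist_zero).
Hypothesis (ht : forall j, dist_eq Om (dist_sub (dist_dt j f) (dist_mul z_coord (dist_ds j f)))
                (dist_pullback_s (v j))).
Implicit Types (a b : P -> R) (psi X : V -> R).

Lemma test_tens a b psi X : rtest rho a -> rtest rho b -> rtest rho psi -> rtest rho X ->
  test_fun_in [set p : E | `|p| <= rho] (tens a b psi X) /\ test_fun Om (tens a b psi X).
Proof.
move=> ta tb tp tX; apply: (test_fun_ball (@compact_ball_E R m rho) ballOm) => re.
by rewrite part_tens; apply: rtest_rtens => //; case: re.
Qed.

Lemma test_cx psi : rtest rho psi -> test_fun U (cx psi).
Proof.
move=> tp; apply: (proj2 (test_fun_ball (@compact_norm_le_rV R m rho) ballU _)) => -[] //=.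
exact: rtest0.
Qed.

Lemma v_scale j (c : R) psi : rtest rho psi -> v j (cx (fun x => c * psi x)) = c%:C * v j (cx psi).
Proof.
move=> tp; have [lin _] := hv j.
have t0 := test_cx (@rtest0 _ _ rho).
have E0 : v j (cx (fun=> 0)) = 0.
  have := lin 1 _ _ t0 t0.
  rewrite (_ : (fun x => 1 * cx (fun=> 0) x + cx (fun=> 0) x) = cx (fun=> 0)).
    by rewrite mul1r => /eqP; rewrite -subr_eq0 opprD addNKr oppr_eq0 => /eqP.
  by apply/funext => x; rewrite mul1r addr0.
have := lin c%:C _ _ (test_cx tp) t0; rewrite E0 addr0 => <-.
by congr (v j _); apply/funext => x; rewrite /cx /= addr0 rmorphM.
Qed.

Lemma f_lin (c : R[i]) (a1 b1 a2 b2 : P -> R) (psi1 X1 psi2 X2 : V -> R) :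
  rtest rho a1 -> rtest rho b1 -> rtest rho psi1 -> rtest rho X1 ->
  rtest rho a2 -> rtest rho b2 -> rtest rho psi2 -> rtest rho X2 ->
  f (fun p => c * tens a1 b1 psi1 X1 p + tens a2 b2 psi2 X2 p) =
  c * f (tens a1 b1 psi1 X1) + f (tens a2 b2 psi2 X2).
Proof. by move=> *; have [lin _] := hf; apply: lin; apply: (proj2 (test_tens _ _ _ _)). Qed.

Lemma f_tens0 (X0 : V -> R) (psi : V -> R) : f (tens (fun=> 0) (fun=> 0) psi X0) = 0.
Proof.
have t0 := @rtest0 R P rho; have t0' := @rtest0 R V rho.
have e psi' X' : tens (fun=> 0) (fun=> 0) psi' X' = (fun=> 0) :> (E -> R[i]).
  by apply/funext => p; rewrite /tens /rtens mul0r.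
have := f_lin 1 t0 t0 t0' t0' t0 t0 t0' t0'; rewrite !e.
rewrite (_ : (fun p => 1 * 0 + 0) = (fun=> 0)); last by apply/funext => p; rewrite mul1r addr0.
by rewrite mul1r => /eqP; rewrite -subr_eq0 opprD addNKr oppr_eq0 => /eqP.
Qed.

Definition zre a b : P -> R := fun z => z.1 * a z - z.2 * b z.
Definition zim a b : P -> R := fun z => z.1 * b z + z.2 * a z.

Lemma pullback_tens a b psi X (s : V) : lip_supp rho X ->
  Cintegral (fun x => Cintegral (fun y => Cintegral_rV (fun t => tens a b psi X (zst x y s t)))) =
  rint (fun x => rint (fun y => a (x, y) * psi s * rint_rV X)) +i*
  rint (fun x => rint (fun y => b (x, y) * psi s * rint_rV X)).
Proof.
move=> lX; apply: part_eq => re; rewrite part_Cintegral.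
have -> : (fun x => part re (Cintegral (fun y => Cintegral_rV (fun t => tens a b psi X (zst x y s t))))) =
   (fun x => rint (fun y => (if re then a else b) (x, y) * psi s * rint_rV X)).
  apply/funext => x; rewrite part_Cintegral; congr rint; apply/funext => y.
  rewrite part_Cintegral_rV -(rint_rV_scale _ (ltW rho0) lX); congr rint_rV.
  by apply/funext => t; rewrite -mulrA; case: re.
by case: re.
Qed.

(** The j-th equation tested on a product: transposition changes the sign of both derivatives, the
    factor z moves onto the z-component, and the fibre integral separates. *)
Lemma equation_tens j a b psi X : rtest rho a -> rtest rho b -> rtest rho psi -> rtest rho X ->
  f (tens (zre a b) (zim a b) (fun s => 'D_(delta_mx 0 j) psi s) X) -
  f (tens a b psi (fun t => 'D_(delta_mx 0 j) X t)) =
  v j (fun s => rint (fun x => rint (fun y => a (x, y) * psi s * rint_rV X)) +i*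
                rint (fun x => rint (fun y => b (x, y) * psi s * rint_rV X))).
Proof.
move=> ta tb tp tX.
have [sa _] := ta; have [sb _] := tb; have [sp _] := tp; have [sX _] := tX.
have := ht j (proj2 (test_tens ta tb tp tX)).
rewrite /dist_sub /dist_dt /dist_mul /dist_ds /dist_derive /dist_pullback_s opprK.
have szr : rsmooth (zre a b).
  by apply: rsmooth_sub; apply: rsmooth_mul => //; [exact: rsmooth_fst|exact: rsmooth_snd].
have szi : rsmooth (zim a b).
  by apply: rsmooth_add; apply: rsmooth_mul => //; [exact: rsmooth_fst|exact: rsmooth_snd].
have -> : Cderive (zst 0 0 0 (delta_mx 0 j)) (tens a b psi X) =
   tens a b psi (fun t => 'D_(delta_mx 0 j) X t).
  rewrite Cderive_tens; apply/funext => p.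
  have := derive_rtens_t (delta_mx 0 j) sa sp sX => /(congr1 (fun f => f p)) /= ->.
  by have := derive_rtens_t (delta_mx 0 j) sb sp sX => /(congr1 (fun f => f p)) /= ->.
have -> : (fun p : E => z_coord p * tens a b psi X p) = tens (zre a b) (zim a b) psi X.
  apply/funext => p; rewrite /z_coord /tens /rtens /zre /zim; apply: part_eq => -[] /=; ring.
have -> : Cderive (zst 0 0 (delta_mx 0 j) 0) (tens (zre a b) (zim a b) psi X) =
   tens (zre a b) (zim a b) (fun s => 'D_(delta_mx 0 j) psi s) X.
  rewrite Cderive_tens; apply/funext => p.
  have := derive_rtens_s (delta_mx 0 j) szr sp sX => /(congr1 (fun f => f p)) /= ->.
  by have := derive_rtens_s (delta_mx 0 j) szi sp sX => /(congr1 (fun f => f p)) /= ->.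
rewrite addrC => ->; congr (v j _); apply/funext => s.
by apply: pullback_tens; exact: rtest_lip_supp.
Qed.

Lemma equation_tens0 j a b psi X : rtest rho a -> rtest rho b -> rtest rho psi -> rtest rho X ->
  rint_rV X = 0 ->
  f (tens (zre a b) (zim a b) (fun s => 'D_(delta_mx 0 j) psi s) X) =
  f (tens a b psi (fun t => 'D_(delta_mx 0 j) X t)).
Proof.
move=> ta tb tp tX I0; apply/eqP; rewrite -subr_eq0 equation_tens // I0; apply/eqP.
rewrite (_ : (fun s => _) = cx (fun x => 0 * (fun=> 0) x)).
  by rewrite v_scale ?mul0r //; exact: rtest0.
apply/funext => s; rewrite /cx mul0r.
under eq_fun do under eq_fun do rewrite mulr0.
under [X in _ +i* rint X]eq_fun do under eq_fun do rewrite mulr0.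
have E0 : (fun x : R => rint (fun y : R => (0 : R))) = (fun=> 0) by apply/funext => x; exact: rint0.
by rewrite E0 rint0.
Qed.

Variables (eps : R) (eps0 : 0 < eps) (epsr : 2 * eps <= rho).

Local Notation om k := (omega eps k).

Lemma rtest_om k : rtest rho (om k).1 /\ rtest rho (om k).2.
Proof. by have [H1 H2] := rtest_omega eps0 k; split; exact: rtest_leW epsr _. Qed.

Lemma zre_om k : zre (om k.+1).1 (om k.+1).2 = (om k).1.
Proof. by apply/funext => z; have [] := omega_succ eps0 k z. Qed.

Lemma zim_om k : zim (om k.+1).1 (om k.+1).2 = (om k).2.
Proof. by apply/funext => z; have [] := omega_succ eps0 k z. Qed.

Lemma f_tens_add (a1 b1 a2 b2 : P -> R) psi X :
  rtest rho a1 -> rtest rho b1 -> rtest rho a2 -> rtest rho b2 -> rtest rho psi -> rtest rho X ->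
  f (tens (fun z => a1 z + a2 z) (fun z => b1 z + b2 z) psi X) =
  f (tens a1 b1 psi X) + f (tens a2 b2 psi X).
Proof.
move=> t1 t2 t3 t4 tp tX; have := f_lin 1 t1 t2 tp tX t3 t4 tp tX; rewrite mul1r => <-.
congr f; apply/funext => p; rewrite mul1r /tens /rtens; apply: part_eq => -[] /=; ring.
Qed.

Lemma f_tens_scale (d : R) a b psi X : rtest rho a -> rtest rho b -> rtest rho psi -> rtest rho X ->
  f (tens (fun z => d * a z) (fun z => d * b z) psi X) = d%:C * f (tens a b psi X).
Proof.
move=> ta tb tp tX; have t0 := @rtest0 R P rho; have := f_lin d%:C ta tb tp tX t0 t0 tp tX.
rewrite f_tens0 addr0 => <-.
congr f; apply/funext => p; rewrite /tens /rtens; apply: part_eq => -[] /=; ring.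
Qed.

(* z * omega 0 is, up to a constant, the d-bar derivative of a test function. *)
Lemma f_dbar psi X : rtest rho psi -> rtest rho X ->
  f (tens (zre (om 0).1 (om 0).2) (zim (om 0).1 (om 0).2) psi X) = 0.
Proof.
move=> tp tX; have [sp _] := tp; have [sX _] := tX.
have tc := rtest_leW epsr (rtest_cutoff eps0); have [sc _] := tc.
have t0 := @rtest0 R P rho; have [s0 _] := t0.
have [tk _] := rtest_om 0.
have tkx : rtest rho (fun z : P => z.1 * (om 0).1 z) by apply: rtest_mull => //; exact: rsmooth_fst.
have tky : rtest rho (fun z : P => z.2 * (om 0).1 z) by apply: rtest_mull => //; exact: rsmooth_snd.
(* The factor 1/2 of the d-bar operator is absorbed into the cut-off, whose half has partial
   derivatives [d] times x kappa and [d] times y kappa. *)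
pose d : R := - (2 / eps ^+ 2) / 2.
have dn : d != 0 by rewrite mulf_neq0 ?oppr_eq0 ?invr_eq0 // mulf_neq0 // invr_eq0 expf_neq0 // gt_eqF.
have hC : 2^-1 = (2^-1 : R)%:C by rewrite rmorphV /= ?unitfE // rmorph_nat.
have th : rtest rho (fun z : P => 2^-1 * cutoff eps z) by apply: rtest_mull => //; exact: rsmooth_cst.
have [sh _] := th.
have dh (e z : P) : 'D_e (fun z => 2^-1 * cutoff eps z) z = d * ((z.1 * e.1 + z.2 * e.2) * (om 0).1 z).
  have := rderives_scale (2^-1) [:: e] sc => /(congr1 (fun f => f z)) /= ->.
  rewrite derive_cutoff /d /=; ring.
have dz (e z : P) : 'D_e (fun _ : P => 0 : R) z = 0 by exact: derive_cst.
have := hz (proj2 (test_tens tc t0 tp tX)).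
rewrite /dist_dzbar /dist_mul /dist_add /dist_dx /dist_dy /dist_derive /dist_zero hC.
have -> : Cderive (zst 1 0 0 0) (fun p : E => (2^-1 : R)%:C * tens (cutoff eps) (fun=> 0) psi X p) =
   tens (fun z : P => d * (z.1 * (om 0).1 z)) (fun z : P => d * (fun=> 0) z) psi X.
  have -> : (fun p : E => (2^-1 : R)%:C * tens (cutoff eps) (fun=> 0) psi X p) =
     tens (fun z => 2^-1 * cutoff eps z) (fun=> 0) psi X.
    apply/funext => p; rewrite /tens /rtens; apply: part_eq => -[] /=; ring.
  rewrite Cderive_tens; apply/funext => p.
  have := derive_rtens_z 1 0 sh sp sX => /(congr1 (fun f => f p)) /= ->.
  have := derive_rtens_z 1 0 s0 sp sX => /(congr1 (fun f => f p)) /= ->.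
  by rewrite /tens /rtens dh dz /= mulr1 mulr0 addr0 mulr0.
have -> : Cderive (zst 0 1 0 0) (fun p : E => (0 +i* 1) * ((2^-1 : R)%:C * tens (cutoff eps) (fun=> 0) psi X p)) =
   tens (fun z : P => d * (fun=> 0) z) (fun z : P => d * (z.2 * (om 0).1 z)) psi X.
  have -> : (fun p : E => (0 +i* 1) * ((2^-1 : R)%:C * tens (cutoff eps) (fun=> 0) psi X p)) =
     tens (fun=> 0) (fun z => 2^-1 * cutoff eps z) psi X.
    apply/funext => p; rewrite /tens /rtens; apply: part_eq => -[] /=; ring.
  rewrite Cderive_tens; apply/funext => p.
  have := derive_rtens_z 0 1 sh sp sX => /(congr1 (fun f => f p)) /= ->.
  have := derive_rtens_z 0 1 s0 sp sX => /(congr1 (fun f => f p)) /= ->.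
  by rewrite /tens /rtens dh dz /= mulr1 mulr0 add0r mulr0.
rewrite (f_tens_scale d tkx t0 tp tX) (f_tens_scale d t0 tky tp tX) -opprD -mulrDr.
rewrite -(f_tens_add tkx t0 t0 tky tp tX) => /eqP; rewrite oppr_eq0 mulf_eq0.
have dC : (d%:C == 0) = false by apply/negbTE; apply: contra dn => /eqP [->].
rewrite dC /= => /eqP E; rewrite -[RHS]E; congr f; apply/funext => p.
by rewrite /zre /zim /tens /rtens /= !mulr0 subr0 addr0 !add0r.
Qed.

Lemma v_linear_on j re : linear_on rho (fun psi => part re (v j (cx psi))).
Proof.
move=> a psi1 psi2 t1 t2; have [lin _] := hv j.
have := lin a%:C _ _ (test_cx t1) (test_cx t2).
have -> : (fun x => a%:C * cx psi1 x + cx psi2 x) = cx (fun x => a * psi1 x + psi2 x).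
  by apply/funext => x; apply: part_eq => -[] /=; ring.
by move=> ->; rewrite part_add part_real_mul.
Qed.

Definition chain j re k psi X : R :=
  part re (f (tens (om k).1 (om k).2 psi (fun t => 'D_(delta_mx 0 j) X t))).

Lemma chain_linear j re k psi : rtest rho psi -> linear_on rho (chain j re k psi).
Proof.
move=> tp a X1 X2 t1 t2; rewrite /chain; have [q1 q2] := rtest_om k.
have [s1 _] := t1; have [s2 _] := t2.
have d1 := rtest_derive (delta_mx 0 j) t1; have d2 := rtest_derive (delta_mx 0 j) t2.
have := rderives_lin a [:: delta_mx 0 j] s1 s2 => /= ->.
rewrite -part_real_mul -part_add -(f_lin a%:C q1 q2 tp d1 q1 q2 tp d2).
congr (part re (f _)); apply/funext => p; rewrite /tens /rtens; apply: part_eq => -[] /=; ring.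
Qed.

Lemma chain_bounded j re : exists (N : nat) (C A : R), [/\ 0 <= C, 0 <= A &
  forall k psi B, rtest rho psi -> bound_CN N psi B ->
    bounded_on rho N (C * A ^+ k * B) (chain j re k psi)].
Proof.
have [_ bd] := hf; have [C1 [N1 H1]] := bd _ (@compact_ball_E R m rho) ballOm.
have [C2 [A [C20 A0 H2]]] := omega_bound eps0 N1.
(* One order more than for [f] because [X] enters through its derivative; the absolute value because
   the constant of a distribution carries no sign, and 2 for the real and imaginary parts of
   [omega]. *)
exists N1.+1, (`|C1| * 3 ^+ N1 * (2 * C2)), A; split => //.
  by rewrite !mulr_ge0 ?exprn_ge0.
move=> k psi Bp tp Hp X BX tX HX; rewrite /chain; have [q1 q2] := rtest_om k.
have [b1 b2] := H2 k; have [so1 _] := q1; have [so2 _] := q2.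
have [sp _] := tp; have [sX _] := tX; have dX := rtest_derive (delta_mx 0 j) tX; have [sdX _] := dX.
have Hp' : bound_CN N1 psi Bp by move=> x; apply: wbound_leN (Hp x).
have HX' : bound_CN N1 (fun t => 'D_(delta_mx 0 j) X t) BX.
  by move=> x; rewrite -[BX]mulr1; apply: wbound_derive (HX x); exact: delta_mx_norm.
have [tf _] := test_tens q1 q2 tp dX.
have W := H1 _ _ tf (CN_norm_le_tens so1 so2 sp sdX b1 b2 Hp' HX').
apply: le_trans (part_le_normc re _) _; apply: le_trans W _.
have Bp0 := bound_CN_ge0 Hp; have BX0 := bound_CN_ge0 HX.
have CA0 : 0 <= C2 * A ^+ k by rewrite mulr_ge0 ?exprn_ge0.
apply: le_trans (ler_wpM2r _ (ler_norm C1)) _.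
  by rewrite !mulr_ge0 ?exprn_ge0 ?addr_ge0.
by rewrite le_eqVlt; apply/orP; left; apply/eqP; ring.
Qed.

(** The equation of index [i] with weight [omega k.+1], applied to the j-th derivative of [X]: its
    integral is 0, and multiplication by z lowers the weight to [omega k]. *)
Lemma chain_step j re k i psi X : rtest rho psi -> rtest rho X ->
  chain j re k.+1 psi (fun x => 'D_(delta_mx 0 i) X x) =
  chain j re k (fun x => 'D_(delta_mx 0 i) psi x) X.
Proof.
move=> tp tX; rewrite /chain; have [q1 q2] := rtest_om k.+1; have [sX _] := tX.
have dX := rtest_derive (delta_mx 0 j) tX.
rewrite (@derive_comm R V X (delta_mx 0 j) (delta_mx 0 i) sX).
by rewrite -(equation_tens0 i q1 q2 tp dX (rint_rV_derive j (ltW rho0) tX)) zre_om zim_om.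
Qed.

(** The equation of index [j] with [X] itself: the term containing z [omega 0] vanishes by [f_dbar],
    which leaves minus the right-hand side. *)
Lemma chain_base j re psi X : rtest rho psi -> rtest rho X ->
  chain j re 0 psi X = - rint (fun x => rint (fun y => kappa eps (x, y))) * rint_rV X *
    part re (v j (cx psi)).
Proof.
move=> tp tX; rewrite /chain; have [q1 q2] := rtest_om 0.
have dp := rtest_derive (delta_mx 0 j) tp.
have := equation_tens j q1 q2 tp tX.
rewrite (f_dbar dp tX) sub0r => E.
rewrite -[f _]opprK E part_opp.
rewrite (_ : (fun s => _) = cx (fun s => rint (fun x => rint (fun y => kappa eps (x, y))) * rint_rV X * psi s)).
  by rewrite v_scale // part_real_mul !mulNr.
apply/funext => s; apply: part_eq => -[] /=.
  have L0 : 0 <= 2 * eps by rewrite mulr_ge0 // ltW.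
  rewrite -mulrA -(rint_plane_scale _ L0 (rtest_kappa eps0)).
  by congr rint; apply/funext => x; congr rint; apply/funext => y; ring.
have -> : (fun x : R => rint (fun y : R => 0 * psi s * rint_rV X)) = (fun=> 0).
  apply/funext => x; rewrite mul0r mul0r; exact: rint0.
exact: rint0.
Qed.

Lemma v_derivative_bounds j re : exists (N : nat) (C A : R), [/\ 0 <= C, 0 <= A &
  derivative_bounds rho N C A (fun psi => part re (v j (cx psi)))].
Proof.
have [N [C [A [C0 A0 H]]]] := chain_bounded j re.
have c0n : - rint (fun x => rint (fun y => kappa eps (x, y))) != 0.
  by rewrite oppr_eq0 gt_eqF // kappa_integral_pos.
have := derivative_bounds_of_chain rho0 C0 A0 c0n (chain_linear j re) H (chain_step j re)
  (chain_base j re).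
by move=> [C' [A' [H1 H2 H3]]]; exists N, C', A'.
Qed.

End Chain.

(** * Reassembling the complex analytic density *)

Lemma part_sum {R : realType} re (I : finType) (F : I -> R[i]) :
  part re (\sum_i F i) = \sum_i part re (F i).
Proof.
apply: (big_morph _ (id1 := 0) (op1 := +%R)); first exact: part_add.
by case: re.
Qed.

Lemma part_mul_real {R : realType} re (z : R[i]) (a : R) : part re (z * a%:C) = part re z * a.
Proof. by rewrite mulrC part_real_mul mulrC. Qed.

Lemma complex_cvg_geometric {R : realType} (F : nat -> R[i]) (l : R[i]) (K : R) :
  (forall re n, `|part re (F n.+1) - part re l| <= K * 2^-1 ^+ n) ->
  (F : nat -> R[i]^o) @ \oo --> (l : R[i]^o).
Proof.
move=> H; rewrite -(@cvg_shiftS (R[i]^o)); apply/cvgrPdist_le => e e0.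
(* In the order of [R[i]] a positive element is real, so the tolerance is a real number. *)
have eE : e = (complex.Re e)%:C by move: e0; case: e => a b; rewrite ltcE /= => /andP[/eqP -> _].
have r0 : 0 < complex.Re e by move: e0; rewrite eE ltcR.
have h1 : `|2^-1 : R| < 1 by rewrite ger0_norm //; lra.
have := cvg_geometric (K + K) h1 => /cvgr0_norm_le /(_ _ r0); apply: filterS => n /= Hn.
have nE (z : R[i]) : `|z| = (Normc.normc z)%:C by case: z.
rewrite eE nE lecR; apply: le_trans (normc_le _) _.
apply: le_trans (le_trans _ (ler_norm _)) Hn.
have pd re : part re (l - F n.+1) = - (part re (F n.+1) - part re l).
  by rewrite part_add part_opp opprB.
have H1 := H true n; have H2 := H false n.
rewrite -normrN -(pd true) in H1; rewrite -normrN -(pd false) in H2.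
by rewrite mulrDl; apply: lerD.
Qed.

Lemma pseries_abs_sum_parts {R : realType} {m : nat} (c1 c2 : ('I_m -> nat) -> R) (y : 'rV[R]_m)
    (l : R[i]) (K : R) :
  (forall re n, \sum_(f : {ffun 'I_m -> 'I_n})
     `|(if re then c1 else c2) (fun i => f i) * \prod_i y 0 i ^+ f i| <= K) ->
  (forall re n, `|\sum_(f : {ffun 'I_m -> 'I_n.+1})
     (if re then c1 else c2) (fun i => f i) * \prod_i y 0 i ^+ f i - part re l| <= K * 2^-1 ^+ n) ->
  pseries_abs_sum (fun al => c1 al +i* c2 al) y l.
Proof.
move=> H1 H2; split.
  exists (K + K) => n; apply: le_trans (lerD (H1 true n) (H1 false n)).
  rewrite -big_split; apply: ler_sum => f _; apply: le_trans (normc_le _) _.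
  have := part_mul_real true (c1 (fun i => f i) +i* c2 (fun i => f i)) (\prod_i y 0 i ^+ f i).
  have := part_mul_real false (c1 (fun i => f i) +i* c2 (fun i => f i)) (\prod_i y 0 i ^+ f i).
  by rewrite /= => -> ->.
apply: (@complex_cvg_geometric _ _ _ K) => re n; rewrite part_sum.
have -> : \sum_(f : {ffun 'I_m -> 'I_n.+1}) part re ((c1 (fun i => f i) +i* c2 (fun i => f i)) *
     monomial y (fun i => f i)) =
   \sum_(f : {ffun 'I_m -> 'I_n.+1}) (if re then c1 else c2) (fun i => f i) * \prod_i y 0 i ^+ f i.
  by apply: eq_bigr => f _; rewrite /monomial part_mul_real; case: re.
exact: H2.
Qed.

Section AnalyticDistribution.
Context {R : realType} {m : nat}.
Local Notation V := 'rV[R]_m.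

(** The real theory yields densities for the real and imaginary parts of [u] on real test functions;
    complex linearity of [u] extends the representation to complex ones. *)
Lemma real_analytic_of_derivative_bounds (U : set V) (u : (V -> R[i]) -> R[i]) (rho : R) :
  0 < rho -> [set x : V | `|x| <= rho] `<=` U -> is_distribution U u ->
  (forall re, linear_on rho (fun psi => part re (u (cx psi)))) ->
  (forall re, exists (N : nat) (C A : R), [/\ 0 <= C, 0 <= A &
    derivative_bounds rho N C A (fun psi => part re (u (cx psi)))]) ->
  dist_real_analytic_near U u 0.
Proof.
move=> rho0 ballU [lin _] lu bu.
have [N1 [C1 [A1 [C10 A10 H1]]]] := bu true; have [N2 [C2 [A2 [C20 A20 H2]]]] := bu false.
have [r1 [K1 [g1 [c1 [r10 r1r abs1 err1 rep1]]]]] := analytic_of_derivative_bounds rho0 C10 A10 (lu true) H1.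
have [r2 [K2 [g2 [c2 [r20 r2r abs2 err2 rep2]]]]] := analytic_of_derivative_bounds rho0 C20 A20 (lu false) H2.
pose r := Num.min r1 r2.
have r0 : 0 < r by rewrite lt_min r10.
have rr1 : r <= r1 by rewrite ge_min lexx.
have rr2 : r <= r2 by rewrite ge_min lexx orbT.
have rr : r <= rho by exact: le_trans r1r.
exists [set x | `|x| < r], (fun x => g1 x +i* g2 x); split.
- have -> : [set x : V | `|x| < r] = ball 0 r.
    by apply/seteqP; split=> x; rewrite -ball_normE /ball_ /= sub0r normrN.
  exact: ball_open.
- by rewrite /= normr0.
- by move=> x /= xr; apply: ballU; rewrite /= (le_trans (ltW xr)).
- move=> a /= ar; exists (fun al => c1 a al +i* c2 a al), r; split=> // s sr.
  have E : a + (s - a) = s by rewrite addrC subrK.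
  apply: (@pseries_abs_sum_parts _ _ _ _ _ _ (Num.max K1 K2)) => -[] n.
  + by rewrite le_max abs1 //; apply: ltW; apply: lt_le_trans rr1.
  + by rewrite le_max abs2 ?orbT //; apply: ltW; apply: lt_le_trans rr2.
  + rewrite /= -{2}E; apply: (@le_trans _ _ (K1 * 2^-1 ^+ n)).
      by apply: err1; apply: ltW; apply: lt_le_trans rr1.
    by rewrite ler_wpM2r ?exprn_ge0 // le_max lexx.
  + rewrite /= -{2}E; apply: (@le_trans _ _ (K2 * 2^-1 ^+ n)).
      by apply: err2; apply: ltW; apply: lt_le_trans rr2.
    by rewrite ler_wpM2r ?exprn_ge0 // le_max lexx orbT.
- move=> phi [K [_ KW [sphi zphi]]].
  have tp re : rtest r (fun x => part re (phi x)).
    split; first by move/smoothP: sphi; apply.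
    move=> x xr; rewrite zphi; first by case: re.
    by move=> /KW /=; rewrite ltNge (ltW xr).
  have T re : test_fun U (cx (fun x => part re (phi x))).
    apply: (proj2 (test_fun_ball (@compact_norm_le_rV R m rho) ballU _)) => -[] /=.
      exact: rtest_leW (tp re).
    exact: rtest0.
  have t1 := tp true; have t2 := tp false.
  have E : phi = (fun x => (0 +i* 1) * cx (fun x => part false (phi x)) x + cx (fun x => part true (phi x)) x).
    apply/funext => x; apply: part_eq => re; rewrite /cx; case: (phi x) => a b; case: re => /=.
      by rewrite mul0r mulr0 subr0 add0r.
    by rewrite mul0r mul1r add0r addr0.
  have [l11 e11] := rep1 _ (rtest_leW rr1 t1); have [l12 e12] := rep1 _ (rtest_leW rr1 t2).
  have [l21 e21] := rep2 _ (rtest_leW rr2 t1); have [l22 e22] := rep2 _ (rtest_leW rr2 t2).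
  rewrite {1}E lin //; apply: part_eq => re; rewrite /dist_of_fun part_Cintegral_rV part_add.
  case: re.
    have -> : (fun x => part true ((g1 x +i* g2 x) * phi x)) =
      (fun x => -1 * (g2 x * part false (phi x)) + g1 x * part true (phi x)).
      by apply/funext => x; case: (phi x) => a b /=; ring.
    rewrite (rint_rV_lin (-1) (ltW rho0) (lip_supp_le r2r l22) (lip_supp_le r1r l11)) -e11 -e22.
    by congr (_ + _); case: (u (cx (fun x => part false (phi x)))) => a b /=; ring.
  have -> : (fun x => part false ((g1 x +i* g2 x) * phi x)) =
      (fun x => 1 * (g1 x * part false (phi x)) + g2 x * part true (phi x)).
    by apply/funext => x; case: (phi x) => a b /=; ring.
  rewrite (rint_rV_lin 1 (ltW rho0) (lip_supp_le r1r l12) (lip_supp_le r2r l21)) -e12 -e21.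
  by congr (_ + _); case: (u (cx (fun x => part false (phi x)))) => a b /=; ring.
Qed.

End AnalyticDistribution.

Local Close Scope complex_scope.

Theorem theorem2p6 (R : realType) (n : nat) (hn : (1 <= n)%N)
    (U : set 'rV[R]_(n.-1)) (hU : open U) (hU0 : U 0)
    (v : 'I_n.-1 -> ('rV[R]_(n.-1) -> R[i]) -> R[i])
    (hv : forall j, is_distribution U (v j))
    (hf : exists (Omega : set (zst_space R n.-1))
                 (f : (zst_space R n.-1 -> R[i]) -> R[i]),
        [/\ open Omega /\ Omega 0,
            Omega `<=` s_proj @^-1` U,
            is_distribution Omega f,
            dist_eq Omega (dist_dzbar f) dist_zero
          & forall j : 'I_n.-1,
              dist_eq Omega
                (dist_sub (dist_dt j f) (dist_mul z_coord (dist_ds j f)))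
                (dist_pullback_s (v j))]) :
  forall j : 'I_n.-1, dist_real_analytic_near U (v j) 0.
Proof.
move=> j; have [Om [f [[oO O0] OU df hz ht]]] := hf.
have : nbhs (0 : zst_space R n.-1) Om by exact: open_nbhs_nbhs.
move=> /nbhs_ballP[e e0 eO]; have {}e0 : 0 < e by [].
pose rho := e / 2; have rho0 : 0 < rho by rewrite divr_gt0.
have ballO : [set p : zst_space R n.-1 | `|p| <= rho] `<=` Om.
  move=> p /= pr; apply: eO; rewrite -ball_normE /ball_ /= sub0r normrN.
  by apply: le_lt_trans pr _; rewrite /rho; lra.
have ballU : [set x : 'rV[R]_n.-1 | `|x| <= rho] `<=` U.
  (* A point of the s-ball is the projection of a point of the ball in [Om], which lies over [U]. *)
  move=> x /= xr; apply: (OU (zst 0 0 x 0)); apply: ballO.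
  by rewrite /= E_normE /= !normr0 !ge_max xr (ltW rho0).
(* The annular weights are supported in the ball of radius twice their parameter, here exactly
   [rho]. *)
have eps0 : 0 < rho / 2 by rewrite divr_gt0.
have epsr : 2 * (rho / 2) <= rho by rewrite mulrC divfK.
apply: (real_analytic_of_derivative_bounds rho0 ballU (hv j)) => re.
  exact: (v_linear_on ballU hv j re).
exact: (v_derivative_bounds rho0 ballO ballU hv df hz ht eps0 epsr j re).
Qed.
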